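(* Let $(M,g)$ be a compact Kähler manifold with nonnegative holomorphic bisectional curvature, and let $L$ be a solution on $M$ to the nonlinear heat equation $$\frac{\partial}{\partial t}L=\Delta L+|\nabla L|^2+F(L),$$ where $F$ is a convex function of $L$, i.e. $F''(L)\ge0$. If $$\nabla_i\nabla_{\bar j}L+f(t)g_{i\bar j}\ge0$$ at $t=0$, where $f(t)$ satisfies $$f^2(t)-F'(L)f(t)+f'(t)\ge0,$$ then this inequality $\nabla_i\nabla_{\bar j}L+f(t)g_{i\bar j}\ge0$ persists for $t>0$.
   Context: $L$ is a real-valued function of $x\in M$ and time $t$; $F$ is a real function of one real variable with derivatives $F'$, $F''$; $f$ is a real function of $t$ alone with derivative $f'$. The function $f$ is not required to be finite at $t=0$: for $F(L)=aL$ the intended example is $f(t)=\frac{a}{1-e^{-at}}$, which blows up as $t\to0^+$, and then the condition at $t=0$ is understood as $t\to0^+$. The metric $g=(g_{i\bar j})$ is a fixed (time-independent) Kähler metric in local holomorphic coordinates, $\nabla$ is its Levi-Civita connection, $\Delta A=\frac12 g^{k\bar l}(\nabla_k\nabla_{\bar l}+\nabla_{\bar l}\nabla_k)A$ (so $\Delta A=g^{k\bar l}\partial_k\partial_{\bar l}A$ on functions), and $|\nabla L|^2=g^{k\bar l}\nabla_kL\nabla_{\bar l}L$. The curvature is $R_{i\bar jk\bar l}=-g_{p\bar j}\,\partial_{\bar l}\Gamma^p_{ik}$ with $\Gamma^p_{ik}=g^{p\bar q}\partial_k g_{i\bar q}$ (the sign for which complex projective space with the Fubini–Study metric is positive). Nonnegative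 holomorphic bisectional curvature means $R_{i\bar jk\bar l}v^i\overline{v^j}w^k\overline{w^l}\ge0$ for all holomorphic tangent vectors $v,w$ at every point of $M$. An inequality $S_{i\bar j}\ge0$ means that the Hermitian form $S$ is positive semidefinite at each point. *)

(* Defs.v *)
From HB Require Import structures.
From mathcomp Require Import all_boot all_order all_algebra.
From mathcomp Require Import all_classical all_reals all_analysis.
From mathcomp Require Import complex.

Set Implicit Arguments.
Unset Strict Implicit.
Unset Printing Implicit Defensive.

Import Order.TTheory GRing.Theory Num.Theory.
Import numFieldNormedType.Exports.

Local Open Scope classical_set_scope.
Local Open Scope ring_scope.
Local Open Scope complex_scope.

Section Smooth.
Context {R : realType} {V : normedModType R}.

Fixpoint iter_derive (s : seq V) (h : V -> R) : V -> R :=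
  if s is v :: s' then 'D_v (iter_derive s' h) else h.

(* Class C^oo on a set U, which is meant to be open. *)
Definition smooth_on (U : set V) (h : V -> R) :=
  forall s z, U z -> {for z, continuous (iter_derive s h)} /\
                     (forall v, derivable (iter_derive s h) z v).

(* Class C^oo on an arbitrary set D: h extends, near each point of D, to a
   smooth function on an open set.  Used for D = W x [0, T[. *)
Definition smooth_within (D : set V) (h : V -> R) :=
  forall z, D z -> exists N : set V, exists k : V -> R,
    [/\ open N, N z, smooth_on N k & forall y, N y -> D y -> k y = h y].

End Smooth.

(* C^n, seen as a real normed space: (x, y) stands for x + i y. *)
Notation Cn R n := ('rV[R]_n * 'rV[R]_n)%type.

Section Wirtinger.
Context {R : realType} {n : nat}.
Implicit Types (k : 'I_n) (h : Cn R n -> R[i]) (z : Cn R n).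

Definition dirx k : Cn R n := (delta_mx 0 k, 0).
Definition diry k : Cn R n := (0, delta_mx 0 k).

Definition deriveC (v : Cn R n) h z : R[i] :=
  'D_v (fun y => complex.Re (h y)) z +i* 'D_v (fun y => complex.Im (h y)) z.

Definition d_z k h z : R[i] :=
  2^-1 * (deriveC (dirx k) h z - 'i%C * deriveC (diry k) h z).

Definition d_zb k h z : R[i] :=
  2^-1 * (deriveC (dirx k) h z + 'i%C * deriveC (diry k) h z).

Definition smoothC_on (U : set (Cn R n)) h :=
  smooth_on U (fun y => complex.Re (h y)) /\
  smooth_on U (fun y => complex.Im (h y)).

(* Smooth solutions of the Cauchy-Riemann equations in each variable. *)
Definition holomorphic_on (U : set (Cn R n)) h :=
  smoothC_on U h /\ forall k z, U z -> d_zb k h z = 0.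

Definition coordC k z : R[i] := z.1 0 k +i* z.2 0 k.

(* For a Hermitian matrix S = (S_{i \bar j}), the value S_{i \bar j} v^i \bar v^j.
   In the order of R[i], 0 <= w means that w is real and nonnegative. *)
Definition hform (S : 'M[R[i]]_n) (v : 'rV[R[i]]_n) : R[i] :=
  \sum_i \sum_j S i j * v 0 i * (v 0 j)^*.

Definition psd (S : 'M[R[i]]_n) := forall v, 0 <= hform S v.

Definition posdef (S : 'M[R[i]]_n) := forall v, v != 0 -> 0 < hform S v.

End Wirtinger.

(* A holomorphic atlas of complex dimension n on a Hausdorff space M.  For an
   index a, chart a : dom a -> cod a is a homeomorphism between open sets, with
   inverse param a; the values of chart a and param a elsewhere are irrelevant. *)
Record complex_atlas (R : realType) (n : nat) (M : topologicalType) := ComplexAtlas {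
  index : Type;
  dom : index -> set M;
  cod : index -> set (Cn R n);
  chart : index -> M -> Cn R n;
  param : index -> Cn R n -> M;
  atlas_hausdorff : hausdorff_space M;
  atlas_cover : forall p, exists a, dom a p;
  dom_open : forall a, open (dom a);
  cod_open : forall a, open (cod a);
  chart_cod : forall a p, dom a p -> cod a (chart a p);
  param_dom : forall a z, cod a z -> dom a (param a z);
  chartK : forall a p, dom a p -> param a (chart a p) = p;
  paramK : forall a z, cod a z -> chart a (param a z) = z;
  chart_continuous : forall a p, dom a p -> {for p, continuous (chart a)};
  param_continuous : forall a z, cod a z -> {for z, continuous (param a)};
  transition_holomorphic : forall a b k,
    holomorphic_on (cod a `&` param a @^-1` dom b)
                   (fun z => coordC k (chart b (param a z)))
}.

(* A Kaehler metric, given by its matrices g_{i \bar j} in the charts. *)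
Record kahler_metric (R : realType) (n : nat) (M : topologicalType)
    (A : complex_atlas R n M) := KahlerMetric {
  gmx : index A -> Cn R n -> 'M[R[i]]_n;
  gmx_smooth : forall a i j, smoothC_on (cod a) (fun z => gmx a z i j);
  gmx_hermitian : forall a z i j, cod a z -> gmx a z j i = (gmx a z i j)^*;
  gmx_posdef : forall a z, cod a z -> posdef (gmx a z);
  gmx_transition : forall a b z, cod a z -> dom b (param a z) ->
    forall i j, gmx a z i j =
      \sum_p \sum_q d_z i (fun y => coordC p (chart b (param a y))) z
                  * (d_z j (fun y => coordC q (chart b (param a y))) z)^*
                  * gmx b (chart b (param a z)) p q;
  (* The Kaehler form i g_{i \bar j} dz^i /\ d\bar z^j is closed: the conditions
     are the vanishing of the (2,1) and of the (1,2) part of its differential. *)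
  gmx_closed : forall a z i j k, cod a z ->
    d_z k (fun y => gmx a y i j) z = d_z i (fun y => gmx a y k j) z /\
    d_zb k (fun y => gmx a y i j) z = d_zb j (fun y => gmx a y i k) z
}.

(* Local geometry of a Hermitian matrix G = (g_{i \bar j}) on an open set of C^n. *)
Section LocalGeometry.
Context {R : realType} {n : nat}.
Context (G : Cn R n -> 'M[R[i]]_n).
Implicit Types (i j k l p q : 'I_n) (A B C D : 'I_(n + n)).
Implicit Types (h : Cn R n -> R[i]) (z : Cn R n).

(* g^{p \bar q}, normalized by g^{p \bar q} g_{i \bar q} = delta^p_i; hence the
   exchange of the indices. *)
Definition ginv z p q : R[i] := invmx (G z) q p.

(* Indices of the complexified tangent space: lshift n i is the holomorphic
   index i and rshift n i is the conjugate index \bar i. *)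
Definition d_c A h z : R[i] :=
  match fintype.split A with inl k => d_z k h z | inr k => d_zb k h z end.

(* Complex bilinear extension of the metric: g_{ij} = g_{\bar i \bar j} = 0 and
   g_{\bar j i} = g_{i \bar j}. *)
Definition gC z : 'M[R[i]]_(n + n) := block_mx 0 (G z) (G z)^T 0.

(* The symbols Gamma^C_{AB} of the Levi-Civita connection (Koszul formula). *)
Definition christoffel C A B z : R[i] :=
  2^-1 * \sum_D invmx (gC z) C D *
    (d_c A (fun y => gC y B D) z + d_c B (fun y => gC y A D) z
     - d_c D (fun y => gC y A B) z).

(* nabla_A nabla_B h = d_A d_B h - Gamma^C_{AB} d_C h *)
Definition nabla2 A B h z : R[i] :=
  d_c A (d_c B h) z - \sum_C christoffel C A B z * d_c C h z.

(* The matrix nabla_i nabla_{\bar j} h *)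
Definition chess h z : 'M[R[i]]_n :=
  \matrix_(i, j) nabla2 (lshift n i) (rshift n j) h z.

Definition laplacian h z : R[i] :=
  2^-1 * \sum_k \sum_l ginv z k l *
    (nabla2 (lshift n k) (rshift n l) h z + nabla2 (rshift n l) (lshift n k) h z).

Definition grad_sqr h z : R[i] :=
  \sum_k \sum_l ginv z k l * d_z k h z * d_zb l h z.

(* Gamma^p_{ik} = g^{p \bar q} d_k g_{i \bar q} *)
Definition gammaK p i k z : R[i] :=
  \sum_q ginv z p q * d_z k (fun y => G y i q) z.

(* R_{i \bar j k \bar l} = - g_{p \bar j} d_{\bar l} Gamma^p_{ik} *)
Definition curvature i j k l z : R[i] :=
  - \sum_p G z p j * d_zb l (gammaK p i k) z.

Definition bisectional z (v w : 'rV[R[i]]_n) : R[i] :=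
  \sum_i \sum_j \sum_k \sum_l
    curvature i j k l z * v 0 i * (v 0 j)^* * w 0 k * (w 0 l)^*.

End LocalGeometry.

Section Kahler.
Context {R : realType} {n : nat} {M : topologicalType} {A : complex_atlas R n M}.
Implicit Types (g : kahler_metric A) (L : M -> R -> R) (T : \bar R).

Definition nonneg_bisectional g :=
  forall a z, cod a z -> forall v w, 0 <= bisectional (gmx g a) z v w.

(* L(., t) in the chart a *)
Definition local_fun L (a : index A) (t : R) (z : Cn R n) : R[i] :=
  (L (param a z) t)%:C.

(* L is of class C^oo on M x [0, T[. *)
Definition smooth_spacetime T L :=
  forall a : index A,
    smooth_within [set x : Cn R n * R^o | [/\ cod a x.1, 0 <= x.2 & (x.2%:E < T)%E]]
                  (fun x => L (param a x.1) x.2).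

Definition heat_solution g T L (F : R -> R) :=
  smooth_spacetime T L /\
  forall a z t, cod a z -> 0 < t -> (t%:E < T)%E ->
    (derive1 (L (param a z)) t)%:C =
      laplacian (gmx g a) (local_fun L a t) z
      + grad_sqr (gmx g a) (local_fun L a t) z + (F (L (param a z) t))%:C.

(* nabla_i nabla_{\bar j} L + c g_{i \bar j} at time t *)
Definition hess_plus g L (a : index A) (t c : R) (z : Cn R n) : 'M[R[i]]_n :=
  chess (gmx g a) (local_fun L a t) z + c%:C *: gmx g a z.

Definition hess_ineq g L (f : R -> R) (t : R) :=
  forall a z, cod a z -> psd (hess_plus g L a t (f t) z).

(* The inequality at t = 0, read as a lower limit when t -> 0+ since f may blow
   up there: at each point, for each e > 0, the form plus e g is nonnegative for
   all small t > 0.  When f has a finite limit f0 at 0+ and L is smooth up to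
   t = 0, this is nabla_i nabla_{\bar j} L + f0 g_{i \bar j} >= 0 at t = 0. *)
Definition hess_ineq_initial g L (f : R -> R) :=
  forall a z, cod a z -> forall e : R, 0 < e ->
    \forall t \near 0^'+, psd (hess_plus g L a t (f t + e) z).

End Kahler.

(* Main.v *)
(* Hamilton's tensor maximum principle.  For e, K > 0 put psi = f + e exp(K t) and
   N = nabla \bar nabla L + psi g.  By the condition at t = 0 and compactness, N > 0 for
   small t.  At the first time where N has a null vector v, at a point z, extend v
   with constant coefficients in a chart around z, and differentiate the heat
   equation along v and \bar v.  Three facts control the result:
   - N is a closed form, N >= 0 near z and N v = 0 at z, so the second covariant
     derivative of N along v and \bar v is positive semidefinite at z (vary v to first
     order as well); it agrees with that of nabla \bar nabla L, since nabla g = 0;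
   - the curvature term left over is tr (g^-1 R(., ., v, \bar v) g^-1 N) >= 0;
   - |nabla L|^2 contributes |nabla_v nabla L|^2 + |nabla_v \bar nabla L|^2 and a
     multiple of nabla N(v, v) = 0, where |nabla_v \bar nabla L|^2 = psi^2 g(v, v) by N v = 0, while
     F(L) contributes at least F'(L) nabla_v \bar nabla_v L = - F'(L) psi g(v, v).
   Hence d/dt N(v, v) >= (psi^2 - F'(L) psi + psi') g(v, v), and this is positive when K
   exceeds F'(L) - 2 f on M x ]0, t1].  But N(v, v) decreases to 0: a contradiction.
   Finally e tends to 0. *)

Require Import Defs.
From HB Require Import structures.
From mathcomp Require Import all_boot all_order all_algebra.
From mathcomp Require Import all_classical all_reals all_analysis.
From mathcomp Require Import complex ring lra.

Set Implicit Arguments.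
Unset Strict Implicit.
Unset Printing Implicit Defensive.

Import Order.TTheory GRing.Theory Num.Theory.
Import numFieldNormedType.Exports.

Local Open Scope classical_set_scope.
Local Open Scope ring_scope.
Local Open Scope complex_scope.

(** * Hermitian matrices *)

(** Delta L + |nabla L|^2 is the single trace tr (G^-1 S) with S = H + b b^H, where H is the complex
    Hessian of L and b the column of the d_k L. One second variation of such a trace along v and its
    conjugate therefore replaces separate commutation formulas for the Laplacian and the gradient
    term. With H = N - psi G, the two curvature terms that psi G produces cancel exactly, so no
    Ricci term survives.

    A vector with constant coefficients in a chart is not parallel. In place of normal coordinates,
    it is moved to v - s a along the line z + s w, and a = w (DG) G^-1 supplies the Christoffel
    corrections.

    The obstacle at t = 0 is that f may blow up there and that the condition is given point by
    point. Tested on one vector, it bounds f from below near 0. With this bound, positivity for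
    small t becomes uniform near each point, and F'(L) - 2 f is bounded above down to t = 0, which
    makes K finite. With E = e exp(K t), psi^2 - F' psi + psi' exceeds f^2 - F' f + f' by exactly E
    (2 f + E - F' + K). *)

Section HermitianForms.
Context {R : realType}.
Local Notation C := R[i].

Lemma conjcM (x y : C) : conjc (x * y) = conjc x * conjc y.
Proof. exact: rmorphM. Qed.

Lemma conjcD (x y : C) : conjc (x + y) = conjc x + conjc y.
Proof. exact: raddfD. Qed.

Lemma conjcN (x : C) : conjc (- x) = - conjc x.
Proof. exact: raddfN. Qed.

Lemma conjcR (x : R) : conjc (x%:C : C) = x%:C.
Proof. by rewrite /conjc /= oppr0. Qed.

Lemma conjc_sum (I : Type) (r : seq I) (P : pred I) (h : I -> C) :
  conjc (\sum_(i <- r | P i) h i) = \sum_(i <- r | P i) conjc (h i).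
Proof. exact: (raddf_sum (@conjc R)). Qed.

Definition adjm m n (S : 'M[C]_(m, n)) : 'M[C]_(n, m) := map_mx conjc S^T.
Local Notation "S ^H" := (adjm S) (at level 8, format "S ^H").

Lemma adjmE m n (S : 'M[C]_(m, n)) i j : S^H i j = conjc (S j i).
Proof. by rewrite !mxE. Qed.

Lemma adjmM m n p (S : 'M[C]_(m, n)) (S' : 'M[C]_(n, p)) :
  (S *m S')^H = S'^H *m S^H.
Proof. by rewrite /adjm trmx_mul map_mxM. Qed.

Lemma adjmD m n (S S' : 'M[C]_(m, n)) : (S + S')^H = S^H + S'^H.
Proof. by rewrite /adjm linearD map_mxD. Qed.

Lemma adjmN m n (S : 'M[C]_(m, n)) : (- S)^H = - S^H.
Proof. by rewrite /adjm linearN map_mxN. Qed.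

Lemma adjmB m n (S S' : 'M[C]_(m, n)) : (S - S')^H = S^H - S'^H.
Proof. by rewrite adjmD adjmN. Qed.

Lemma adjmZ m n a (S : 'M[C]_(m, n)) : (a *: S)^H = conjc a *: S^H.
Proof. by rewrite /adjm linearZ map_mxZ. Qed.

Lemma adjmK m n (S : 'M[C]_(m, n)) : S^H^H = S.
Proof. by apply/matrixP => i j; rewrite !mxE conjcK. Qed.

Lemma adjm1 n : (1%:M : 'M[C]_n)^H = 1%:M.
Proof. by rewrite /adjm trmx1 map_mx1. Qed.

Lemma hformE n (S : 'M[C]_n) v : hform S v = (v *m S *m v^H) 0 0.
Proof.
rewrite /hform mxE exchange_big; apply: eq_bigr => j _.
rewrite adjmE mxE big_distrl; apply: eq_bigr => i _.
by rewrite [S i j * _]mulrC.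
Qed.

Lemma hformD n (S S' : 'M[C]_n) v : hform (S + S') v = hform S v + hform S' v.
Proof. by rewrite !hformE mulmxDr mulmxDl mxE. Qed.

Lemma hformZ n a (S : 'M[C]_n) v : hform (a *: S) v = a * hform S v.
Proof. by rewrite !hformE -scalemxAr -scalemxAl mxE. Qed.

Lemma hform0 n (S : 'M[C]_n) : hform S 0 = 0.
Proof. by rewrite hformE !mul0mx mxE. Qed.

Lemma hform_congr m n (J : 'M[C]_(m, n)) (S : 'M[C]_n) v :
  hform (J *m S *m J^H) v = hform S (v *m J).
Proof. by rewrite !hformE adjmM !mulmxA. Qed.

Lemma psd_congr m n (J : 'M[C]_(m, n)) (S : 'M[C]_n) :
  psd S -> psd (J *m S *m J^H).
Proof. by move=> S0 v; rewrite hform_congr. Qed.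

Lemma hform_herm_conj n (S : 'M[C]_n) v : S^H = S -> conjc (hform S v) = hform S v.
Proof.
move=> SH; rewrite hformE -adjmE; congr (fun_of_matrix _ 0 0).
by rewrite !adjmM adjmK SH mulmxA.
Qed.

Lemma hform_herm_Im n (S : 'M[C]_n) v : S^H = S -> complex.Im (hform S v) = 0.
Proof.
move=> /(@hform_herm_conj _ _ v); case: (hform S v) => x y /= [] yN; lra.
Qed.

Lemma hform_ge0 n (S : 'M[C]_n) v : S^H = S ->
  (0 <= hform S v) = (0 <= complex.Re (hform S v)).
Proof. by move=> SH; rewrite lecE (hform_herm_Im _ SH) /= eqxx. Qed.

Lemma hform_gt0 n (S : 'M[C]_n) v : S^H = S ->
  (0 < hform S v) = (0 < complex.Re (hform S v)).
Proof. by move=> SH; rewrite ltcE (hform_herm_Im _ SH) /= eqxx. Qed.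

Lemma posdef_psd n (S : 'M[C]_n) : posdef S -> psd S.
Proof.
by move=> S0 v; have [->|/S0/ltW//] := eqVneq v 0; rewrite hform0.
Qed.

Lemma psd_outer n (u : 'cV[C]_n) : psd (u *m u^H).
Proof.
move=> v; rewrite hformE !mulmxA -mulmxA -adjmM mxE.
apply: sumr_ge0 => i _; rewrite adjmE; exact: mulcJ_ge0.
Qed.

Definition nsq n (v : 'rV[C]_n) : R :=
  \sum_i (complex.Re (v 0 i) ^+ 2 + complex.Im (v 0 i) ^+ 2).

Lemma nsqE n (v : 'rV[C]_n) : (nsq v)%:C = \sum_i v 0 i * conjc (v 0 i).
Proof.
rewrite rmorph_sum; apply: eq_bigr => i _; case: (v 0 i) => x y.
by apply/eqP; rewrite eq_complex /= !mulrN opprK -!expr2 [y * x]mulrC addNr !eqxx.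
Qed.

Lemma nsq_ge0 n (v : 'rV[C]_n) : 0 <= nsq v.
Proof. by apply: sumr_ge0 => i _; rewrite addr_ge0 ?sqr_ge0. Qed.

Lemma nsq_gt0 n (v : 'rV[C]_n) : v != 0 -> 0 < nsq v.
Proof.
move=> v0; rewrite lt_neqAle nsq_ge0 andbT eq_sym; apply: contra v0.
rewrite psumr_eq0 => [|i _]; last by rewrite addr_ge0 ?sqr_ge0.
move=> /allP v0; apply/eqP/rowP => i; rewrite mxE.
have := v0 i; rewrite mem_index_enum => /(_ isT).
rewrite paddr_eq0 ?sqr_ge0 // !sqrf_eq0 => /andP[/eqP + /eqP].
by case: (v 0 i) => x y /= -> ->.
Qed.

Lemma nsq_mul n (v : 'rV[C]_n) : v *m v^H = ((nsq v)%:C)%:M.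
Proof.
apply/matrixP => i j; rewrite !ord1 !mxE eqxx mulr1n nsqE.
by apply: eq_bigr => k _; rewrite adjmE.
Qed.

(** With u = v S, the form on v - s u equals s (s c - 2 |u|^2), where c is the form on u. For s =
    |u|^2 / (c + 1) this is negative unless u = 0. *)
Lemma psd_kernel n (S : 'M[C]_n) v : S^H = S -> psd S -> hform S v = 0 ->
  S *m v^H = 0.
Proof.
move=> SH S0 v0; set u := v *m S.
have uE : u^H = S *m v^H by rewrite adjmM SH.
rewrite -uE; suff -> : u = 0 by apply/matrixP => i j; rewrite !mxE conjc0.
apply/eqP; apply: contraT => /nsq_gt0 u0.
set c := complex.Re (hform S u).
have cE : hform S u = c%:C.
  by rewrite [LHS]complexE (hform_herm_Im _ SH) mulr0 addr0.
have c0 : 0 <= c by have := S0 u; rewrite cE ler0c.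
pose s : R := nsq u / (c + 1).
have s0 : 0 < s by rewrite divr_gt0 // ltr_wpDl.
have := S0 (v - s%:C *: u).
have -> : hform S (v - s%:C *: u) =
    (s * (s * c - 2 * nsq u))%:C.
  rewrite hformE adjmB adjmZ !mulmxBl !mulmxBr -!scalemxAl -!scalemxAr.
  have e0 : (u *m v^H) 0 0 = 0 by rewrite -hformE.
  have e1 : (u *m S *m u^H) 0 0 = c%:C by rewrite -hformE.
  rewrite -[u *m S *m v^H]mulmxA -uE -/u nsq_mul.
  have -> : conjc (s%:C) = s%:C by apply/eqP; rewrite eq_complex /= oppr0 !eqxx.
  move: e0 e1; rewrite !mxE => -> ->; rewrite eqxx !mulr1n.
  rewrite !rmorphM !rmorphB !rmorphM /= rmorph_nat; ring.
rewrite ler0c pmulr_rge0 // subr_ge0 /s => h.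
have : nsq u / (c + 1) * c < 2 * nsq u.
  rewrite mulrAC ltr_pdivrMr; nra.
by rewrite ltNge h.
Qed.

Lemma posdef_unit n (S : 'M[C]_n) : posdef S -> S \in unitmx.
Proof.
move=> S0; rewrite -row_free_unit -kermx_eq0; apply/eqP/row_matrixP => i.
rewrite row0; apply/eqP; apply: contraT => /S0.
by rewrite hformE -row_mul mulmx_ker row0 mul0mx mxE ltxx.
Qed.

Lemma invmx_herm n (S : 'M[C]_n) : S^H = S -> S \in unitmx -> (invmx S)^H = invmx S.
Proof.
move=> SH Su; rewrite -[LHS](mulmxK Su) -{2}SH -adjmM mulmxV //.
by rewrite adjm1 mul1mx.
Qed.

Lemma posdef_inv n (S : 'M[C]_n) : S^H = S -> posdef S -> psd (invmx S).
Proof.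
move=> SH S0; have Su := posdef_unit S0.
have -> : invmx S = invmx S *m S *m (invmx S)^H.
  by rewrite invmx_herm // mulVmx // mul1mx.
exact/psd_congr/posdef_psd.
Qed.

(** An explicit constant instead of compactness of the sphere: row i of P = S^-1 represents the i-th
    coordinate for the form S, so Cauchy-Schwarz gives |v_i|^2 <= P_ii S(v, v). Summing over i
    yields c = 1 / (1 + tr P); the 1 keeps the denominator positive in dimension 0. *)
Lemma posdef_lower n (S : 'M[C]_n) : S^H = S -> posdef S ->
  exists2 c : R, 0 < c & forall v, c * nsq v <= complex.Re (hform S v).
Proof.
move=> SH S0; have Su := posdef_unit S0; pose P := invmx S.
have PH : P^H = P by exact: invmx_herm.
pose d i := complex.Re (P i i).
have dE i : hform S (row i P) = (d i)%:C.
  have -> : hform S (row i P) = P i i.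
    rewrite hformE -row_mul /P mulVmx //.
    by rewrite rowE mulmx1 mxE (bigD1 i) //= big1 ?addr0 => [|k /negPf ki];
       rewrite ?adjmE !mxE ?eqxx ?ki ?andbF ?mul0r // mul1r -[LHS]adjmE PH.
  have : conjc (P i i) = P i i by rewrite -[LHS]adjmE PH.
  rewrite /d; case: (P i i) => x y [] yN; congr (_ +i* _); rewrite /=; lra.
have d0 i : 0 < d i.
  rewrite -ltcR -dE; apply: S0; apply/eqP => /(congr1 (mulmx^~ S)).
  rewrite -row_mul mulVmx // mul0mx => /rowP/(_ i)/eqP.
  by rewrite !mxE eqxx oner_eq0.
have key (v : 'rV[C]_n) i : complex.Re (v 0 i) ^+ 2 + complex.Im (v 0 i) ^+ 2 <=
    d i * complex.Re (hform S v).
  have uS : S *m (row i P)^H = (delta_mx 0 i)^H.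
    rewrite -{1}SH -adjmM -row_mul mulVmx //; congr (_^H).
    by apply/rowP => k; rewrite !mxE eqxx eq_sym.
  have uS' : row i P *m S = delta_mx 0 i.
    by rewrite -row_mul mulVmx //; apply/rowP => k; rewrite !mxE eqxx eq_sym.
  (* Cauchy-Schwarz: subtract from [v] its S-orthogonal projection on row i of [P]. *)
  have := posdef_psd S0 (v - (v 0 i / (d i)%:C) *: row i P).
  have -> : hform S (v - (v 0 i / (d i)%:C) *: row i P) =
     hform S v - (v 0 i * conjc (v 0 i)) / (d i)%:C.
    rewrite hformE adjmB adjmZ !mulmxBl !mulmxBr -!scalemxAl -!scalemxAr.
    rewrite -[v *m S *m (row i P)^H]mulmxA uS uS'.
    have e1 : (v *m (delta_mx 0 i : 'rV[C]_n)^H) 0 0 = v 0 i.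
      rewrite mxE (bigD1 i) //= adjmE mxE !eqxx big1 ?addr0 ?conjc1 ?mulr1 //.
      by move=> k /negPf ki; rewrite adjmE mxE ki andbF conjc0 mulr0.
    have e2 : ((delta_mx 0 i : 'rV[C]_n) *m v^H) 0 0 = conjc (v 0 i).
      by rewrite -rowE mxE adjmE.
    have e3 : ((delta_mx 0 i : 'rV[C]_n) *m (row i P)^H) 0 0 = (d i)%:C.
      by have := dE i; rewrite hformE uS'.
    rewrite !mxE; move: e1 e2 e3; rewrite !mxE => -> -> ->.
    have -> : conjc (v 0 i / (d i)%:C) = conjc (v 0 i) / (d i)%:C.
      by rewrite conjcM -fmorphV conjcR.
    rewrite hformE mxE.
    have dn0 : (d i)%:C != 0 :> C by rewrite fmorph_eq0 gt_eqF.
    by field.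
  have -> : v 0 i * conjc (v 0 i) =
      (complex.Re (v 0 i) ^+ 2 + complex.Im (v 0 i) ^+ 2)%:C.
    by rewrite add_Re2_Im2 sqr_normc.
  rewrite -fmorphV -rmorphM lecE /= => /andP[_].
  case: (hform S v) => x y /=; rewrite subr_ge0 ler_pdivrMr // [d i * _]mulrC.
  by [].
exists (1 + \sum_i d i)^-1 => [|v].
  by rewrite invr_gt0 ltr_pwDl // sumr_ge0 // => i _; exact: ltW.
have D0 : 0 <= \sum_i d i by rewrite sumr_ge0 // => i _; exact: ltW.
have h0 : 0 <= complex.Re (hform S v) by rewrite -hform_ge0 //; exact: posdef_psd.
rewrite ler_pdivrMl ?ltr_pwDl // mulrDl mul1r; apply: ler_wpDl => //.
by rewrite mulr_suml; apply: ler_sum.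
Qed.

(** Diagonalize S in a unitary basis: the trace becomes the sum of the eigenvalues of S, each
    weighted by the value of S' on the corresponding basis vector. *)
Lemma tr_psd_ge0 n (S S' : 'M[C]_n) : S^H = S -> psd S -> psd S' ->
  0 <= \tr (S *m S').
Proof.
move=> SH S0 S'0.
have Snormal : S \is normalmx.
  apply/normalmxP; suff -> : map_mx Num.conj S^T = S by [].
  by rewrite -[RHS]SH; apply/matrixP => i j; rewrite !mxE.
have /orthomx_spectralP SE := Snormal.
set U := spectralmx S in SE *; set d := spectral_diag S in SE *.
have Uu : U \in unitmx := spectral_unit S.
have UV : invmx U = U^H.
  by rewrite invmx_unitary ?spectral_unitarymx.
rewrite UV in SE.
have hE (S1 : 'M[C]_n) k : (U *m S1 *m U^H) k k = hform S1 (row k U).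
  rewrite hformE -row_mul mxE [RHS]mxE; apply: eq_bigr => j _.
  by rewrite !mxE.
have UU : U *m U^H = 1%:M by rewrite -UV mulmxV.
have dE k : d 0 k = hform S (row k U).
  rewrite -hE SE !mulmxA UU mul1mx -mulmxA UU mulmx1 mxE eqxx mulr1n.
  by [].
rewrite SE -!mulmxA mxtrace_mulC -!mulmxA mxtrace_mulC.
rewrite /mxtrace; apply: sumr_ge0 => k _.
rewrite mxE (bigD1 k) //= big1 ?addr0 => [|j jk].
  by rewrite mulmxA hE mxE eqxx mulr1n dE mulr_ge0.
by rewrite [diag_mx _ _ _]mxE (negPf jk) mulr0n mulr0.
Qed.

(** An entrywise norm: continuity of the entries makes it small, and it bounds the form uniformly in
    the vector. *)
Definition mnorm n (S : 'M[C]_n) : R :=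
  \sum_i \sum_j (`|complex.Re (S i j)| + `|complex.Im (S i j)|).

Lemma mnorm_ge0 n (S : 'M[C]_n) : 0 <= mnorm S.
Proof. by do 2 apply: sumr_ge0 => ? _; rewrite addr_ge0. Qed.

Lemma hform_bound n (S : 'M[C]_n) v :
  `|complex.Re (hform S v)| <= mnorm S * nsq v.
Proof.
have key i j : `|complex.Re (S i j * v 0 i * conjc (v 0 j))| <=
    (`|complex.Re (S i j)| + `|complex.Im (S i j)|) * nsq v.
  rewrite -mulrA; set w := v 0 i * conjc (v 0 j).
  have le_nsq k : complex.Re (v 0 k) ^+ 2 + complex.Im (v 0 k) ^+ 2 <= nsq v.
    rewrite /nsq (bigD1 k) //= lerDl; apply: sumr_ge0 => l _.
    by rewrite addr_ge0 ?sqr_ge0.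
  have := le_nsq i; have := le_nsq j.
  have [] : `|complex.Re w| <= nsq v /\ `|complex.Im w| <= nsq v.
    have := le_nsq i; have := le_nsq j; rewrite /w.
    case: (v 0 i) => a b; case: (v 0 j) => c d /= h1 h2.
    have := sqr_ge0 (a - c); have := sqr_ge0 (b - d).
    have := sqr_ge0 (a + c); have := sqr_ge0 (b + d).
    have := sqr_ge0 (a - d); have := sqr_ge0 (b - c).
    have := sqr_ge0 (a + d); have := sqr_ge0 (b + c).
    by split; rewrite ler_norml; apply/andP; split; nra.
  move: (nsq v) => N; case: w => p q; case: (S i j) => a b /= hp hq _ _.
  rewrite mulrDl (le_trans (ler_normB _ _)) // !normrM lerD // ler_wpM2l //.
rewrite /hform /mnorm mulr_suml.
have ReS (I : finType) (h : I -> C) :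
    complex.Re (\sum_i h i) = \sum_i complex.Re (h i).
  by apply: (big_morph (@complex.Re R)) => // -[? ?] [? ?].
rewrite ReS (le_trans (ler_norm_sum _ _ _)) //; apply: ler_sum => i _.
rewrite ReS mulr_suml (le_trans (ler_norm_sum _ _ _)) //.
by apply: ler_sum => j _.
Qed.

End HermitianForms.

Local Notation "S ^H" := (adjm S) (at level 8, format "S ^H").

Lemma mxtraceB (V : pzRingType) m (S S' : 'M[V]_m) :
  \tr (S - S') = \tr S - \tr S'.
Proof. exact: raddfB. Qed.

Lemma mxtraceN (V : pzRingType) m (S : 'M[V]_m) : \tr (- S) = - \tr S.
Proof. exact: raddfN. Qed.

(** * Second variation of tr (G^-1 S) and its curvature term *)

Section TraceVariation.
Context {V : comNzRingType} {n : nat}.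
Variables (G P DG DbG DDbG : 'M[V]_n).

(* P is G^-1, and DX, DbX, DDbX are the derivatives of X = G, S along a constant
   vector v, its conjugate and both.  Then cov2 is the second covariant derivative
   of S along v and \bar v, and trvar is the second derivative of tr (P S). *)
Definition cov2 (S DS DbS DDbS : 'M[V]_n) :=
  DDbS - DG *m P *m DbS - DS *m (P *m DbG) + DG *m P *m S *m (P *m DbG).

Definition trvar (S DS DbS DDbS : 'M[V]_n) :=
  \tr ((P *m DG *m P *m DbG *m P + P *m DbG *m P *m DG *m P
        - P *m DDbG *m P) *m S)
  - \tr (P *m DbG *m P *m DS) - \tr (P *m DG *m P *m DbS) + \tr (P *m DDbS).

(** The commutation formula in matrix form. [DG *m P *m DbG - DDbG] is the curvature in the
    directions v and \bar v (see [bisectionalE]), and completing the derivatives of S to [cov2]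
    leaves just this term, by cyclicity of the trace. *)
Lemma trvarE S DS DbS DDbS :
  trvar S DS DbS DDbS =
    \tr (P *m (DG *m P *m DbG - DDbG) *m P *m S) + \tr (P *m cov2 S DS DbS DDbS).
Proof.
rewrite /trvar /cov2 !(mulmxDl, mulmxDr, mulmxBl, mulmxBr, mulNmx, mulmxN).
rewrite !(mxtraceD, mxtraceB, mxtraceN) !mulmxA.
have -> : \tr (P *m DbG *m P *m DG *m P *m S) =
    \tr (P *m DG *m P *m S *m P *m DbG).
  by rewrite -[P *m DbG *m P *m DG]mulmxA -!mulmxA mulmxA mxtrace_mulC !mulmxA.
have -> : \tr (P *m DbG *m P *m DS) = \tr (P *m DS *m P *m DbG).
  by rewrite -[in LHS]mulmxA mxtrace_mulC !mulmxA.
move: (\tr _) (\tr _) (\tr _) (\tr _) (\tr _) (\tr _) => *; ring.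
Qed.

(** The right side is what the product rule yields when each derivative of P is replaced by -P
    (derivative of G) P. *)
Lemma trvar_inv S DS DbS DDbS :
  trvar S DS DbS DDbS =
  \tr (- ((- (P *m DG *m P) *m DbG + P *m DDbG) *m P +
          P *m DbG *m - (P *m DG *m P)) *m S +
        - (P *m DbG *m P) *m DS + (- (P *m DG *m P) *m DbS + P *m DDbS)).
Proof.
rewrite /trvar !(mulmxDl, mulmxDr, mulmxBl, mulmxBr, mulNmx, mulmxN) !mulmxA.
rewrite !(opprD, opprK, mxtraceD, mxtraceB, mxtraceN, mulmxDl, mulNmx).
move: (\tr _) (\tr _) (\tr _) (\tr _) (\tr _) (\tr _) => *; ring.
Qed.

Lemma cov2D S DS DbS DDbS S' DS' DbS' DDbS' :
  cov2 (S + S') (DS + DS') (DbS + DbS') (DDbS + DDbS') =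
    cov2 S DS DbS DDbS + cov2 S' DS' DbS' DDbS'.
Proof.
rewrite /cov2 !(mulmxDl, mulmxDr); apply/matrixP => i j; rewrite !mxE; ring.
Qed.

Lemma cov2Z a S DS DbS DDbS :
  cov2 (a *: S) (a *: DS) (a *: DbS) (a *: DDbS) = a *: cov2 S DS DbS DDbS.
Proof.
by rewrite /cov2 -!(scalemxAr, scalemxAl) -!(scalerDr, scalerBr).
Qed.

(** [cov2] leaves out the term in which the second derivative falls on the connection [P *m DbG].
    For the metric that term is the curvature, so the value here is minus the curvature instead of
    0. *)
Lemma cov2_metric : P *m G = 1%:M ->
  cov2 G DG DbG DDbG = - (DG *m P *m DbG - DDbG).
Proof.
by move=> PG; rewrite /cov2 -[DG *m P *m G]mulmxA PG mulmx1 mulmxA subrK opprB.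
Qed.

(** The hypotheses on [Dh] and [Dh'] say that the covariant derivatives of [h] and [h'] vanish,
    which removes all third-order terms. The remaining products stand for |nabla_v \bar nabla L|^2
    and |nabla_v nabla L|^2; [DG *m P *m b] is the Christoffel correction of [beta]. *)
Lemma cov2_outer (b beta h Dh : 'cV[V]_n) (b' beta' h' Dh' : 'rV[V]_n) :
  Dh = DG *m P *m h -> Dh' = h' *m (P *m DbG) ->
  cov2 (b *m b') (beta *m b' + b *m h') (h *m b' + b *m beta')
       (Dh *m b' + h *m h' + beta *m beta' + b *m Dh') =
    h *m h' + (beta - DG *m P *m b) *m (beta' - b' *m (P *m DbG)).
Proof.
move=> -> ->; rewrite /cov2 !(mulmxDl, mulmxDr, mulmxBl, mulmxBr).
rewrite !(mulmxN, mulNmx) !mulmxA.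
do 7 move: (_ *m _ : 'M[V]_n) => ?.
apply/matrixP => i j; rewrite !mxE.
ring.
Qed.

End TraceVariation.

Section TraceInequality.
Context {R : realType} {n : nat}.
Local Notation C := R[i].
Variables (G P DG DbG DDbG : 'M[C]_n).
Hypotheses (PG : P *m G = 1%:M) (PH : P^H = P).
Hypotheses (DGH : DG^H = DbG) (DDbGH : DDbG^H = DDbG).

Let K := DG *m P *m DbG - DDbG.
Local Notation cov2 := (cov2 P DG DbG).
Local Notation trvar := (trvar P DG DbG DDbG).

(** Substitute H = N - psi G in [trvarE]. The curvature part contributes - psi tr (P K), while
    [cov2] of - psi G contributes + psi tr (P K), and these cancel. The four remaining traces are of
    products of semidefinite matrices. Finally N v = 0 gives h = - psi G v^H, whence tr (P h h^H) =
    psi^2 G(v, v). *)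
Lemma trvar_levi (H DH DbH DDbH : 'M[C]_n) (b beta h Dh : 'cV[C]_n)
    (v : 'rV[C]_n) (psi : R) (N := H + psi%:C *: G) :
  psd P -> psd K -> G^H = G -> N^H = N -> psd N -> N *m v^H = 0 ->
  h = H *m v^H -> Dh = DG *m P *m h ->
  psd (cov2 N (DH + psi%:C *: DG) (DbH + psi%:C *: DbG) (DDbH + psi%:C *: DDbG)) ->
  (psi ^+ 2)%:C * hform G v <=
    trvar (H + b *m b^H) (DH + (beta *m b^H + b *m h^H))
      (DbH + (h *m b^H + b *m beta^H))
      (DDbH + (Dh *m b^H + h *m h^H + beta *m beta^H + b *m Dh^H)).
Proof.
move=> P0 K0 GH NH N0 Nv hE DhE X0.
have PKPH : (P *m K *m P)^H = P *m K *m P.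
  by rewrite !adjmM PH adjmB !adjmM PH -{1}DGH adjmK DGH DDbGH !mulmxA.
have PKP0 : psd (P *m K *m P) by rewrite -{2}PH; exact: psd_congr.
set M := cov2 N _ _ _ in X0.
have Dh'E : Dh^H = h^H *m (P *m DbG) by rewrite DhE !adjmM PH DGH.
have uE : beta^H - b^H *m (P *m DbG) = (beta - DG *m P *m b)^H.
  by rewrite adjmB !adjmM PH DGH.
have ME : cov2 H DH DbH DDbH = M + psi%:C *: K.
  by rewrite /M /N cov2D cov2Z cov2_metric // scalerN addrNK.
rewrite trvarE.
rewrite cov2D.
rewrite (cov2_outer _ _ _ _ DhE Dh'E) uE ME.
have -> : H = N - psi%:C *: G by rewrite /N addrK.
have tG : \tr (P *m K *m P *m G) = \tr (P *m K) by rewrite -mulmxA PG mulmx1.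
have hG : h = - psi%:C *: (G *m v^H).
  have : N *m v^H = 0 by [].
  by rewrite /N mulmxDl -hE -scalemxAl scaleNr => /eqP; rewrite addr_eq0 => /eqP.
have hh : \tr (P *m (h *m h^H)) = (psi ^+ 2)%:C * hform G v.
  rewrite hG adjmZ adjmM adjmK GH conjcN conjcR !(scalemxAl, scalemxAr).
  rewrite -!scalemxAl -!scalemxAr !mulmxA PG mul1mx.
  rewrite !mxtraceZ -mulmxA mxtrace_mulC [\tr _]big_ord1 hformE rmorphXn /=.
  ring.
have t1 := tr_psd_ge0 PKPH PKP0 N0.
have t2 := tr_psd_ge0 PKPH PKP0 (psd_outer b).
have t3 := tr_psd_ge0 PH P0 X0.
have t4 := tr_psd_ge0 PH P0 (psd_outer (beta - DG *m P *m b)).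
have aux (a : C) (Q N1 G1 B M1 K1 h1 u1 : 'M[C]_n) :
    \tr (Q *m (N1 - a *: G1 + B)) + \tr (P *m (M1 + a *: K1 + (h1 + u1))) =
    \tr (P *m h1) + a * (\tr (P *m K1) - \tr (Q *m G1)) +
    (\tr (Q *m N1) + \tr (Q *m B) + \tr (P *m M1) + \tr (P *m u1)).
  rewrite !mulmxDr !mulmxN !mxtraceD mxtraceN -!scalemxAr !mxtraceZ.
  move: (\tr _) (\tr _) (\tr _) (\tr _) => *; ring.
rewrite aux tG subrr mulr0 addr0 hh lerDl; do 3 (apply: addr_ge0 => //).
Qed.

End TraceInequality.

(** * Directional derivatives of smooth functions *)

Section DirectionalDerivatives.
Context {R : realType} {V : normedModType R}.
Implicit Types (f h : V -> R) (z x v e : V) (U : set V).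

Lemma is_derive_line f z v (s : R) : derivable f (s *: v + z) v ->
  is_derive s 1 (fun r : R => f (r *: v + z)) ('D_v f (s *: v + z)).
Proof.
move=> df.
have E : (fun r : R => r^-1 *: (((fun q : R => f (q *: v + z)) \o shift s) (r *: 1) -
      f (s *: v + z))) =
    (fun r : R => r^-1 *: ((f \o shift (s *: v + z)) (r *: v) - f (s *: v + z))).
  apply/funext => r /=.
  by rewrite [r *: 1]mulr1 scalerDl addrA.
split; first by rewrite /derivable E.
by rewrite /derive E.
Qed.

Lemma MVT_direction f z v (d : R) :
  (forall r : R, `|r| <= `|d| -> derivable f (r *: v + z) v) ->
  exists2 c : R, `|c| <= `|d| & f (d *: v + z) - f z = d * 'D_v f (c *: v + z).
Proof.
move=> df; pose p (r : R) := f (r *: v + z).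
have dp (r : R) : `|r| <= `|d| -> is_derive r 1 p ('D_v f (r *: v + z)).
  by move=> rd; apply: is_derive_line; exact: df.
have cp (a b : R) : `|a| <= `|d| -> `|b| <= `|d| -> {within `[a, b], continuous p}.
  move=> ad bd; apply: derivable_within_continuous => r; rewrite in_itv /= => /andP[ar rb].
  have := dp r; case => //; move: ad bd; rewrite !ler_norml; lra.
have pd : f (d *: v + z) - f z = p d - p 0 by rewrite /p scale0r add0r.
have [d0|d0|d0] := ltgtP d 0.
- have [c cI E] : exists2 c, c \in `]d, 0[%R & p 0 - p d = 'D_v f (c *: v + z) * (0 - d).
    apply: MVT => //; last by apply: cp; rewrite ?normr0.
    move=> r; rewrite in_itv /= => /andP[r1 r2]; apply: dp.
    by rewrite !ltr0_norm // lerN2 ltW.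
  exists c; last by rewrite pd -opprB E; ring.
  by move: cI; rewrite in_itv /= => /andP[c1 c2]; rewrite !ltr0_norm // lerN2 ltW.
- have [c cI E] : exists2 c, c \in `]0, d[%R & p d - p 0 = 'D_v f (c *: v + z) * (d - 0).
    apply: MVT => //; last by apply: cp; rewrite ?normr0.
    move=> r; rewrite in_itv /= => /andP[r1 r2]; apply: dp.
    by rewrite !gtr0_norm // ltW.
  exists c; last by rewrite pd E; ring.
  by move: cI; rewrite in_itv /= => /andP[c1 c2]; rewrite !gtr0_norm // ltW.
- by exists 0; [rewrite d0 | rewrite pd d0 subrr mul0r].
Qed.

(** [smooth_on] speaks of directional derivatives only, so the chain rule along a moving point rests
    on the mean value theorem: the increment is [d s] times the derivative at a point
    [c s *: e + y s], and [c s] tends to 0 with [d s]. *)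
Lemma cvg_incr U h x e (y : R -> V) (d : R -> R) (w : R) :
  open U -> U x -> (forall z, U z -> derivable h z e) ->
  {for x, continuous ('D_e h)} ->
  y s @[s --> 0^'] --> x -> d s @[s --> 0^'] --> 0 ->
  s^-1 * d s @[s --> 0^'] --> w ->
  s^-1 * (h (d s *: e + y s) - h (y s)) @[s --> 0^'] --> w * 'D_e h x.
Proof.
move=> Uo Ux dh ch yx d0 dw.
(* If the segment leaves [U], 0 serves as a default; this does not occur for small [s]. *)
have /choice[c cP] (s : R) : exists c : R, `|c| <= `|d s| /\
    ((forall r : R, `|r| <= `|d s| -> U (r *: e + y s)) ->
     h (d s *: e + y s) - h (y s) = d s * 'D_e h (c *: e + y s)).
  have [Us|nUs] := pselect (forall r : R, `|r| <= `|d s| -> U (r *: e + y s)).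
    have [c c1 c2] := @MVT_direction h (y s) e (d s) (fun r rd => dh _ (Us r rd)).
    by exists c.
  by exists 0; split => [|/nUs//]; rewrite normr0.
have c0 : c s @[s --> 0^'] --> 0.
  apply/cvgrPdist_le => eps eps0; move/cvgrPdist_le: d0 => /(_ _ eps0).
  apply: filterS => s; rewrite !sub0r !normrN; apply: le_trans.
  by have [] := cP s.
have cy : c s *: e + y s @[s --> 0^'] --> x.
  rewrite -[X in _ --> X]add0r -[X in _ --> X + _](scale0r e).
  by apply: cvgD => //; apply: cvgZr_tmp.
have cD : 'D_e h (c s *: e + y s) @[s --> 0^'] --> 'D_e h x.
  exact: (@cvg_comp _ _ _ (fun s => c s *: e + y s) ('D_e h) _ _ _ cy ch).
have L : s^-1 * d s * 'D_e h (c s *: e + y s) @[s --> 0^'] --> w * 'D_e h x.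
  exact: cvgM.
refine (cvg_trans _ L); apply: near_eq_cvg.
have [eps /= eps0 Ueps] : exists2 eps : R, 0 < eps & ball x eps `<=` U.
  by have /nbhs_ballP[eps] := open_nbhs_nbhs (conj Uo Ux); exists eps.
have eps20 : 0 < eps / 2 by rewrite divr_gt0.
move/cvgrPdist_lt: yx => /(_ _ eps20); move/cvgrPdist_lt: d0.
have e0 : 0 < eps / 2 / (`|e| + 1) by rewrite divr_gt0 // ltr_wpDl.
move=> /(_ _ e0); apply: filterS2 => s; rewrite sub0r normrN => ds ys.
rewrite -mulrA; congr (_ * _); have [_ ->//] := cP s.
move=> r rd; apply: Ueps; rewrite -ball_normE /= opprD addrCA.
rewrite (le_lt_trans (ler_normD _ _)) // [ltRHS]splitr.
rewrite ler_ltD // normrN normrZ.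
have : `|r| < eps / 2 / (`|e| + 1) by exact: le_lt_trans ds.
rewrite ltr_pdivlMr ?ltr_wpDl // => /ltW; apply: le_trans.
by rewrite ler_wpM2l // lerDl.
Qed.

(** The directions are travelled one after another. Each stage is [cvg_incr] with a moving base
    point, and the increments telescope. *)
Lemma cvg_sum_incr (I : Type) (r : seq I) U h x (e : I -> V) (y : R -> V)
    (d : I -> R -> R) (w : I -> R) :
  open U -> U x -> (forall i z, U z -> derivable h z (e i)) ->
  (forall i, {for x, continuous ('D_(e i) h)}) ->
  (forall i, d i s @[s --> 0^'] --> 0) ->
  (forall i, s^-1 * d i s @[s --> 0^'] --> w i) ->
  y s @[s --> 0^'] --> x ->
  s^-1 * (h ((\sum_(i <- r) d i s *: e i) + y s) - h (y s)) @[s --> 0^'] -->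
    \sum_(i <- r) w i * 'D_(e i) h x.
Proof.
move=> Uo Ux dh ch d0 dw; elim: r y => [|i r IHr] y yx.
  rewrite big_nil; under eq_fun do rewrite big_nil add0r subrr mulr0.
  exact: cvg_cst.
pose y' s := (\sum_(i <- r) d i s *: e i) + y s.
have y'x : y' s @[s --> 0^'] --> x.
  rewrite -[X in _ --> X]add0r; apply: cvgD => //.
  elim: {IHr} (r) => [|j r' IH].
    under eq_fun do rewrite big_nil; exact: cvg_cst.
  under eq_fun do rewrite big_cons.
  have ej : d j s *: e j @[s --> 0^'] --> (0 : R) *: e j.
    by apply: cvgZr_tmp; exact: d0.
  by have L := cvgD ej IH; rewrite scale0r addr0 in L; exact: L.
rewrite big_cons; under eq_fun do rewrite big_cons -addrA -/(y' _).
have -> : (fun s => s^-1 * (h (d i s *: e i + y' s) - h (y s))) =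
   (fun s => s^-1 * (h (d i s *: e i + y' s) - h (y' s)) +
             s^-1 * (h (y' s) - h (y s))).
  by apply/funext => s; rewrite -mulrDr; congr (_ * _); ring.
have L1 := cvg_incr Uo Ux (dh i) (ch i) y'x (d0 i) (dw i).
exact: (cvgD L1 (IHr _ yx)).
Qed.

(** The case of increments [s * a i]: continuity of the partial derivatives is what makes the
    derivative linear in the direction. *)
Lemma is_derive_comb (I : Type) (r : seq I) U h x (e : I -> V) (a : I -> R) :
  open U -> U x -> (forall i z, U z -> derivable h z (e i)) ->
  (forall i, {for x, continuous ('D_(e i) h)}) ->
  is_derive x (\sum_(i <- r) a i *: e i) h (\sum_(i <- r) a i * 'D_(e i) h x).
Proof.
move=> Uo Ux dh ch.
have := @cvg_sum_incr _ r U h x e (fun=> x) (fun i s => s * a i) a Uo Ux dh ch.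
set l := \sum_(i <- r) a i * _ => H.
have L : s^-1 *: ((h \o shift x) (s *: \sum_(i <- r) a i *: e i) - h x)
    @[s --> 0^'] --> l.
  have := H _ _ (cvg_cst _).
  under eq_fun => s.
    under eq_bigr do rewrite -scalerA.
    rewrite -scaler_sumr; over.
  apply.
  - move=> i; have s0 : s @[s --> 0^'] --> (0 : R) by exact: cvg_within.
    by have L := cvgM s0 (cvg_cst (a i)); rewrite mul0r in L; exact: L.
  - move=> i; apply: cvg_near_cst; near=> s; rewrite mulKf //; near: s; exact: nbhs_dnbhs_neq.
by split; [apply/cvg_ex; exists l | exact/cvg_lim].
Unshelve. all: by end_near. Qed.

(** The mixed second difference over s u and s v, divided by s^2, is symmetric in u and v. Two
    applications of the mean value theorem show that it tends to each of the two mixed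
    derivatives. *)
Lemma Schwarz_symmetry U h x (u v : V) :
  open U -> U x ->
  (forall z, U z -> derivable h z u) -> (forall z, U z -> derivable h z v) ->
  (forall z, U z -> derivable ('D_u h) z v) ->
  (forall z, U z -> derivable ('D_v h) z u) ->
  {for x, continuous ('D_u ('D_v h))} -> {for x, continuous ('D_v ('D_u h))} ->
  'D_u ('D_v h) x = 'D_v ('D_u h) x.
Proof.
move=> Uo Ux du dv duv dvu cuv cvu.
have key (a b : V) : (forall z, U z -> derivable h z a) ->
    (forall z, U z -> derivable ('D_a h) z b) ->
    {for x, continuous ('D_b ('D_a h))} ->
    (s ^+ 2)^-1 * (h (s *: a + (s *: b + x)) - h (s *: b + x) - (h (s *: a + x) - h x))
      @[s --> 0^'] --> 'D_b ('D_a h) x.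
  move=> da dab cab.
  have [eps /= eps0 Ueps] : exists2 eps : R, 0 < eps & ball x eps `<=` U.
    by have /nbhs_ballP[eps] := open_nbhs_nbhs (conj Uo Ux); exists eps.
  have inU (s p q : R) : `|s| * (`|a| + `|b| + 1) < eps -> `|p| <= `|s| ->
      `|q| <= `|s| -> U (p *: a + (q *: b + x)).
    move=> se ps qs; apply: Ueps; rewrite -ball_normE /= opprD addrCA !opprD.
    rewrite [x + _]addrCA subrr addr0 -opprD normrN; apply: le_lt_trans se.
    rewrite (le_trans (ler_normD _ _)) // !normrZ !mulrDr mulr1 -addrA lerD //.
      exact: ler_wpM2r.
    by rewrite ler_wpDr // ler_wpM2r.
  have /choice[c cP] (s : R) : exists c : R * R, `|c.1| <= `|s| /\ `|c.2| <= `|s| /\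
     (`|s| * (`|a| + `|b| + 1) < eps ->
      h (s *: a + (s *: b + x)) - h (s *: b + x) - (h (s *: a + x) - h x) =
      s ^+ 2 * 'D_b ('D_a h) (c.1 *: a + (c.2 *: b + x))).
    have [se|se] := ltP (`|s| * (`|a| + `|b| + 1)) eps; last first.
      by exists (0, 0); rewrite /= normr0.
    pose g z := h (s *: b + z) - h z.
    have dg (r : R) : `|r| <= `|s| ->
        is_derive (r *: a + x) a g ('D_a h (s *: b + (r *: a + x)) - 'D_a h (r *: a + x)).
      move=> rs; apply: is_deriveB.
        have U1 : U (s *: b + (r *: a + x)) by rewrite addrCA; exact: (inU s).
        split.
          have := da _ U1; rewrite /derivable /=.
          by under eq_fun do rewrite addrCA.
        rewrite /derive /=.
        by congr (lim _); under eq_fun do rewrite addrCA.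
      apply: derivableP; apply: da.
      by have := inU s r 0 se rs; rewrite scale0r add0r normr0; apply.
    have [p ps pE] := @MVT_direction g x a s (fun r rs => @ex_derive _ _ _ _ _ _ _ (dg r rs)).
    have [q qs qE] := @MVT_direction ('D_a h) (p *: a + x) b s
       (fun r rs => dab _ (eq_ind _ U (inU s p r se ps rs) _ (addrCA _ _ _))).
    exists (p, q); split; [exact: ps|split; [exact: qs|move=> _]].
    have := dg p ps => -[_ gE].
    move: pE; rewrite gE qE /g [s *: b + (s *: a + x)]addrCA [q *: b + _]addrCA => pE.
    by rewrite expr2 -mulrA -pE; ring.
  have z0 (d : R -> R) : (forall s, `|d s| <= `|s|) -> d s @[s --> 0^'] --> (0 : R).
    move=> ds; apply/cvgrPdist_lt => eta eta0.
    near=> s; rewrite sub0r normrN (le_lt_trans (ds s)) //; near: s.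
    exact: (@dnbhs0_lt _ R).
  have cc : (c s).1 *: a + ((c s).2 *: b + x) @[s --> 0^'] --> x.
    rewrite -[X in _ --> X]add0r -{1}(scale0r a); apply: cvgD.
      by apply: cvgZr_tmp; apply: z0 => s; have [] := cP s.
    rewrite -[X in _ --> X]add0r -{1}(scale0r b); apply: cvgD; last exact: cvg_cst.
    by apply: cvgZr_tmp; apply: z0 => s; have [_ []] := cP s.
  have L := @cvg_comp _ _ _ _ ('D_b ('D_a h)) _ _ _ cc cab.
  refine (cvg_trans _ L); apply: near_eq_cvg; near=> s.
  have s0 : s != 0 by near: s; exact: nbhs_dnbhs_neq.
  have [_ [_ ->]] := cP s; first by rewrite mulKf // sqrf_eq0.
  rewrite -ltr_pdivlMr ?ltr_wpDl ?addr_ge0 //; near: s.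
  by apply: (@dnbhs0_lt _ R); rewrite divr_gt0 // ltr_wpDl ?addr_ge0.
have L1 := key u v du duv cvu; have L2 := key v u dv dvu cuv.
have E : (fun s : R => (s ^+ 2)^-1 *
     (h (s *: v + (s *: u + x)) - h (s *: u + x) - (h (s *: v + x) - h x))) =
   (fun s : R => (s ^+ 2)^-1 *
     (h (s *: u + (s *: v + x)) - h (s *: v + x) - (h (s *: u + x) - h x))).
  by apply/funext => s; rewrite addrCA; congr (_ * _); ring.
rewrite E in L2.
by rewrite -(cvg_lim (@Rhausdorff R) L2) -(cvg_lim (@Rhausdorff R) L1).
Unshelve. all: by end_near. Qed.

End DirectionalDerivatives.

(* If the derivative of p were decreasing through its zero at 0, the mean value
   theorem would make p negative on the right of 0. *)
Lemma second_derivative_min (R : realType) (p dp : R -> R) (d2 : R) :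
  (\forall s \near (0 : R), is_derive (s : R) (1 : R) p (dp s)) -> is_derive (0 : R) (1 : R) dp d2 ->
  p 0 = 0 -> (\forall s \near (0 : R), 0 <= p s) -> dp 0 = 0 /\ 0 <= d2.
Proof.
move=> dpP [ddp d2E] p0 pge0.
have [eps /= eps0 H] : exists2 eps : R, 0 < eps &
    forall s : R, `|s| < eps -> is_derive (s : R) (1 : R) p (dp s) /\ 0 <= p s.
  have : \forall s \near (0 : R), is_derive (s : R) (1 : R) p (dp s) /\ 0 <= p s.
    by near=> s; split; near: s.
  move=> /nbhs_ballP[eps /= e0 He]; exists eps => // s se; apply: He.
  by rewrite -ball_normE /= sub0r normrN.
have dp0 : dp 0 = 0.
  have [] := H 0; first by rewrite normr0.
  move=> d0 _; have dm : is_derive (0 : R) (1 : R) p 0.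
    apply: (@derive1_at_min R p (- eps) eps 0).
    - by rewrite ge0_cp // ltW.
    - by move=> t; rewrite in_itv /= -ltr_norml => /H[[]].
    - by rewrite in_itv /= oppr_lt0 eps0.
    - by move=> t; rewrite in_itv /= -ltr_norml p0 => /H[].
  by rewrite -(@derive_val _ _ _ _ _ _ _ d0) (@derive_val _ _ _ _ _ _ _ dm).
split => //; rewrite leNgt; apply/negP => d20.
have : (dp (s *: 1 + 0) - dp 0) / s @[s --> 0^'] --> d2.
  move: ddp => /cvg_ex[l L]; rewrite -d2E /derive (cvg_lim _ L) //.
  apply: cvg_trans L; apply: near_eq_cvg; near=> s => /=.
  by rewrite [_^-1 *: _]mulrC.
move=> /cvgr_lt /(_ 0 d20) /= dneg.
pose m eta := Num.min eps eta.
have m1 eta : m eta <= eps by rewrite ge_min lexx.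
have m2 eta : m eta <= eta by rewrite ge_min lexx orbT.
have [s [s0 se sneg]] : exists s : R, [/\ 0 < s, s < eps &
    forall t : R, 0 < t -> t <= s -> dp t < 0].
  move: dneg => /nbhs_ballP[eta /= eta0 Heta].
  exists (m eta / 2); split; first by rewrite divr_gt0 // lt_min eps0.
    by rewrite ltr_pdivrMr // (le_lt_trans (m1 eta)) //; lra.
  move=> t t0 ts; have := Heta t; rewrite -ball_normE /= sub0r normrN gtr0_norm //.
  rewrite dp0 subr0 addr0 [t *: 1]mulr1 => /(_ _ (lt0r_neq0 t0)).
  rewrite pmulr_llt0 ?invr_gt0 //; apply; apply: (le_lt_trans ts).
  by rewrite ltr_pdivrMr // (le_lt_trans (m2 eta)) //; lra.
have [c] : exists2 c, c \in `]0, s[%R & p s - p 0 = dp c * (s - 0).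
  apply: MVT => // [t|].
    rewrite in_itv /= => /andP[t0 ts].
    by have [] := H t; first by rewrite gtr0_norm // (lt_trans ts).
  apply: derivable_within_continuous => t; rewrite in_itv /= => /andP[t0 ts].
  by have [[]] : is_derive t 1 p (dp t) /\ 0 <= p t by apply: H; rewrite ger0_norm // (le_lt_trans ts).
rewrite in_itv /= p0 !subr0 => /andP[c0 cs] ps.
have := sneg c c0 (ltW cs).
have [_] : is_derive s 1 p (dp s) /\ 0 <= p s by apply: H; rewrite gtr0_norm.
by rewrite ps pmulr_lge0 // leNgt => /negP.
Unshelve. all: by end_near. Qed.

(** * Smooth functions on open sets *)

Section Smooth.
Context {R : realType} {V : normedModType R}.
Implicit Types (f h : V -> R) (z v : V) (U W : set V) (s : seq V).

Lemma open_near U z : open U -> U z -> \forall y \near z, U y.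
Proof. by move=> Uo Uz; exact: open_nbhs_nbhs. Qed.

Lemma smooth_derivable U h z v : smooth_on U h -> U z -> derivable h z v.
Proof. by move=> hs Uz; have [_] := hs [::] z Uz. Qed.

Lemma smooth_continuous U h z : smooth_on U h -> U z -> {for z, continuous h}.
Proof. by move=> hs Uz; have [] := hs [::] z Uz. Qed.

Lemma iter_derive_rcons s v h : iter_derive s ('D_v h) = iter_derive (rcons s v) h.
Proof. by elim: s => //= u s ->. Qed.

Lemma smooth_derive U h v : smooth_on U h -> smooth_on U ('D_v h).
Proof. by move=> hs s z Uz; rewrite iter_derive_rcons; exact: hs. Qed.

Lemma smooth_sub U W h : W `<=` U -> smooth_on U h -> smooth_on W h.
Proof. by move=> WU hs s z /WU; exact: hs. Qed.

Lemma iter_derive_eq U f h s : open U -> (forall z, U z -> f z = h z) ->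
  forall z, U z -> iter_derive s f z = iter_derive s h z.
Proof.
move=> Uo fh; elim: s => //= v s IHs z Uz.
by apply: near_eq_derive; apply: filterS (open_near Uo Uz) => y /IHs.
Qed.

Lemma smooth_eq U f h : open U -> (forall z, U z -> f z = h z) ->
  smooth_on U f -> smooth_on U h.
Proof.
move=> Uo fh fs s z Uz; have [fc fd] := fs s z Uz.
have E : \forall y \near z, iter_derive s f y = iter_derive s h y.
  by apply: filterS (open_near Uo Uz) => y /(iter_derive_eq s Uo fh).
split=> [|v]; last exact: near_eq_derivable (fd v).
rewrite /prop_for /continuous_at -(nbhs_singleton E).
exact: (cvg_trans (near_eq_cvg E) fc).
Qed.

Lemma iter_derive_lin U (a : R) f h s : open U -> smooth_on U f -> smooth_on U h ->
  forall z, U z -> iter_derive s (fun y => a * f y + h y) z =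
    a * iter_derive s f z + iter_derive s h z.
Proof.
move=> Uo fs hs; elim: s => //= v s IHs z Uz.
rewrite (@near_eq_derive _ _ _ _ (a *: iter_derive s f + iter_derive s h)).
  have [_ fd] := fs s z Uz; have [_ hd] := hs s z Uz.
  by rewrite deriveD ?deriveZ //; exact: derivableZ.
by apply: filterS (open_near Uo Uz) => y /IHs ->.
Qed.

Lemma smooth_lin U (a : R) f h : open U -> smooth_on U f -> smooth_on U h ->
  smooth_on U (fun y => a * f y + h y).
Proof.
move=> Uo fs hs s z Uz; have [fc fd] := fs s z Uz; have [hc hd] := hs s z Uz.
have E : \forall y \near z, (a *: iter_derive s f + iter_derive s h) y =
    iter_derive s (fun y => a * f y + h y) y.
  by apply: filterS (open_near Uo Uz) => y /(iter_derive_lin a s Uo fs hs) ->.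
split=> [|v].
  rewrite /prop_for /continuous_at -(nbhs_singleton E).
  apply: cvg_trans (near_eq_cvg E) _.
  by apply: cvgD => //; apply: cvgZl_tmp.
apply: near_eq_derivable E _; apply: derivableD => //; exact: derivableZ.
Qed.

Lemma smooth_const U (c : R) : smooth_on U (fun=> c).
Proof.
move=> s z _; suff [d ->] : exists d, iter_derive s (fun _ : V => c) = fun=> d.
  by split=> [|v]; [exact: cvg_cst | exact: derivable_cst].
elim: s => [|v s [d IHs]]; first by exists c.
by exists 0; apply/funext => y /=; rewrite IHs derive_cst.
Qed.

Lemma smooth_Schwarz U h z u v : open U -> smooth_on U h -> U z ->
  'D_u ('D_v h) z = 'D_v ('D_u h) z.
Proof.
move=> Uo hs Uz; apply: (Schwarz_symmetry Uo Uz).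
- by move=> y; exact: smooth_derivable.
- by move=> y; exact: smooth_derivable.
- by move=> y; apply: smooth_derivable; exact: smooth_derive.
- by move=> y; apply: smooth_derivable; exact: smooth_derive.
- by have [] := hs [:: u; v] z Uz.
- by have [] := hs [:: v; u] z Uz.
Qed.

End Smooth.

(** * Functions of space and time at a fixed time *)

Section Slices.
Context {R : realType} {V : normedModType R}.

Lemma slice_quotient (h : (V * R^o)%type -> R) (t : R) z v :
  (fun s : R => s^-1 *: (((fun y => h (y, t)) \o shift z) (s *: v) - h (z, t))) =
  (fun s : R => s^-1 *: ((h \o shift (z, t)) (s *: (v, 0)) - h (z, t))).
Proof.
apply/funext => s /=; congr (_ *: (h _ - _)).
by rewrite /GRing.add /= /add_pair /= scaler0 add0r.
Qed.

Lemma derive_slice (h : (V * R^o)%type -> R) (t : R) z v :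
  'D_v (fun y => h (y, t)) z = 'D_(v, 0) h (z, t).
Proof. by rewrite /derive slice_quotient. Qed.

Lemma iter_derive_slice (h : (V * R^o)%type -> R) (t : R) s :
  iter_derive s (fun y => h (y, t)) =
    fun z => iter_derive [seq (v, 0) | v <- s] h (z, t).
Proof.
elim: s => //= v s ->; apply/funext => z.
exact: (derive_slice (iter_derive _ h)).
Qed.

Lemma smooth_slice (W : set (V * R^o)%type) h (t : R) : smooth_on W h ->
  smooth_on [set z | W (z, t)] (fun y => h (y, t)).
Proof.
move=> hs s z Wz; rewrite iter_derive_slice.
have [hc hd] := hs [seq (v, 0) | v <- s] (z, t) Wz; split=> [|v].
  apply: (@continuous_comp _ _ _ (fun y => (y, t)) (iter_derive _ h)) => //.
  have L : y @[y --> z] --> z by exact: cvg_id.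
  have L' : t @[y --> z] --> (t : R^o) by exact: cvg_cst.
  exact: (cvg_pair L L').
by have := hd (v, 0); rewrite /derivable slice_quotient.
Qed.

End Slices.

(** * Complex directional derivatives *)

Section ComplexDerivatives.
Context {R : realType} {n : nat}.
Local Notation C := R[i].
Local Notation V := (Cn R n).
Implicit Types (f : V -> R) (h : V -> C) (z v : V) (U : set V).

Lemma cReM (x y : C) :
  complex.Re (x * y) = complex.Re x * complex.Re y - complex.Im x * complex.Im y.
Proof. by case: x; case: y. Qed.

Lemma cImM (x y : C) :
  complex.Im (x * y) = complex.Re x * complex.Im y + complex.Im x * complex.Re y.
Proof. by case: x; case: y => a b c d /=; rewrite addrC [d * _]mulrC; ring. Qed.

Lemma cReD (x y : C) : complex.Re (x + y) = complex.Re x + complex.Re y.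
Proof. by case: x; case: y. Qed.

Lemma cImD (x y : C) : complex.Im (x + y) = complex.Im x + complex.Im y.
Proof. by case: x; case: y. Qed.

Lemma complexRI (x y : C) :
  complex.Re x = complex.Re y -> complex.Im x = complex.Im y -> x = y.
Proof. by case: x; case: y => a b c d /= -> ->. Qed.

Definition is_deriveC z v h (d : C) :=
  is_derive z v (fun y => complex.Re (h y)) (complex.Re d) /\
  is_derive z v (fun y => complex.Im (h y)) (complex.Im d).

(** Products and inverses are handled at this level, one derivative at one point; smoothness itself
    is propagated through linear operations only. *)
Definition derivableC h z := forall v,
  derivable (fun y => complex.Re (h y)) z v /\
  derivable (fun y => complex.Im (h y)) z v.

Lemma derivableCP h z v : derivableC h z -> is_deriveC z v h (deriveC v h z).
Proof. by move=> /(_ v)[h1 h2]; split; apply: derivableP. Qed.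

Lemma is_deriveC_val z v h d : is_deriveC z v h d -> deriveC v h z = d.
Proof. by move=> [[_ h1] [_ h2]]; rewrite /deriveC h1 h2; case: d {h1 h2}. Qed.

Lemma is_deriveC_derivable z h (d : V -> C) :
  (forall v, is_deriveC z v h (d v)) -> derivableC h z.
Proof. by move=> H v; have [[] ? _ [] ? _] := H v. Qed.

Lemma is_deriveC_cst z v (c : C) : is_deriveC z v (fun=> c) 0.
Proof. by split; exact: is_derive_cst. Qed.

Lemma is_deriveCD z v h1 h2 d1 d2 : is_deriveC z v h1 d1 -> is_deriveC z v h2 d2 ->
  is_deriveC z v (fun y => h1 y + h2 y) (d1 + d2).
Proof.
move=> [a1 b1] [a2 b2]; split; rewrite ?cReD ?cImD.
  by under eq_fun do rewrite cReD; exact: is_deriveD.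
by under eq_fun do rewrite cImD; exact: is_deriveD.
Qed.

Lemma is_deriveCM z v h1 h2 d1 d2 : is_deriveC z v h1 d1 -> is_deriveC z v h2 d2 ->
  is_deriveC z v (fun y => h1 y * h2 y) (d1 * h2 z + h1 z * d2).
Proof.
move=> [a1 b1] [a2 b2]; split.
  under eq_fun do rewrite cReM.
  apply: (is_derive_eq (is_deriveB (is_deriveM a1 a2) (is_deriveM b1 b2))).
  by rewrite cReD !cReM /= /GRing.scale /=; ring.
under eq_fun do rewrite cImM.
apply: (is_derive_eq (is_deriveD (is_deriveM a1 b2) (is_deriveM b1 a2))).
by rewrite cImD !cImM /= /GRing.scale /=; ring.
Qed.

Lemma is_deriveC_conj z v h d : is_deriveC z v h d ->
  is_deriveC z v (fun y => conjc (h y)) (conjc d).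
Proof.
move=> [a b]; split.
  have E x : complex.Re (conjc x) = complex.Re x :> R by case: x.
  by under eq_fun do rewrite E; rewrite E.
have E x : complex.Im (conjc x) = - complex.Im x :> R by case: x.
by under eq_fun do rewrite E; rewrite E; exact: is_deriveN.
Qed.

Lemma is_deriveC_real z v f d : is_derive z v f d ->
  is_deriveC z v (fun y => (f y)%:C) d%:C.
Proof. by move=> H; split => //=; exact: is_derive_cst. Qed.

Lemma derivableC_cst c z : derivableC (fun=> c) z.
Proof. by apply: is_deriveC_derivable => v; exact: is_deriveC_cst. Qed.

Lemma derivableCD h1 h2 z : derivableC h1 z -> derivableC h2 z ->
  derivableC (fun y => h1 y + h2 y) z.
Proof.
by move=> a b; apply: is_deriveC_derivable => v; apply: is_deriveCD; exact: derivableCP.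
Qed.

Lemma derivableCM h1 h2 z : derivableC h1 z -> derivableC h2 z ->
  derivableC (fun y => h1 y * h2 y) z.
Proof.
by move=> a b; apply: is_deriveC_derivable => v; apply: is_deriveCM; exact: derivableCP.
Qed.

Lemma derivableC_conj h z : derivableC h z -> derivableC (fun y => conjc (h y)) z.
Proof.
by move=> a; apply: is_deriveC_derivable => v; apply: is_deriveC_conj; exact: derivableCP.
Qed.

Lemma derivableC_real f z : (forall v, derivable f z v) ->
  derivableC (fun y => (f y)%:C) z.
Proof.
move=> a; apply: is_deriveC_derivable => v; apply: is_deriveC_real.
exact: derivableP.
Qed.

Lemma derivableC_sum (I : Type) (r : seq I) (P : pred I) (h : I -> V -> C) z :
  (forall i, P i -> derivableC (h i) z) ->
  derivableC (fun y => \sum_(i <- r | P i) h i y) z.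
Proof.
move=> H; elim: r => [|i r IH].
  by under eq_fun do rewrite big_nil; exact: derivableC_cst.
under eq_fun do rewrite big_cons; case Pi: (P i); last exact: IH.
exact: (derivableCD (H i Pi) IH).
Qed.

Lemma derivableC_prod (I : Type) (r : seq I) (P : pred I) (h : I -> V -> C) z :
  (forall i, P i -> derivableC (h i) z) ->
  derivableC (fun y => \prod_(i <- r | P i) h i y) z.
Proof.
move=> H; elim: r => [|i r IH].
  by under eq_fun do rewrite big_nil; exact: derivableC_cst.
under eq_fun do rewrite big_cons; case Pi: (P i); last exact: IH.
exact: (derivableCM (H i Pi) IH).
Qed.

Lemma derivableC_inv h z : h z != 0 -> derivableC h z ->
  derivableC (fun y => (h y)^-1) z.
Proof.
move=> hz0 dh v; have [da db] := dh v.
pose N : V -> R := fun y => complex.Re (h y) ^+ 2 + complex.Im (h y) ^+ 2.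
have Nz : N z != 0.
  apply: contra hz0; rewrite /N paddr_eq0 ?sqr_ge0 // !sqrf_eq0.
  by case: (h z) => a b /= /andP[/eqP-> /eqP->].
have dN : derivable N z v.
  have := derivableD (derivableM da da) (derivableM db db).
  by apply: near_eq_derivable; near=> y; rewrite /N !expr2.
have dNV : derivable (fun y => (N y)^-1) z v by exact: derivableV.
split.
  have E y : complex.Re ((h y)^-1) = complex.Re (h y) * (N y)^-1.
    by rewrite /N; case: (h y).
  by under eq_fun do rewrite E; exact: (derivableM da dNV).
have E y : complex.Im ((h y)^-1) = - (complex.Im (h y) * (N y)^-1).
  by rewrite /N; case: (h y).
by under eq_fun do rewrite E; exact: (derivableN (derivableM db dNV)).
Unshelve. all: by end_near. Qed.

Lemma derivableC_near h1 h2 z : (\forall y \near z, h1 y = h2 y) ->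
  derivableC h1 z -> derivableC h2 z.
Proof.
move=> E H v; have [a b] := H v.
by split; [move: a | move: b]; apply: near_eq_derivable; apply: filterS E => y ->.
Qed.

(* First-order operators with constant coefficients, given by lists of
   (coefficient, direction). *)
Definition dop (r : seq (C * V)) h z : C := \sum_(p <- r) p.1 * deriveC p.2 h z.

Implicit Types r s : seq (C * V).

Lemma dop_near r h1 h2 z : (\forall y \near z, h1 y = h2 y) ->
  dop r h1 z = dop r h2 z.
Proof.
move=> E; apply: eq_bigr => p _; congr (_ * _).
by congr (_ +i* _); apply: near_eq_derive; apply: filterS E => y ->.
Qed.

Lemma dop_cst r c z : dop r (fun=> c) z = 0.
Proof.
apply: big1 => p _; by rewrite (is_deriveC_val (is_deriveC_cst z p.2 c)) mulr0.
Qed.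

Lemma dopD r h1 h2 z : derivableC h1 z -> derivableC h2 z ->
  dop r (fun y => h1 y + h2 y) z = dop r h1 z + dop r h2 z.
Proof.
move=> a b; rewrite /dop -big_split; apply: eq_bigr => p _ /=.
rewrite (is_deriveC_val (is_deriveCD (derivableCP p.2 a) (derivableCP p.2 b))).
exact: mulrDr.
Qed.

Lemma dopM r h1 h2 z : derivableC h1 z -> derivableC h2 z ->
  dop r (fun y => h1 y * h2 y) z = dop r h1 z * h2 z + h1 z * dop r h2 z.
Proof.
move=> a b; rewrite /dop mulr_suml mulr_sumr -big_split; apply: eq_bigr => p _ /=.
rewrite (is_deriveC_val (is_deriveCM (derivableCP p.2 a) (derivableCP p.2 b))).
by ring.
Qed.

Lemma dopZ r c h z : derivableC h z -> dop r (fun y => c * h y) z = c * dop r h z.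
Proof.
by move=> a; rewrite dopM // ?dop_cst ?mul0r ?add0r //; exact: derivableC_cst.
Qed.

Lemma dop_sum (I : Type) (l : seq I) (P : pred I) r (h : I -> V -> C) z :
  (forall i, P i -> derivableC (h i) z) ->
  dop r (fun y => \sum_(i <- l | P i) h i y) z = \sum_(i <- l | P i) dop r (h i) z.
Proof.
move=> H; elim: l => [|i l IH].
  by under eq_fun do rewrite big_nil; rewrite big_nil dop_cst.
under eq_fun do rewrite big_cons; rewrite big_cons; case: ifP => // Pi.
by rewrite dopD ?IH //; [exact: H | exact: derivableC_sum].
Qed.

Definition conj_dop r : seq (C * V) := [seq (conjc p.1, p.2) | p <- r].

Lemma dop_conj r h z : derivableC h z ->
  dop (conj_dop r) (fun y => conjc (h y)) z = conjc (dop r h z).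
Proof.
move=> a; rewrite /dop conjc_sum big_map; apply: eq_bigr => p _ /=.
by rewrite (is_deriveC_val (is_deriveC_conj (derivableCP p.2 a))) conjcM.
Qed.

Lemma conj_dopK r : conj_dop (conj_dop r) = r.
Proof.
rewrite /conj_dop -map_comp -[RHS]map_id; apply: eq_map => -[c v] /=.
by rewrite conjcK.
Qed.

Lemma smoothC_derivable U h z : smoothC_on U h -> U z -> derivableC h z.
Proof.
by move=> [a b] Uz v; split; [exact: smooth_derivable a Uz | exact: smooth_derivable b Uz].
Qed.

Lemma smoothC_eq U h1 h2 : open U -> (forall z, U z -> h1 z = h2 z) ->
  smoothC_on U h1 -> smoothC_on U h2.
Proof.
move=> Uo E [a b]; split.
  by apply: smooth_eq a => // z Uz; rewrite E.
by apply: smooth_eq b => // z Uz; rewrite E.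
Qed.

Lemma smoothC_cst U c : smoothC_on U (fun=> c).
Proof. by split; exact: smooth_const. Qed.

Lemma smoothC_lin U c h1 h2 : open U -> smoothC_on U h1 -> smoothC_on U h2 ->
  smoothC_on U (fun y => c * h1 y + h2 y).
Proof.
move=> Uo [a1 b1] [a2 b2]; split.
  have := smooth_lin (complex.Re c) Uo a1 (smooth_lin (- complex.Im c) Uo b1 a2).
  apply: smooth_eq => // y _; rewrite cReD cReM; ring.
have := smooth_lin (complex.Re c) Uo b1 (smooth_lin (complex.Im c) Uo a1 b2).
by apply: smooth_eq => // y _; rewrite cImD cImM; ring.
Qed.

Lemma smoothC_conj U h : open U -> smoothC_on U h ->
  smoothC_on U (fun y => conjc (h y)).
Proof.
move=> Uo [a b]; split.
  by apply: smooth_eq a => // y _; case: (h y).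
have := smooth_lin (-1) Uo b (smooth_const (U := U) 0).
by apply: smooth_eq => // y _; case: (h y) => x w /=; rewrite addr0 mulN1r.
Qed.

Lemma smoothC_real U f : smooth_on U f -> smoothC_on U (fun y => (f y)%:C).
Proof. by move=> a; split; [exact: a | exact: smooth_const]. Qed.

Lemma smoothC_deriveC U h v : smoothC_on U h -> smoothC_on U (deriveC v h).
Proof. by move=> [a b]; split; exact: smooth_derive. Qed.

Lemma smoothC_dop U r h : open U -> smoothC_on U h -> smoothC_on U (dop r h).
Proof.
move=> Uo hs; rewrite /dop; elim: r => [|p r IH].
  by under eq_fun do rewrite big_nil; exact: smoothC_cst.
under eq_fun do rewrite big_cons.
exact: (smoothC_lin p.1 Uo (smoothC_deriveC p.2 hs) IH).
Qed.

Lemma deriveC_dop U v r h z : open U -> smoothC_on U h -> U z ->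
  deriveC v (dop r h) z = \sum_(p <- r) p.1 * deriveC v (deriveC p.2 h) z.
Proof.
move=> Uo hs Uz; have -> x : deriveC v x z = dop [:: (1, v)] x z.
  by rewrite /dop big_seq1 mul1r.
have dd p : derivableC (deriveC p h) z.
  by apply: smoothC_derivable Uz; exact: smoothC_deriveC.
rewrite dop_sum => [|p _].
  by apply: eq_bigr => p _; rewrite dopZ // /dop big_seq1 mul1r.
by apply: derivableCM => //; exact: derivableC_cst.
Qed.

Lemma deriveC_comm U u v h z : open U -> smoothC_on U h -> U z ->
  deriveC u (deriveC v h) z = deriveC v (deriveC u h) z.
Proof.
move=> Uo [a b] Uz.
apply: complexRI.
  change ('D_u ('D_v (fun y => complex.Re (h y))) z =
          'D_v ('D_u (fun y => complex.Re (h y))) z).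
  exact: (smooth_Schwarz u v Uo a Uz).
change ('D_u ('D_v (fun y => complex.Im (h y))) z =
        'D_v ('D_u (fun y => complex.Im (h y))) z).
exact: (smooth_Schwarz u v Uo b Uz).
Qed.

Lemma dop_comm U r s h z : open U -> smoothC_on U h -> U z ->
  dop r (dop s h) z = dop s (dop r h) z.
Proof.
move=> Uo hs Uz.
have E r1 s1 : dop r1 (dop s1 h) z =
    \sum_(p <- r1) \sum_(q <- s1) p.1 * q.1 * deriveC p.2 (deriveC q.2 h) z.
  apply: eq_bigr => p _; rewrite (deriveC_dop _ _ Uo hs Uz) mulr_sumr.
  by apply: eq_bigr => q _; rewrite mulrA.
rewrite !E exchange_big; apply: eq_bigr => q _; apply: eq_bigr => p _ /=.
by rewrite (deriveC_comm _ _ Uo hs Uz) [p.1 * _]mulrC.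
Qed.

Definition zdir (k : 'I_n) : seq (C * V) := [:: (2^-1, dirx k); (- (2^-1 * 'i%C), diry k)].
Definition zbdir (k : 'I_n) : seq (C * V) := [:: (2^-1, dirx k); (2^-1 * 'i%C, diry k)].

Lemma d_zE k h z : d_z k h z = dop (zdir k) h z.
Proof.
rewrite /d_z /dop /zdir big_cons big_seq1; cbn [fst snd].
move: (deriveC _ h z) (deriveC _ h z) => a b.
by rewrite mulNr -mulrA -mulrBr.
Qed.

Lemma d_zbE k h z : d_zb k h z = dop (zbdir k) h z.
Proof.
rewrite /d_zb /dop /zbdir big_cons big_seq1; cbn [fst snd].
move: (deriveC _ h z) (deriveC _ h z) => a b.
by rewrite -mulrA -mulrDr.
Qed.

(** The operators v^k d_k and, below, \bar v^k d_{\bar k}. As [v] is constant in the chart, they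
    commute on smooth functions and no derivative falls on [v]. *)
Definition vdir (v : 'rV[C]_n) : seq (C * V) :=
  flatten [seq [seq (v 0 k * p.1, p.2) | p <- zdir k] | k <- enum 'I_n].
Definition vbdir (v : 'rV[C]_n) : seq (C * V) :=
  flatten [seq [seq (conjc (v 0 k) * p.1, p.2) | p <- zbdir k] | k <- enum 'I_n].

Lemma dop_vdir (v : 'rV[C]_n) h z : dop (vdir v) h z = \sum_k v 0 k * d_z k h z.
Proof.
rewrite /dop /vdir big_flatten big_map big_enum; apply: eq_bigr => k _.
rewrite big_map d_zE /dop mulr_sumr; apply: eq_bigr => p _.
by cbn [fst snd]; rewrite mulrA.
Qed.

Lemma dop_vbdir (v : 'rV[C]_n) h z : dop (vbdir v) h z = \sum_k conjc (v 0 k) * d_zb k h z.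
Proof.
rewrite /dop /vbdir big_flatten big_map big_enum; apply: eq_bigr => k _.
rewrite big_map d_zbE /dop mulr_sumr; apply: eq_bigr => p _.
by cbn [fst snd]; rewrite mulrA.
Qed.

Lemma conj_zdir k : conj_dop (zdir k) = zbdir k.
Proof.
have c2 : conjc (2^-1 : C) = 2^-1.
  by rewrite (_ : 2^-1 = (2^-1 : R)%:C) ?conjcR // fmorphV /= rmorph_nat.
have ci : conjc (- (2^-1 * 'i%C) : C) = 2^-1 * 'i%C.
  rewrite conjcN conjcM c2 -mulrN; congr (_ * _).
  by apply/eqP; rewrite eq_complex /= oppr0 opprK !eqxx.
by rewrite /conj_dop /zdir /zbdir; cbn [map fst snd]; rewrite c2 ci.
Qed.

Lemma conj_zbdir k : conj_dop (zbdir k) = zdir k.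
Proof. by rewrite -conj_zdir conj_dopK. Qed.

Lemma conj_vdir (v : 'rV[C]_n) : conj_dop (vdir v) = vbdir v.
Proof.
rewrite /conj_dop /vdir /vbdir map_flatten -map_comp; congr flatten.
apply: eq_map => k.
rewrite -[LHS]/(conj_dop [seq (v 0 k * p.1, p.2) | p <- zdir k]) -conj_zdir /conj_dop.
by elim: (zdir k) => //= p l ->; rewrite conjcM.
Qed.

Lemma conj_vbdir (v : 'rV[C]_n) : conj_dop (vbdir v) = vdir v.
Proof. by rewrite -conj_vdir conj_dopK. Qed.

Lemma d_z_conj k h z : derivableC h z ->
  d_z k (fun y => conjc (h y)) z = conjc (d_zb k h z).
Proof. by move=> dh; rewrite d_zE d_zbE -conj_zbdir dop_conj. Qed.

Lemma d_zb_conj k h z : derivableC h z ->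
  d_zb k (fun y => conjc (h y)) z = conjc (d_z k h z).
Proof. by move=> dh; rewrite d_zE d_zbE -conj_zdir dop_conj. Qed.

End ComplexDerivatives.

(** * Derivatives of matrix-valued functions *)

Section MatrixDerivatives.
Context {R : realType} {n : nat}.
Local Notation C := R[i].
Local Notation V := (Cn R n).
Implicit Types (z : V) (U : set V) (r s : seq (C * V)).

Definition derivable_mx m p (X : V -> 'M[C]_(m, p)) z :=
  forall i j, derivableC (fun y => X y i j) z.

Definition smooth_mx U m p (X : V -> 'M[C]_(m, p)) :=
  forall i j, smoothC_on U (fun y => X y i j).

Definition mxd r m p (X : V -> 'M[C]_(m, p)) z : 'M[C]_(m, p) :=
  \matrix_(i, j) dop r (fun y => X y i j) z.

Lemma derivable_mx_near m p (X Y : V -> 'M[C]_(m, p)) z :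
  (\forall y \near z, X y = Y y) -> derivable_mx X z -> derivable_mx Y z.
Proof.
by move=> E dX i j; apply: derivableC_near (dX i j); apply: filterS E => y ->.
Qed.

Lemma mxd_near r m p (X Y : V -> 'M[C]_(m, p)) z :
  (\forall y \near z, X y = Y y) -> mxd r X z = mxd r Y z.
Proof.
move=> E; apply/matrixP => i j; rewrite !mxE; apply: dop_near.
by apply: filterS E => y ->.
Qed.

Lemma derivable_mx_cst m p (c : 'M[C]_(m, p)) z : derivable_mx (fun=> c) z.
Proof. by move=> i j; exact: derivableC_cst. Qed.

Lemma mxd_cst r m p (c : 'M[C]_(m, p)) z : mxd r (fun=> c) z = 0.
Proof. by apply/matrixP => i j; rewrite !mxE dop_cst. Qed.

Lemma derivable_mxM m p q (X : V -> 'M[C]_(m, p)) (Y : V -> 'M[C]_(p, q)) z :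
  derivable_mx X z -> derivable_mx Y z -> derivable_mx (fun y => X y *m Y y) z.
Proof.
move=> dX dY i j; under eq_fun do rewrite mxE.
by apply: derivableC_sum => k _; exact: derivableCM (dX i k) (dY k j).
Qed.

Lemma mxdM r m p q (X : V -> 'M[C]_(m, p)) (Y : V -> 'M[C]_(p, q)) z :
  derivable_mx X z -> derivable_mx Y z ->
  mxd r (fun y => X y *m Y y) z = mxd r X z *m Y z + X z *m mxd r Y z.
Proof.
move=> dX dY; apply/matrixP => i j; rewrite [LHS]mxE.
under eq_fun do rewrite mxE.
rewrite dop_sum => [|k _]; last exact: derivableCM (dX i k) (dY k j).
rewrite !mxE -big_split; apply: eq_bigr => k _.
by rewrite (dopM _ (dX i k) (dY k j)) !mxE.
Qed.

Lemma derivable_mxD m p (X Y : V -> 'M[C]_(m, p)) z :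
  derivable_mx X z -> derivable_mx Y z -> derivable_mx (fun y => X y + Y y) z.
Proof.
move=> dX dY i j; under eq_fun do rewrite mxE.
exact: derivableCD (dX i j) (dY i j).
Qed.

Lemma mxdD r m p (X Y : V -> 'M[C]_(m, p)) z :
  derivable_mx X z -> derivable_mx Y z ->
  mxd r (fun y => X y + Y y) z = mxd r X z + mxd r Y z.
Proof.
move=> dX dY; apply/matrixP => i j; rewrite [LHS]mxE.
under eq_fun do rewrite mxE.
by rewrite (dopD _ (dX i j) (dY i j)) !mxE.
Qed.

Lemma derivable_mxN m p (X : V -> 'M[C]_(m, p)) z :
  derivable_mx X z -> derivable_mx (fun y => - X y) z.
Proof.
move=> dX i j; under eq_fun do rewrite mxE -mulN1r.
exact: derivableCM (derivableC_cst _ _) (dX i j).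
Qed.

Lemma mxdZ r m p c (X : V -> 'M[C]_(m, p)) z :
  derivable_mx X z -> mxd r (fun y => c *: X y) z = c *: mxd r X z.
Proof.
move=> dX; apply/matrixP => i j; rewrite [LHS]mxE.
under eq_fun do rewrite mxE.
by rewrite (dopZ _ _ (dX i j)) !mxE.
Qed.

Lemma mxdN r m p (X : V -> 'M[C]_(m, p)) z :
  derivable_mx X z -> mxd r (fun y => - X y) z = - mxd r X z.
Proof.
move=> dX; under eq_fun do rewrite -scaleN1r.
by rewrite mxdZ // scaleN1r.
Qed.

Lemma derivable_mx_tr m (X : V -> 'M[C]_m) z :
  derivable_mx X z -> derivableC (fun y => \tr (X y)) z.
Proof. by move=> dX; apply: derivableC_sum => i _; exact: dX. Qed.

Lemma dop_tr r m (X : V -> 'M[C]_m) z :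
  derivable_mx X z -> dop r (fun y => \tr (X y)) z = \tr (mxd r X z).
Proof.
move=> dX; rewrite dop_sum => [|i _]; last exact: dX.
by apply: eq_bigr => i _; rewrite mxE.
Qed.

Lemma derivable_mx_adj m p (X : V -> 'M[C]_(m, p)) z :
  derivable_mx X z -> derivable_mx (fun y => (X y)^H) z.
Proof.
move=> dX i j; under eq_fun do rewrite adjmE.
exact: derivableC_conj (dX j i).
Qed.

Lemma mxd_adj r m p (X : V -> 'M[C]_(m, p)) z : derivable_mx X z ->
  mxd (conj_dop r) (fun y => (X y)^H) z = (mxd r X z)^H.
Proof.
move=> dX; apply/matrixP => i j; rewrite adjmE [LHS]mxE.
under eq_fun do rewrite adjmE.
by rewrite (dop_conj _ (dX j i)) mxE.
Qed.

Lemma derivableC_det m (X : V -> 'M[C]_m) z :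
  derivable_mx X z -> derivableC (fun y => \det (X y)) z.
Proof.
move=> dX; apply: derivableC_sum => s _.
apply: derivableCM; first exact: derivableC_cst.
by apply: derivableC_prod => i _; exact: dX.
Qed.

Lemma derivable_mx_inv U m (X : V -> 'M[C]_m) z : open U -> U z ->
  (forall y, U y -> X y \in unitmx) -> derivable_mx X z ->
  derivable_mx (fun y => invmx (X y)) z.
Proof.
move=> Uo Uz Xu dX.
apply: (@derivable_mx_near _ _ (fun y => (\det (X y))^-1 *: \adj (X y))).
  by apply: filterS (open_near Uo Uz) => y Uy; rewrite /invmx Xu.
move=> i j; under eq_fun do rewrite mxE.
apply: derivableCM.
  apply: derivableC_inv; last exact: derivableC_det.
  by have := Xu z Uz; rewrite unitmxE unitfE.
under eq_fun do rewrite mxE; apply: derivableCM; first exact: derivableC_cst.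
by apply: derivableC_det => k l; under eq_fun do rewrite !mxE; exact: dX.
Qed.

Lemma mxd_inv U r m (X : V -> 'M[C]_m) z : open U -> U z ->
  (forall y, U y -> X y \in unitmx) -> derivable_mx X z ->
  mxd r (fun y => invmx (X y)) z = - (invmx (X z) *m mxd r X z *m invmx (X z)).
Proof.
move=> Uo Uz Xu dX; have dP := derivable_mx_inv Uo Uz Xu dX.
have : mxd r (fun y => invmx (X y) *m X y) z = 0.
  rewrite -(mxd_cst r 1%:M z); apply: mxd_near.
  by apply: filterS (open_near Uo Uz) => y Uy; rewrite mulVmx // Xu.
rewrite mxdM // => /(congr1 (mulmx^~ (invmx (X z)))).
rewrite mulmxDl mul0mx mulmxK ?Xu // => /eqP.
by rewrite addr_eq0 => /eqP.
Qed.

Lemma smooth_mx_derivable U m p (X : V -> 'M[C]_(m, p)) z :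
  smooth_mx U X -> U z -> derivable_mx X z.
Proof. by move=> Xs Uz i j; exact: smoothC_derivable (Xs i j) Uz. Qed.

Lemma smooth_mxd U r m p (X : V -> 'M[C]_(m, p)) : open U ->
  smooth_mx U X -> smooth_mx U (mxd r X).
Proof.
move=> Uo Xs i j; under eq_fun do rewrite mxE.
exact: smoothC_dop Uo (Xs i j).
Qed.

Lemma mxd_comm U r s m p (X : V -> 'M[C]_(m, p)) z : open U -> U z ->
  smooth_mx U X -> mxd r (mxd s X) z = mxd s (mxd r X) z.
Proof.
move=> Uo Uz Xs; apply/matrixP => i j; rewrite [LHS]mxE [RHS]mxE.
have E t : (fun y => mxd t X y i j) = dop t (fun y => X y i j).
  by apply/funext => y; rewrite mxE.
by rewrite !E; exact: dop_comm Uo (Xs i j) Uz.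
Qed.

Lemma smooth_mxD U m p (X Y : V -> 'M[C]_(m, p)) : open U ->
  smooth_mx U X -> smooth_mx U Y -> smooth_mx U (fun y => X y + Y y).
Proof.
move=> Uo Xs Ys i j.
have := smoothC_lin 1 Uo (Xs i j) (Ys i j).
by apply: smoothC_eq => // y _; rewrite mxE mul1r.
Qed.

Lemma smooth_mxZ U m p c (X : V -> 'M[C]_(m, p)) : open U ->
  smooth_mx U X -> smooth_mx U (fun y => c *: X y).
Proof.
move=> Uo Xs i j.
have := smoothC_lin c Uo (Xs i j) (smoothC_cst U 0).
by apply: smoothC_eq => // y _; rewrite mxE addr0.
Qed.

(* The second variation of tr (G^-1 S); the derivatives of G^-1 are expressed
   through those of G. *)
Lemma dop2_tr_inv U r s m (G S : V -> 'M[C]_m) z : open U -> U z ->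
  (forall y, U y -> G y \in unitmx) -> smooth_mx U G ->
  (forall y, U y -> derivable_mx S y) -> derivable_mx (mxd s S) z ->
  dop r (dop s (fun y => \tr (invmx (G y) *m S y))) z =
    trvar (invmx (G z)) (mxd r G z) (mxd s G z) (mxd r (mxd s G) z)
          (S z) (mxd r S z) (mxd s S z) (mxd r (mxd s S) z).
Proof.
move=> Uo Uz Gu Gs dS dsS.
have dG y : U y -> derivable_mx G y by exact: smooth_mx_derivable.
pose P y := invmx (G y).
have dP y : U y -> derivable_mx P y by move=> Uy; exact: derivable_mx_inv Uo Uy Gu (dG y Uy).
have PE t y : U y -> mxd t P y = - (P y *m mxd t G y *m P y).
  by move=> Uy; exact: mxd_inv Uo Uy Gu (dG y Uy).
have dsG : derivable_mx (mxd s G) z.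
  by apply: smooth_mx_derivable Uz; exact: smooth_mxd.
have dPz := dP z Uz; have dSz := dS z Uz.
have dPGP : derivable_mx (fun y => P y *m mxd s G y *m P y) z.
  exact: derivable_mxM (derivable_mxM dPz dsG) dPz.
have E1 : \forall y \near z, dop s (fun y => \tr (P y *m S y)) y =
    \tr (- (P y *m mxd s G y *m P y) *m S y + P y *m mxd s S y).
  apply: filterS (open_near Uo Uz) => y Uy.
  rewrite dop_tr; last exact: derivable_mxM (dP y Uy) (dS y Uy).
  by rewrite (mxdM _ (dP y Uy) (dS y Uy)) PE.
have dN := derivable_mxN dPGP.
rewrite (dop_near _ E1) dop_tr; last first.
  exact: derivable_mxD (derivable_mxM dN dSz) (derivable_mxM dPz dsS).
rewrite (mxdD _ (derivable_mxM dN dSz) (derivable_mxM dPz dsS)).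
rewrite (mxdM _ dN dSz) (mxdM _ dPz dsS) (mxdN _ dPGP).
rewrite (mxdM _ (derivable_mxM dPz dsG) dPz) (mxdM _ dPz dsG) !PE //.
by rewrite trvar_inv.
Qed.

End MatrixDerivatives.

(** * Variations of a positive semidefinite form at a null vector *)

Section MinimumAlongLines.
Context {R : realType} {V : normedModType R}.

(** [f0], [f1] and [f2] are the coefficients of the form on the moving vector v - s a, read at z + s
    u. The resulting function of s is nonnegative and vanishes at s = 0; the two conclusions are its
    first and second derivative there. *)
Lemma second_variation_min (U : set V) (z u : V) (f0 f1 f2 : V -> R) :
  open U -> U z -> smooth_on U f0 -> smooth_on U f1 -> smooth_on U f2 ->
  f0 z = 0 ->
  (forall s : R, U (s *: u + z) ->
    0 <= f0 (s *: u + z) - s * f1 (s *: u + z) + s ^+ 2 * f2 (s *: u + z)) ->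
  'D_u f0 z = f1 z /\ 0 <= 'D_u ('D_u f0) z - 2 * 'D_u f1 z + 2 * f2 z.
Proof.
move=> Uo Uz s0 s1 s2 f0z fge0.
pose c (f : V -> R) (s : R) := f (s *: u + z).
have cE f : c f 0 = f z by rewrite /c scale0r add0r.
pose p (s : R) := c f0 s - s * c f1 s + s * s * c f2 s.
pose dp (s : R) := c ('D_u f0) s - (c f1 s + s * c ('D_u f1) s) +
  ((s + s) * c f2 s + s * s * c ('D_u f2) s).
have cU : \forall s \near (0 : R), U (s *: u + z).
  have L : s *: u + z @[s --> (0 : R)] --> z.
    have : s *: u @[s --> (0 : R)] --> (0 : R) *: u.
      by apply: cvgZr_tmp; exact: cvg_id.
    move=> L; have := cvgD L (cvg_cst z); rewrite scale0r add0r; apply.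
  by apply: L; exact: open_nbhs_nbhs.
have dc f s : smooth_on U f -> U (s *: u + z) -> is_derive s 1 (c f) (c ('D_u f) s).
  by move=> fs Us; apply: is_derive_line; exact: smooth_derivable fs Us.
have pge0 : \forall s \near (0 : R), 0 <= p s.
  by apply: filterS cU => s /fge0; rewrite /p /c expr2.
clearbody c.
have did (s : R) : is_derive s 1 (fun s : R => s) 1 by exact: is_derive_id.
have dM (f g : R -> R) (s df dg : R) : is_derive s (1 : R) f df ->
    is_derive s (1 : R) g dg -> is_derive s (1 : R) (fun s => f s * g s) (df * g s + f s * dg).
  move=> h1 h2; apply: (is_derive_eq (is_deriveM h1 h2)).
  by rewrite /GRing.scale /= addrC [g s * _]mulrC.
have dD (f g : R -> R) (s df dg : R) : is_derive s (1 : R) f df ->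
    is_derive s (1 : R) g dg -> is_derive s (1 : R) (fun s => f s + g s) (df + dg).
  by move=> h1 h2; exact: is_deriveD.
have dp1 : \forall s \near (0 : R), is_derive (s : R) (1 : R) p (dp s).
  apply: filterS cU => s Us.
  have a0 := dc f0 s s0 Us; have a1 := dc f1 s s1 Us; have a2 := dc f2 s s2 Us.
  apply: (is_derive_eq (is_deriveD (is_deriveB a0 (dM _ _ _ _ _ (did s) a1))
    (dM _ _ _ _ _ (dM _ _ _ _ _ (did s) (did s)) a2))).
  by rewrite /dp; ring.
have U0 : U ((0 : R) *: u + z) by rewrite scale0r add0r.
have dp2 : is_derive (0 : R) (1 : R) dp
    ('D_u ('D_u f0) z - 2 * 'D_u f1 z + 2 * f2 z).
  have s0' := smooth_derive u s0; have s1' := smooth_derive u s1.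
  have s2' := smooth_derive u s2.
  have a0 := dc _ 0 s0' U0; have a1 := dc _ 0 s1 U0; have a2 := dc _ 0 s2 U0.
  have a1' := dc _ 0 s1' U0; have a2' := dc _ 0 s2' U0.
  apply: (is_derive_eq (is_deriveD
    (is_deriveB a0 (is_deriveD a1 (dM _ _ _ _ _ (did 0) a1')))
    (is_deriveD (dM _ _ _ _ _ (dD _ _ _ _ _ (did 0) (did 0)) a2)
       (dM _ _ _ _ _ (dM _ _ _ _ _ (did 0) (did 0)) a2')))).
  have alg (x y y' w w' v : R) : x - (y + (1 * y + 0 * y')) +
      ((1 + 1) * v + (0 + 0) * w + ((1 * 0 + 0 * 1) * w + 0 * 0 * w')) =
      x - 2 * y + 2 * v by ring.
  by rewrite -(cE ('D_u ('D_u f0))) -(cE ('D_u f1)) -(cE f2); exact: alg.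
have p0 : p 0 = 0 by rewrite /p !cE f0z; ring.
have [e1 e2] := second_derivative_min dp1 dp2 p0 pge0.
split; last exact: e2.
by move: e1; rewrite /dp !cE; lra.
Qed.

End MinimumAlongLines.

Section PsdMinimum.
Context {R : realType} {n : nat}.
Local Notation C := R[i].
Local Notation V := (Cn R n).

(** The real tangent vector with complex coordinates [w]; the derivative along it is the sum of
    those along [vdir w] and [vbdir w]. *)
Definition real_dir (w : 'rV[C]_n) : V :=
  (\row_k complex.Re (w 0 k), \row_k complex.Im (w 0 k)).

Lemma Re_comb (p q : R) (x y : C) :
  complex.Re (p%:C * x + q%:C * y) = p * complex.Re x + q * complex.Re y.
Proof. by case: x y => a b [c d] /=; ring. Qed.

Lemma Im_comb (p q : R) (x y : C) :
  complex.Im (p%:C * x + q%:C * y) = p * complex.Im x + q * complex.Im y.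
Proof. by case: x y => a b [c d] /=; ring. Qed.

Lemma real_dirE w : real_dir w = \sum_(b <- [seq (k, c) | k <- enum 'I_n, c <- [:: true; false]])
  (if b.2 then complex.Re (w 0 b.1) else complex.Im (w 0 b.1)) *:
  (if b.2 then dirx b.1 else diry b.1 : V).
Proof.
rewrite big_allpairs /= big_enum /=.
under eq_bigr do rewrite big_cons big_seq1 /=.
have sum1 (I : Type) (r : seq I) (h : I -> V) : (\sum_(i <- r) h i).1 = \sum_(i <- r) (h i).1.
  by apply: (big_morph fst).
have sum2 (I : Type) (r : seq I) (h : I -> V) : (\sum_(i <- r) h i).2 = \sum_(i <- r) (h i).2.
  by apply: (big_morph snd).
apply: injective_projections; [rewrite sum1 | rewrite sum2]; apply/rowP => j;
  rewrite summxE (bigD1 j) //= big1 => [|k /negPf kj]; rewrite !mxE ?eqxx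
    ?[j == k]eq_sym ?kj ?mulr0 ?mulr1 ?addr0 ?add0r //.
Qed.

Lemma deriveC_real_dir U w h z : open U -> smoothC_on U h -> U z ->
  deriveC (real_dir w) h z = dop (vdir w) h z + dop (vbdir w) h z.
Proof.
move=> Uo [hr hi] Uz.
pose e (b : 'I_n * bool) : V := if b.2 then dirx b.1 else diry b.1.
pose a (b : 'I_n * bool) := if b.2 then complex.Re (w 0 b.1) else complex.Im (w 0 b.1).
have DE f : smooth_on U f -> 'D_(real_dir w) f z =
    \sum_k (complex.Re (w 0 k) * 'D_(dirx k) f z + complex.Im (w 0 k) * 'D_(diry k) f z).
  move=> fs; rewrite real_dirE.
  have De i y : U y -> derivable f y (e i).
    by move=> Uy; exact: smooth_derivable fs Uy.
  have Ce i : {for z, continuous ('D_(e i) f)}.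
    by apply: smooth_continuous Uz; exact: smooth_derive.
  rewrite (@derive_val _ _ _ _ _ _ _ (is_derive_comb _ a Uo Uz De Ce)).
  rewrite big_allpairs big_enum; apply: eq_bigr => k _.
  by rewrite big_cons big_seq1.
rewrite dop_vdir dop_vbdir -big_split /=.
have -> : deriveC (real_dir w) h z = \sum_k ((complex.Re (w 0 k))%:C * deriveC (dirx k) h z
    + (complex.Im (w 0 k))%:C * deriveC (diry k) h z).
  rewrite {1}/deriveC (DE _ hr) (DE _ hi).
  have ReS (I : Type) (r : seq I) (g : I -> C) :
      complex.Re (\sum_(i <- r) g i) = \sum_(i <- r) complex.Re (g i).
    by apply: (big_morph (@complex.Re R)) => // x y; exact: cReD.
  have ImS (I : Type) (r : seq I) (g : I -> C) :
      complex.Im (\sum_(i <- r) g i) = \sum_(i <- r) complex.Im (g i).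
    by apply: (big_morph (@complex.Im R)) => // x y; exact: cImD.
  apply: complexRI; [rewrite ReS | rewrite ImS]; apply: eq_bigr => k _.
    by rewrite Re_comb.
  by rewrite Im_comb.
apply: eq_bigr => k _; rewrite /d_z /d_zb.
move: (deriveC _ h z) (deriveC _ h z) (w 0 k) => y x c.
have -> : conjc c = (complex.Re c)%:C - 'i%C * (complex.Im c)%:C.
  by rewrite {1}[c]complexE conjcD conjcM !conjcR -mulNr; congr (_ + _ * _);
     apply/eqP; rewrite eq_complex /= oppr0 !eqxx.
rewrite {3}[c]complexE.
move: (complex.Re c)%:C (complex.Im c)%:C => p q.
have ii : 'i%C * 'i%C = -1 :> C by rewrite -expr2 sqr_i.
have hh : 2^-1 + 2^-1 = 1 :> C by rewrite [RHS]splitr mul1r.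
transitivity ((2^-1 + 2^-1) * (p * x) - ('i%C * 'i%C) * ((2^-1 + 2^-1) * (q * y))).
  by rewrite ii hh; ring.
by move: 'i%C (2^-1) => i h2; ring.
Qed.

Lemma dop_cat r s (h : V -> C) z : dop (r ++ s) h z = dop r h z + dop s h z.
Proof. exact: big_cat. Qed.

Lemma mxd_cat r s m p (X : V -> 'M[C]_(m, p)) z :
  mxd (r ++ s) X z = mxd r X z + mxd s X z.
Proof. by apply/matrixP => i j; rewrite !mxE dop_cat. Qed.

Lemma mxd_vdirZ c w m p (X : V -> 'M[C]_(m, p)) z :
  mxd (vdir (c *: w)) X z = c *: mxd (vdir w) X z.
Proof.
apply/matrixP => i j; rewrite !mxE !dop_vdir mulr_sumr; apply: eq_bigr => k _.
by rewrite mxE mulrA.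
Qed.

Lemma mxd_vbdirZ c w m p (X : V -> 'M[C]_(m, p)) z :
  mxd (vbdir (c *: w)) X z = conjc c *: mxd (vbdir w) X z.
Proof.
apply/matrixP => i j; rewrite !mxE !dop_vbdir mulr_sumr; apply: eq_bigr => k _.
by rewrite mxE conjcM mulrA.
Qed.

Lemma smoothC_sum U (I : Type) (l : seq I) (h : I -> V -> C) : open U ->
  (forall i, smoothC_on U (h i)) -> smoothC_on U (fun y => \sum_(i <- l) h i y).
Proof.
move=> Uo hs; elim: l => [|i l IH].
  by under eq_fun do rewrite big_nil; exact: smoothC_cst.
under eq_fun do rewrite big_cons -[h i _]mul1r; exact: (smoothC_lin 1 Uo (hs i) IH).
Qed.

Lemma smooth_mx_sandwich U m p q l (x : 'M[C]_(m, p)) (X : V -> 'M[C]_(p, q))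
    (w : 'M[C]_(q, l)) : open U -> smooth_mx U X ->
  smooth_mx U (fun y => x *m X y *m w).
Proof.
move=> Uo Xs i j.
have xX i' j' : smoothC_on U (fun y => (x *m X y) i' j').
  under eq_fun do rewrite mxE; apply: smoothC_sum => // k.
  under eq_fun do rewrite -[_ * _]addr0; exact: (smoothC_lin _ Uo (Xs k j') (smoothC_cst U 0)).
under eq_fun do rewrite mxE; apply: smoothC_sum => // k.
under eq_fun do rewrite [_ * _]mulrC -[_ * _]addr0.
exact: (smoothC_lin _ Uo (xX i k) (smoothC_cst U 0)).
Qed.

Lemma mxd_sandwich r m p q l (x : 'M[C]_(m, p)) (X : V -> 'M[C]_(p, q))
    (w : 'M[C]_(q, l)) z : derivable_mx X z ->
  mxd r (fun y => x *m X y *m w) z = x *m mxd r X z *m w.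
Proof.
move=> dX; have dx := derivable_mx_cst x z; have dw := derivable_mx_cst w z.
rewrite (mxdM _ (derivable_mxM dx dX) dw) (mxdM _ dx dX) !mxd_cst.
by rewrite mul0mx add0r mulmx0 addr0.
Qed.

Section AtKernel.
Variables (U : set V) (N : V -> 'M[C]_n) (z : V) (v : 'rV[C]_n).
Hypotheses (Uo : open U) (Uz : U z) (Ns : smooth_mx U N).
Hypotheses (NH : forall y, U y -> (N y)^H = N y) (N0 : forall y, U y -> psd (N y)).
Hypothesis Nv : N z *m v^H = 0.

Let bil (x w : 'rV[C]_n) y := (x *m N y *m w^H) 0 0.

Let bil_smooth x w : smoothC_on U (bil x w).
Proof. exact: (smooth_mx_sandwich x w^H Uo Ns 0 0). Qed.

Let dNz : derivable_mx N z.
Proof. exact: smooth_mx_derivable Ns Uz. Qed.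

Let dop_bil r x w : dop r (bil x w) z = (x *m mxd r N z *m w^H) 0 0.
Proof. by rewrite -mxd_sandwich // mxE. Qed.

Let dop2_bil r s x w :
  dop r (dop s (bil x w)) z = (x *m mxd r (mxd s N) z *m w^H) 0 0.
Proof.
have dsN : derivable_mx (mxd s N) z.
  by apply: smooth_mx_derivable Uz; exact: smooth_mxd.
rewrite -(mxd_sandwich r x w^H dsN) mxE; apply: dop_near.
apply: filterS (open_near Uo Uz) => y Uy.
rewrite -mxd_sandwich; first by rewrite mxE.
exact: smooth_mx_derivable Ns Uy.
Qed.

(** The point moves along the real direction of [w] while the null vector moves to v - s a. Since N
    v = 0, the cross terms vanish at z itself and enter only through their derivative. *)
Let line_variation (w a : 'rV[C]_n) (L := vdir w ++ vbdir w) :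
  complex.Re ((v *m mxd L N z *m v^H) 0 0) = 0 /\
  0 <= complex.Re ((v *m mxd L (mxd L N) z *m v^H) 0 0
     - 2%:R%:C * (a *m mxd L N z *m v^H + v *m mxd L N z *m a^H) 0 0
     + 2%:R%:C * (a *m N z *m a^H) 0 0).
Proof.
pose B1 y := bil a v y + bil v a y.
have B1s : smoothC_on U B1.
  have := smoothC_lin 1 Uo (bil_smooth a v) (bil_smooth v a).
  by apply: smoothC_eq => // y _; rewrite mul1r.
have dE h y : smoothC_on U h -> U y -> deriveC (real_dir w) h y = dop L h y.
  by move=> hs Uy; rewrite dop_cat; exact: (deriveC_real_dir w Uo hs Uy).
have [] := @second_variation_min R V U z (real_dir w)
   (fun y => complex.Re (bil v v y)) (fun y => complex.Re (B1 y))
   (fun y => complex.Re (bil a a y)) Uo Uz (bil_smooth v v).1 B1s.1 (bil_smooth a a).1.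
- by rewrite /bil -mulmxA Nv mulmx0 mxE.
- move=> s; set y := _ + z => Uy.
  have := N0 Uy (v - s%:C *: a); rewrite lecE => /andP[_].
  rewrite hformE adjmB adjmZ conjcR !mulmxBl !mulmxBr -!scalemxAl -!scalemxAr.
  rewrite /B1 /bil !mxE.
  move: (\sum_j _) (\sum_j _) (\sum_j _) (\sum_j _) => b1 b2 b3 b4.
  case: b1 => p1 q1; case: b2 => p2 q2; case: b3 => p3 q3; case: b4 => p4 q4 /=.
  by move=> h; lra.
have vN : v *m N z = 0.
  by rewrite -[LHS]adjmK adjmM NH // Nv /adjm trmx0 map_mx0.
have B1z : B1 z = 0.
  by rewrite /B1 /bil -mulmxA Nv mulmx0 vN mul0mx mxE addr0.
move=> e1 e2.
have {}e1 : complex.Re (deriveC (real_dir w) (bil v v) z) = complex.Re (B1 z) := e1.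
have {}e2 : 0 <= complex.Re (deriveC (real_dir w) (deriveC (real_dir w) (bil v v)) z) -
  2 * complex.Re (deriveC (real_dir w) B1 z) + 2 * complex.Re (bil a a z) := e2.
move: e1 e2.
rewrite (dE _ _ (bil_smooth v v) Uz) (dE _ _ B1s Uz).
rewrite (dE _ _ (smoothC_deriveC _ (bil_smooth v v)) Uz).
have -> : dop L (deriveC (real_dir w) (bil v v)) z = dop L (dop L (bil v v)) z.
  apply: dop_near; apply: filterS (open_near Uo Uz) => y Uy.
  exact: dE (bil_smooth v v) Uy.
rewrite B1z dop2_bil dop_bil dopD ?dop_bil; first last.
- exact: smoothC_derivable (bil_smooth v a) Uz.
- exact: smoothC_derivable (bil_smooth a v) Uz.
move=> e1 e2; split; first exact: e1.
move: e2; rewrite /bil [(_ + _ : 'M[C]_(1, 1)) 0 0]mxE.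
move: ((_ *m _) 0 0) ((_ *m _) 0 0) ((_ *m _) 0 0) ((_ *m _) 0 0) => b1 b2 b3 b4.
case: b1 => p1 q1; case: b2 => p2 q2; case: b3 => p3 q3; case: b4 => p4 q4 /=.
by move=> h; lra.
Qed.

(** The real variation along [w] gives the real part. The expression is complex linear in [w], so
    replacing [w] by i w gives the imaginary part. *)
Lemma first_variation_kernel w : v *m mxd (vdir w) N z *m v^H = 0.
Proof.
have E (w1 : 'rV[C]_n) : complex.Re ((v *m mxd (vdir w1) N z *m v^H) 0 0) = 0.
  have [e _] := line_variation w1 0; move: e; rewrite mxd_cat.
  rewrite mulmxDr mulmxDl mxE.
  have -> : (v *m mxd (vbdir w1) N z *m v^H) 0 0 =
      conjc ((v *m mxd (vdir w1) N z *m v^H) 0 0).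
    rewrite -adjmE !adjmM adjmK mulmxA; congr ((_ *m _ *m _) 0 0).
    rewrite -mxd_adj // conj_vdir; apply: mxd_near.
    by apply: filterS (open_near Uo Uz) => y Uy; rewrite NH.
  by case: (_ 0 0) => p q /=; rewrite -mulr2n => /eqP; rewrite mulrn_eq0 => /eqP.
have := E w; have := E ('i%C *: w); rewrite mxd_vdirZ -scalemxAr -scalemxAl mxE.
move=> e1 e2; apply/matrixP => i j; rewrite !ord1 [RHS]mxE.
move: e1 e2; case: (_ 0 0) => p q /=; rewrite mul0r mul1r sub0r => /eqP.
by rewrite oppr_eq0 => /eqP-> ->.
Qed.

(** Add the variations for (w, a) and for (i w, i a): the pure second derivatives along w and along
    \bar w cancel, as do the unwanted cross terms, and four times the mixed expression remains. *)
Lemma second_variation_kernel w a :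
  0 <= complex.Re ((v *m mxd (vdir w) (mxd (vbdir w) N) z *m v^H
    - a *m mxd (vbdir w) N z *m v^H - v *m mxd (vdir w) N z *m a^H
    + a *m N z *m a^H) 0 0).
Proof.
have dd r : derivable_mx (mxd r N) z.
  by apply: smooth_mx_derivable Uz; exact: smooth_mxd.
have comm r s : mxd r (mxd s N) z = mxd s (mxd r N) z by exact: mxd_comm Uo Uz Ns.
pose A := mxd (vdir w) N; pose B := mxd (vbdir w) N.
pose L := vdir w ++ vbdir w; pose L' := vdir ('i%C *: w) ++ vbdir ('i%C *: w).
have dA : derivable_mx A z := dd _; have dB : derivable_mx B z := dd _.
have ci : conjc 'i%C = - 'i%C :> C.
  by apply/eqP; rewrite eq_complex /= oppr0 !eqxx.
have ii : 'i%C * 'i%C = -1 :> C by rewrite -expr2 sqr_i.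
have E1 : mxd L N = fun y => A y + B y by apply/funext => y; rewrite mxd_cat.
have L'E (X : V -> 'M[C]_n) y : mxd L' X y = 'i%C *: (mxd (vdir w) X y - mxd (vbdir w) X y).
  by rewrite mxd_cat mxd_vdirZ mxd_vbdirZ ci scaleNr scalerBr.
have E1' : mxd L' N = fun y => 'i%C *: (A y - B y) by apply/funext => y; exact: L'E.
have AB : mxd (vbdir w) A z = mxd (vdir w) B z by exact: comm.
have E2 : mxd L (mxd L N) z = mxd (vdir w) A z + mxd (vdir w) B z +
    (mxd (vdir w) B z + mxd (vbdir w) B z).
  by rewrite E1 mxd_cat !(mxdD _ dA dB) AB.
have dNB := derivable_mxN dB; have dAB := derivable_mxD dA dNB.
have E2' : mxd L' (mxd L' N) z = - (mxd (vdir w) A z - mxd (vdir w) B z -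
    (mxd (vdir w) B z - mxd (vbdir w) B z)).
  rewrite E1' L'E !(mxdZ _ _ dAB) !(mxdD _ dA dNB) !(mxdN _ dB) AB.
  by rewrite -scalerBr scalerA ii scaleN1r.
have [_ h1] := line_variation w a; have [_ h2] := line_variation ('i%C *: w) ('i%C *: a).
move: h1 h2; rewrite -/L -/L' E2 E2' E1 E1' -/A -/B.
move: (mxd (vdir w) A z) (mxd (vdir w) B z) (mxd (vbdir w) B z) (A z) (B z) (N z).
move=> A2 ABz B2 Az Bz Nz.
rewrite adjmZ ci -!scalemxAl -!scalemxAr -!scalemxAl !scalerA mulNr mulrN ii opprK.
rewrite !scaleN1r !scale1r !(mulmxDr, mulmxDl, mulmxN, mulNmx).
rewrite !mxE.
do 8 move: (\sum_j _) => [? ?].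
rewrite /=; lra.
Qed.

End AtKernel.

End PsdMinimum.

(** * The Levi form *)

Section LeviForm.
Context {R : realType} {n : nat}.
Local Notation C := R[i].
Local Notation V := (Cn R n).
Implicit Types (U : set V) (l : V -> R) (N : V -> 'M[C]_n) (v w : 'rV[C]_n).

Definition closed_form U N := forall y, U y -> forall i j k,
  d_z k (fun x => N x i j) y = d_z i (fun x => N x k j) y /\
  d_zb k (fun x => N x i j) y = d_zb j (fun x => N x i k) y.

Definition levi l y : 'M[C]_n :=
  \matrix_(i, j) d_z i (d_zb j (fun x => (l x)%:C)) y.

Definition dcol l y : 'cV[C]_n := \col_k d_z k (fun x => (l x)%:C) y.

Lemma d_z_fun k (h : V -> C) : d_z k h = dop (zdir k) h.
Proof. by apply/funext => y; exact: d_zE. Qed.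

Lemma d_zb_fun k (h : V -> C) : d_zb k h = dop (zbdir k) h.
Proof. by apply/funext => y; exact: d_zbE. Qed.

Section OneFunction.
Variables (U : set V) (l : V -> R).
Hypotheses (Uo : open U) (ls : smooth_on U l).

Let lc y : C := (l y)%:C.

Let lcs : smoothC_on U lc.
Proof. exact: smoothC_real. Qed.

Let dops r : smoothC_on U (dop r lc).
Proof. exact: smoothC_dop Uo lcs. Qed.

Lemma levi_smooth : smooth_mx U (levi l).
Proof.
move=> i j; under eq_fun do rewrite mxE d_z_fun d_zb_fun.
exact: smoothC_dop Uo (dops _).
Qed.

Lemma dcol_smooth : smooth_mx U (dcol l).
Proof.
move=> i j; under eq_fun do rewrite mxE d_zE.
exact: dops.
Qed.

Lemma levi_herm y : U y -> (levi l y)^H = levi l y.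
Proof.
move=> Uy; apply/matrixP => i j; rewrite adjmE !mxE !d_z_fun !d_zb_fun.
have dd r x : U x -> derivableC (dop r lc) x by exact: smoothC_derivable (dops r).
rewrite -dop_conj; last exact: dd.
rewrite conj_zdir (dop_comm _ _ Uo lcs Uy); apply: dop_near.
apply: filterS (open_near Uo Uy) => x Ux.
rewrite -dop_conj; last exact: smoothC_derivable lcs Ux.
by rewrite conj_zbdir; apply: dop_near; apply: filterS (open_near Uo Ux) => t _;
   rewrite conjcR.
Qed.

Lemma levi_closed : closed_form U (levi l).
Proof.
move=> y Uy i j k.
have E r s h1 : (forall x, U x -> dop s lc x = h1 x) -> dop r (dop s lc) y = dop r h1 y.
  by move=> sE; apply: dop_near; apply: filterS (open_near Uo Uy).
have L i' j' : (fun x => levi l x i' j') = dop (zdir i') (dop (zbdir j') lc).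
  by apply/funext => x; rewrite mxE d_z_fun d_zb_fun.
rewrite !L !d_zE !d_zbE; split.
  by rewrite (dop_comm _ _ Uo (dops _) Uy).
rewrite (dop_comm _ _ Uo (dops _) Uy) [RHS](dop_comm _ _ Uo (dops _) Uy).
apply: dop_near; apply: filterS (open_near Uo Uy) => x Ux.
exact: dop_comm Uo lcs Ux.
Qed.

(** Through this identity, the equation N v = 0 controls the conjugate derivative of the gradient
    column. *)
Lemma levi_mul_adj v y : U y -> levi l y *m v^H = mxd (vbdir v) (dcol l) y.
Proof.
move=> Uy; apply/matrixP => i j; rewrite !mxE dop_vbdir; apply: eq_bigr => k _.
have -> : (fun x => dcol l x i j) = dop (zdir i) lc.
  by apply/funext => x; rewrite mxE d_zE.
by rewrite adjmE ord1 mxE d_z_fun !d_zb_fun mulrC (dop_comm _ _ Uo lcs Uy).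
Qed.

Lemma hform_levi v y : U y ->
  hform (levi l y) v = dop (vdir v) (dop (vbdir v) lc) y.
Proof.
move=> Uy; rewrite (dop_comm _ _ Uo lcs Uy).
have -> : dop (vdir v) lc = fun x => \sum_k v 0 k * dop (zdir k) lc x.
  by apply/funext => x; rewrite dop_vdir; apply: eq_bigr => k _; rewrite d_zE.
have dd r : derivableC (dop r lc) y by exact: smoothC_derivable (dops r) Uy.
rewrite dop_sum => [|k _]; last exact: derivableCM (derivableC_cst _ _) (dd _).
rewrite hformE -mulmxA levi_mul_adj // mxE; apply: eq_bigr => k _.
have dE : (fun x => dcol l x k 0) = dop (zdir k) lc.
  by apply/funext => x; rewrite mxE d_zE.
by rewrite [mxd _ _ _ _ _]mxE dE (dopZ _ _ (dd _)).
Qed.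

End OneFunction.

Section ClosedForms.
Variables (U : set V) (N : V -> 'M[C]_n).
Hypotheses (Uo : open U) (Ns : smooth_mx U N) (Nc : closed_form U N).

(** Closedness lets the vector in the holomorphic slot and the holomorphic direction of
    differentiation change places. *)
Lemma mul_mxd_swap v w y : U y -> v *m mxd (vdir w) N y = w *m mxd (vdir v) N y.
Proof.
move=> Uy; apply/matrixP => i j; rewrite !mxE !ord1.
under eq_bigr do rewrite mxE dop_vdir mulr_sumr.
rewrite exchange_big; apply: eq_bigr => k _.
rewrite mxE dop_vdir mulr_sumr; apply: eq_bigr => k' _.
by rewrite (Nc Uy k' j k).1 mulrCA.
Qed.

Lemma mxd_mul_swap v w y : U y ->
  mxd (vbdir w) N y *m v^H = mxd (vbdir v) N y *m w^H.
Proof.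
move=> Uy; apply/matrixP => i j; rewrite !mxE !ord1.
under eq_bigr do rewrite mxE dop_vbdir mulr_suml.
rewrite exchange_big; apply: eq_bigr => k _.
rewrite mxE dop_vbdir mulr_suml; apply: eq_bigr => k' _.
by rewrite !adjmE (Nc Uy i k' k).2 mulrAC [conjc (w 0 k) * _]mulrC mulrAC.
Qed.

(** The conjugate pair is exchanged under the derivative along [w]; then the derivatives are
    commuted and the holomorphic pair is exchanged. A variation at the null vector v in an arbitrary
    direction w thus becomes a derivative along v evaluated on w. *)
Lemma mxd2_swap v w y : U y ->
  v *m mxd (vdir w) (mxd (vbdir w) N) y *m v^H =
  w *m mxd (vdir v) (mxd (vbdir v) N) y *m w^H.
Proof.
move=> Uy.
have dd r : derivable_mx (mxd r N) y.
  by apply: smooth_mx_derivable Uy; exact: smooth_mxd.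
transitivity (v *m mxd (vdir w) (mxd (vbdir v) N) y *m w^H).
  rewrite -!mulmxA; congr (_ *m _).
  have c1 (u : 'rV[C]_n) : derivable_mx (fun _ : V => u^H) y by exact: derivable_mx_cst.
  have E (u : 'rV[C]_n) (X : V -> 'M[C]_n) : derivable_mx X y ->
      mxd (vdir w) X y *m u^H = mxd (vdir w) (fun x => X x *m u^H) y.
    by move=> dX; rewrite (mxdM _ dX (c1 u)) mxd_cst mulmx0 addr0.
  rewrite (E v _ (dd (vbdir w))) (E w _ (dd (vbdir v))).
  apply: mxd_near; apply: filterS (open_near Uo Uy) => x Ux.
  exact: mxd_mul_swap.
congr (_ *m _); rewrite ![mxd (vdir _) _ y](mxd_comm _ _ Uo Uy Ns).
have c1 (u : 'rV[C]_n) : derivable_mx (fun _ : V => u) y by exact: derivable_mx_cst.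
have E (u : 'rV[C]_n) (X : V -> 'M[C]_n) : derivable_mx X y ->
    u *m mxd (vbdir v) X y = mxd (vbdir v) (fun x => u *m X x) y.
  by move=> dX; rewrite (mxdM _ (c1 u) dX) mxd_cst mul0mx add0r.
rewrite (E v _ (dd (vdir w))) (E w _ (dd (vdir v))).
apply: mxd_near; apply: filterS (open_near Uo Uy) => x Ux.
exact: mul_mxd_swap.
Qed.

(** Apply [second_variation_kernel] with a = w DG P, the first-order change dictated by the
    Christoffel symbols. Once v and w are exchanged in every term, the inequality is the value of
    [cov2] on w. *)
Lemma cov2_psd (P DG DbG : 'M[C]_n) v z : U z ->
  (forall y, U y -> (N y)^H = N y) -> (forall y, U y -> psd (N y)) ->
  N z *m v^H = 0 -> P^H = P -> DG^H = DbG ->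
  psd (cov2 P DG DbG (N z) (mxd (vdir v) N z) (mxd (vbdir v) N z)
         (mxd (vdir v) (mxd (vbdir v) N) z)).
Proof.
move=> Uz NH N0 Nv PH DGH.
have dN y : U y -> derivable_mx N y by exact: smooth_mx_derivable.
have dH r y : U y -> (mxd r N y)^H = mxd (conj_dop r) N y.
  move=> Uy; rewrite -mxd_adj; last exact: dN.
  by apply: mxd_near; apply: filterS (open_near Uo Uy) => x /NH.
have DbGH : DbG^H = DG by rewrite -DGH adjmK.
have ddH : (mxd (vdir v) (mxd (vbdir v) N) z)^H = mxd (vdir v) (mxd (vbdir v) N) z.
  rewrite -mxd_adj; last by apply: smooth_mx_derivable Uz; exact: smooth_mxd.
  rewrite conj_vdir (mxd_comm _ _ Uo Uz Ns); apply: mxd_near.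
  by apply: filterS (open_near Uo Uz) => x Ux; rewrite dH // conj_vbdir.
move=> w; rewrite hform_ge0; last first.
  rewrite /cov2 adjmD !adjmB !adjmM PH DGH DbGH ddH !dH // conj_vdir conj_vbdir NH //.
  by rewrite !mulmxA; congr (_ + _); exact: addrAC.
have := second_variation_kernel Uo Uz Ns NH N0 Nv w (w *m DG *m P).
rewrite mxd2_swap // mul_mxd_swap // -[_ *m mxd _ _ _ *m v^H]mulmxA mxd_mul_swap //.
rewrite hformE /cov2 !(mulmxDl, mulmxDr, mulmxN, mulNmx) !adjmM PH DGH !mulmxA.
by [].
Qed.

End ClosedForms.
End LeviForm.

Lemma is_derive_comp_real (R : realType) (V : normedModType R) (F : R -> R)
    (f : V -> R) z v : derivable F (f z) 1 -> derivable f z v ->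
  is_derive z v (fun y => F (f y)) (derive1 F (f z) * 'D_v f z).
Proof.
move=> dF df; pose c (s : R) := f (s *: v + z).
have z0 : (0 : R) *: v + z = z by rewrite scale0r add0r.
have [dc cE] : is_derive (0 : R) (1 : R) c ('D_v f z).
  by have := @is_derive_line R V f z v 0; rewrite z0; apply.
have c0 : c 0 = f z by rewrite /c z0.
have F0 : is_derive (c 0) (1 : R) F (derive1 F (f z)).
  rewrite c0 derive1E; exact: (derivableP dF).
have c1 : is_derive (0 : R) (1 : R) c ('D_v f z) by [].
have [dFc dFcE] := is_derive1_comp F0 c1.
have dFf : derivable (fun y => F (f y)) z v by apply/derivable1P; exact: dFc.
have dFfz : derivable (fun y => F (f y)) ((0 : R) *: v + z) v by rewrite z0.
have [_ E] := is_derive_line dFfz.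
split; first exact: dFf.
by rewrite -dFcE -[in LHS]z0; exact: esym E.
Qed.

(** * The differential inequality at a null vector, in one chart *)

Section LocalKey.
Context {R : realType} {n : nat}.
Local Notation C := R[i].
Local Notation V := (Cn R n).
Variables (U : set V) (G : V -> 'M[C]_n) (l q : V -> R) (F : R -> R).
Variables (psi : R) (v : 'rV[C]_n) (z : V).
Hypotheses (Uo : open U) (Uz : U z) (ls : smooth_on U l) (qs : smooth_on U q).
Hypotheses (Gs : smooth_mx U G) (GH : forall y, U y -> (G y)^H = G y).
Hypotheses (G0 : forall y, U y -> posdef (G y)) (Gc : closed_form U G).
Hypotheses (dF : forall u : R, derivable F u 1) (ddF : forall u : R, derivable (derive1 F) u 1).
Hypothesis F_convex : 0 <= derive1 (derive1 F) (l z).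
Hypothesis heat : forall y, U y -> (q y)%:C =
  \tr (invmx (G y) *m (levi l y + dcol l y *m (dcol l y)^H)) + (F (l y))%:C.
Hypothesis N0 : forall y, U y -> psd (levi l y + psi%:C *: G y).
Hypothesis Nv : hform (levi l z + psi%:C *: G z) v = 0.
(* R(w, \bar w, v, \bar v) >= 0 for all w *)
Hypothesis K0 : psd (mxd (vdir v) G z *m invmx (G z) *m mxd (vbdir v) G z
  - mxd (vdir v) (mxd (vbdir v) G) z).

Let N y := levi l y + psi%:C *: G y.
Let lc y : C := (l y)%:C.
Let D := vdir v.
Let Db := vbdir v.
Let b := dcol l.

Let lcs : smoothC_on U lc. Proof. exact: smoothC_real. Qed.

Let Ns : smooth_mx U N.
Proof. exact: smooth_mxD Uo (levi_smooth Uo ls) (smooth_mxZ _ Uo Gs). Qed.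

Let NH y : U y -> (N y)^H = N y.
Proof. by move=> Uy; rewrite adjmD adjmZ conjcR (levi_herm Uo ls Uy) GH. Qed.

Let mxdN r y : U y -> mxd r N y = mxd r (levi l) y + psi%:C *: mxd r G y.
Proof.
move=> Uy; have dl := smooth_mx_derivable (levi_smooth Uo ls) Uy.
have dG := smooth_mx_derivable Gs Uy.
have dZ := smooth_mx_derivable (smooth_mxZ psi%:C Uo Gs) Uy.
by rewrite (mxdD _ dl dZ) (mxdZ _ _ dG).
Qed.

Let mxd2N r s : mxd r (mxd s N) z =
  mxd r (mxd s (levi l)) z + psi%:C *: mxd r (mxd s G) z.
Proof.
have dl := smooth_mx_derivable (smooth_mxd s Uo (levi_smooth Uo ls)) Uz.
have dG := smooth_mx_derivable (smooth_mxd s Uo Gs) Uz.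
have dZ := smooth_mx_derivable (smooth_mxZ psi%:C Uo (smooth_mxd s Uo Gs)) Uz.
rewrite -(mxdZ _ _ dG) -(mxdD _ dl dZ); apply: mxd_near.
by apply: filterS (open_near Uo Uz) => y /mxdN ->.
Qed.

Let Nc : closed_form U N.
Proof.
move=> y Uy i j k.
have E (r : seq (C * V)) i' j' : dop r (fun x => N x i' j') y =
    dop r (fun x => levi l x i' j') y + psi%:C * dop r (fun x => G x i' j') y.
  by have /matrixP/(_ i' j') := mxdN r Uy; rewrite !mxE.
rewrite !d_zE !d_zbE !E -!d_zE -!d_zbE.
have [a1 a2] := levi_closed Uo ls Uy i j k; have [b1 b2] := Gc Uy i j k.
by rewrite a1 a2 b1 b2.
Qed.

Let ker : N z *m v^H = 0.
Proof. exact: psd_kernel (NH Uz) (N0 Uz) Nv. Qed.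

Let h := levi l z *m v^H.

Let bs : smooth_mx U b. Proof. exact: dcol_smooth. Qed.

Let db y : U y -> derivable_mx b y. Proof. exact: smooth_mx_derivable. Qed.

Let Dbb y : U y -> mxd Db b y = levi l y *m v^H.
Proof. by move=> Uy; rewrite -(levi_mul_adj Uo ls). Qed.

Let Dh : mxd D (mxd Db b) z = mxd D (levi l) z *m v^H.
Proof.
have dl := smooth_mx_derivable (levi_smooth Uo ls) Uz.
have dv := derivable_mx_cst v^H z.
rewrite (mxd_near _ (filterS _ (open_near Uo Uz)) (Y := fun y => levi l y *m v^H)) //.
by rewrite (mxdM _ dl dv) mxd_cst mulmx0 addr0.
Qed.

(** The first variation vanishes in each direction e_i. Exchanging e_i with v turns this into (D N)
    v^H = 0. Since both (D N) v^H and N v^H vanish, [h] is covariantly constant along v to first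
    order at z, as [cov2_outer] demands. *)
Let first_order : mxd D (mxd Db b) z = mxd D G z *m invmx (G z) *m h.
Proof.
have Gu := posdef_unit (G0 Uz).
have hE : h = - (psi%:C *: (G z *m v^H)).
  by have := ker; rewrite /N mulmxDl -scalemxAl => /eqP; rewrite addr_eq0 => /eqP.
have DN : mxd D N z *m v^H = 0.
  apply/matrixP => i j; rewrite [RHS]mxE ord1.
  have e w := first_variation_kernel Uo Uz Ns NH N0 ker w.
  have := e (delta_mx 0 i); rewrite (mul_mxd_swap Nc) // -mulmxA -rowE.
  by move=> /matrixP/(_ 0 0); rewrite !mxE.
move: DN; rewrite mxdN // mulmxDl => /eqP; rewrite addr_eq0 => /eqP DN.
rewrite Dh DN hE mulmxN -scalemxAr !mulmxA -[_ *m _ *m G z]mulmxA mulVmx //.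
by rewrite mulmx1 -scalemxAl.
Qed.

Let S y := levi l y + b y *m (b y)^H.
Let S1 y := mxd Db (levi l) y + (mxd Db b y *m (b y)^H + b y *m (mxd D b y)^H).

Let db' r y : U y -> derivable_mx (mxd r b) y.
Proof. exact: smooth_mx_derivable (smooth_mxd r Uo bs). Qed.

Let DbS y : U y -> mxd Db S y = S1 y.
Proof.
move=> Uy; have dl := smooth_mx_derivable (levi_smooth Uo ls) Uy.
have dbH := derivable_mx_adj (db Uy).
rewrite (mxdD _ dl (derivable_mxM (db Uy) dbH)) (mxdM _ (db Uy) dbH).
by rewrite /S1 -(mxd_adj _ (db Uy)) conj_vdir.
Qed.

Let DS : mxd D S z = mxd D (levi l) z + (mxd D b z *m (b z)^H + b z *m h^H).
Proof.
have dl := smooth_mx_derivable (levi_smooth Uo ls) Uz.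
have dbH := derivable_mx_adj (db Uz).
rewrite (mxdD _ dl (derivable_mxM (db Uz) dbH)) (mxdM _ (db Uz) dbH).
by rewrite /h -(Dbb Uz) -(mxd_adj _ (db Uz)) conj_vbdir.
Qed.

Let dS1 : derivable_mx S1 z.
Proof.
apply: derivable_mxD.
  exact: smooth_mx_derivable (smooth_mxd _ Uo (levi_smooth Uo ls)) Uz.
apply: derivable_mxD.
  exact: derivable_mxM (db' _ Uz) (derivable_mx_adj (db Uz)).
exact: derivable_mxM (db Uz) (derivable_mx_adj (db' _ Uz)).
Qed.

Let DDbS : mxd D (mxd Db S) z = mxd D (mxd Db (levi l)) z +
  (mxd D (mxd Db b) z *m (b z)^H + h *m h^H + mxd D b z *m (mxd D b z)^H +
   b z *m (mxd D (mxd Db b) z)^H).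
Proof.
have dl := smooth_mx_derivable (smooth_mxd Db Uo (levi_smooth Uo ls)) Uz.
have dbH := derivable_mx_adj (db Uz).
have dDbb := db' Db Uz; have dDb := db' D Uz; have dDbH := derivable_mx_adj dDb.
have d1 := derivable_mxM dDbb dbH; have d2 := derivable_mxM (db Uz) dDbH.
rewrite (mxd_near _ (filterS DbS (open_near Uo Uz))).
rewrite (mxdD _ dl (derivable_mxD d1 d2)) (mxdD _ d1 d2).
rewrite (mxdM _ dDbb dbH) (mxdM _ (db Uz) dDbH).
have e1 : mxd D (fun y => (b y)^H) z = h^H.
  by rewrite /h -(Dbb Uz) -(mxd_adj _ (db Uz)) conj_vbdir.
have e2 : mxd D (fun y => (mxd D b y)^H) z = (mxd D (mxd Db b) z)^H.
  by rewrite (mxd_comm _ _ Uo Uz bs) -(mxd_adj _ dDb) conj_vbdir.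
by rewrite e1 e2 (Dbb Uz) -/h !addrA.
Qed.

(** [F] is only twice derivable, so the derivability of the inner first derivative is recorded along
    with the formula. *)
Let Fterm : derivableC (dop Db (fun y => (F (l y))%:C)) z /\
  dop D (dop Db (fun y => (F (l y))%:C)) z =
  (derive1 (derive1 F) (l z))%:C * (dop D lc z * dop Db lc z) +
  (derive1 F (l z))%:C * hform (levi l z) v.
Proof.
have comp (F1 : R -> R) r y : derivable F1 (l y) 1 -> U y ->
    derivableC (fun y => (F1 (l y))%:C) y /\
    dop r (fun y => (F1 (l y))%:C) y = (derive1 F1 (l y))%:C * dop r lc y.
  move=> dF1 Uy.
  have E w : is_derive y w (fun y => F1 (l y)) (derive1 F1 (l y) * 'D_w l y).
    exact: is_derive_comp_real dF1 (smooth_derivable ls Uy).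
  split; first by apply: derivableC_real => w; case: (E w).
  rewrite /dop mulr_sumr; apply: eq_bigr => p _.
  rewrite (is_deriveC_val (is_deriveC_real (E p.2))).
  have -> : deriveC p.2 lc y = ('D_(p.2) l y)%:C.
    by apply: is_deriveC_val; apply: is_deriveC_real; apply: derivableP;
       exact: smooth_derivable ls Uy.
  by rewrite rmorphM mulrCA.
have E : \forall y \near z, dop Db (fun y => (F (l y))%:C) y =
    (derive1 F (l y))%:C * dop Db lc y.
  by apply: filterS (open_near Uo Uz) => y Uy; have [_ ->] := comp F Db y (@dF (l y)) Uy.
have [c1 c2] := comp (derive1 F) D z (@ddF (l z)) Uz.
have c3 : derivableC (dop Db lc) z.
  by apply: smoothC_derivable Uz; exact: smoothC_dop Uo lcs.
split.
  apply: derivableC_near (derivableCM c1 c3).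
  by apply: filterS E => y Ey; exact: esym Ey.
by rewrite (dop_near _ E) (dopM _ c1 c3) c2 (hform_levi Uo ls v Uz) mulrA.
Qed.

(** [q] stands for the time derivative of L. Differentiating [heat] along \bar v and v, the trace is
    bounded by [trvar_levi]. The F-term is F'' |D l|^2 + F' H(v, v) for the complex Hessian H, where
    the first summand is nonnegative and H(v, v) = - psi G(v, v) at the null vector. *)
Lemma local_maximum_principle :
  (psi ^+ 2 - derive1 F (l z) * psi)%:C * hform (G z) v <= hform (levi q z) v.
Proof.
have Gu y : U y -> G y \in unitmx by move=> Uy; exact: posdef_unit (G0 Uy).
have dG y : U y -> derivable_mx G y by exact: smooth_mx_derivable.
have dl y : U y -> derivable_mx (levi l) y by exact: smooth_mx_derivable (levi_smooth Uo ls).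
have dS y : U y -> derivable_mx S y.
  by move=> Uy; exact: derivable_mxD (dl y Uy) (derivable_mxM (db Uy) (derivable_mx_adj (db Uy))).
have dDbS : derivable_mx (mxd Db S) z.
  apply: derivable_mx_near dS1.
  by apply: filterS (open_near Uo Uz) => y Uy; exact: esym (DbS Uy).
pose P y := invmx (G y); pose Fl y : C := (F (l y))%:C.
have dPS y : U y -> derivableC (fun y => \tr (P y *m S y)) y.
  move=> Uy; apply: derivable_mx_tr.
  exact: derivable_mxM (derivable_mx_inv Uo Uy Gu (dG y Uy)) (dS y Uy).
have dFl y : U y -> derivableC Fl y.
  move=> Uy; apply: derivableC_real => w.
  by case: (is_derive_comp_real (@dF (l y)) (@smooth_derivable _ _ _ _ _ w ls Uy)).
have qE y : U y -> (q y)%:C = \tr (P y *m S y) + Fl y by exact: heat.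
have DbqE y : U y -> dop Db (fun y => (q y)%:C) y =
    dop Db (fun y => \tr (P y *m S y)) y + dop Db Fl y.
  move=> Uy; rewrite -(dopD _ (dPS y Uy) (dFl y Uy)); apply: dop_near.
  exact: filterS qE (open_near Uo Uy).
have PH : (P z)^H = P z by rewrite invmx_herm ?GH //; exact: Gu.
have DGH : (mxd D G z)^H = mxd Db G z.
  rewrite -(mxd_adj _ (dG z Uz)) conj_vdir; apply: mxd_near.
  exact: filterS GH (open_near Uo Uz).
have DDbGH : (mxd D (mxd Db G) z)^H = mxd D (mxd Db G) z.
  have dDbG := smooth_mx_derivable (smooth_mxd Db Uo Gs) Uz.
  rewrite -(mxd_adj _ dDbG) conj_vdir (mxd_comm D Db Uo Uz Gs); apply: mxd_near.
  apply: filterS (open_near Uo Uz) => y Uy.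
  rewrite -(mxd_adj _ (dG y Uy)) conj_vbdir; apply: mxd_near.
  exact: filterS GH (open_near Uo Uy).
have X0 := cov2_psd Uo Ns Nc Uz NH N0 ker PH DGH.
rewrite !mxdN // mxd2N in X0.
have := trvar_levi (mulVmx (Gu z Uz)) PH DGH DDbGH (b z) (mxd D b z)
  (posdef_inv (GH Uz) (G0 Uz)) K0 (GH Uz) (NH Uz) (N0 Uz) ker (erefl h) first_order X0.
have DbSz : mxd Db S z = mxd Db (levi l) z + (h *m (b z)^H + b z *m (mxd D b z)^H).
  by rewrite /h -(Dbb Uz); exact: DbS Uz.
rewrite -/(S z) -DS -DbSz -DDbS.
rewrite -(dop2_tr_inv D Uo Uz Gu Gs dS dDbS) => key.
have [dDbF FE] := Fterm.
have qcs : smoothC_on U (fun y => (q y)%:C) by exact: smoothC_real.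
have dDbq := smoothC_derivable (smoothC_dop Db Uo qcs) Uz.
(* Derivability of the first derivative of the trace is read off from [heat], as the difference of a
   smooth term and the F-term. *)
have dDbtr : derivableC (dop Db (fun y => \tr (P y *m S y))) z.
  apply: derivableC_near (derivableCD dDbq (derivableCM (derivableC_cst (-1) z) dDbF)).
  by apply: filterS (open_near Uo Uz) => y Uy; rewrite DbqE // mulN1r addrK.
rewrite (hform_levi Uo qs v Uz) (dop_near _ (filterS DbqE (open_near Uo Uz))).
rewrite (dopD _ dDbtr dDbF) FE.
have lN : hform (levi l z) v = - (psi%:C * hform (G z) v).
  by move: Nv; rewrite hformD hformZ => /eqP; rewrite addr_eq0 => /eqP.
have DbD : dop Db lc z = conjc (dop D lc z).
  rewrite -(dop_conj _ (smoothC_derivable lcs Uz)) conj_vdir; apply: dop_near.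
  by apply: filterS (open_near Uo Uz) => y _; rewrite conjcR.
have -> : (psi ^+ 2 - derive1 F (l z) * psi)%:C * hform (G z) v =
    (psi ^+ 2)%:C * hform (G z) v + (derive1 F (l z))%:C * hform (levi l z) v.
  rewrite lN; move: (psi ^+ 2) (derive1 F (l z)) (hform (G z) v) => x c g.
  by rewrite rmorphB rmorphM; ring.
rewrite DbD addrA lerD2r.
apply: le_trans key _; rewrite lerDl.
by rewrite mulr_ge0 ?mulcJ_ge0 // ler0c.
Qed.

End LocalKey.

(** * Kaehler geometry in coordinates *)

Section KahlerCoordinates.
Context {R : realType} {n : nat}.
Local Notation C := R[i].
Local Notation V := (Cn R n).
Variables (U : set V) (G : V -> 'M[C]_n).
Hypotheses (Uo : open U) (Gs : smooth_mx U G) (Gc : closed_form U G).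

Lemma d_c_lshift (i : 'I_n) (h : V -> C) : d_c (lshift n i) h = d_z i h.
Proof. by apply/funext => y; rewrite /d_c (unsplitK (inl i)). Qed.

Lemma d_c_rshift (i : 'I_n) (h : V -> C) : d_c (rshift n i) h = d_zb i h.
Proof. by apply/funext => y; rewrite /d_c (unsplitK (inr i)). Qed.

Lemma d_z0 (i : 'I_n) y : d_z i (fun=> 0 : C) y = 0.
Proof. by rewrite d_zE dop_cst. Qed.

Lemma d_zb0 (i : 'I_n) y : d_zb i (fun=> 0 : C) y = 0.
Proof. by rewrite d_zbE dop_cst. Qed.

(** In each summand of the Koszul formula, closedness of the Kaehler form makes the surviving
    derivatives cancel. Mixed second covariant derivatives of functions are therefore plain
    derivatives. *)
Lemma christoffel_mixed c (i j : 'I_n) y : U y ->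
  christoffel G c (lshift n i) (rshift n j) y = 0 /\
  christoffel G c (rshift n j) (lshift n i) y = 0.
Proof.
move=> Uy.
have Eur (a b : 'I_n) : (fun y => gC G y (lshift n a) (rshift n b)) = fun y => G y a b.
  by apply/funext => x; rewrite /gC block_mxEur.
have Eul (a b : 'I_n) : (fun y => gC G y (lshift n a) (lshift n b)) = fun=> 0.
  by apply/funext => x; rewrite /gC block_mxEul mxE.
have Edr (a b : 'I_n) : (fun y => gC G y (rshift n a) (rshift n b)) = fun=> 0.
  by apply/funext => x; rewrite /gC block_mxEdr mxE.
have Edl (a b : 'I_n) : (fun y => gC G y (rshift n a) (lshift n b)) = fun y => G y b a.
  by apply/funext => x; rewrite /gC block_mxEdl mxE.
split; rewrite /christoffel big1 ?mulr0 // => d _; rewrite -[d]splitK;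
  case: (fintype.split d) => e /=;
  rewrite ?d_c_lshift ?d_c_rshift ?Eur ?Eul ?Edr ?Edl ?d_c_lshift ?d_c_rshift
    ?d_z0 ?d_zb0.
- by rewrite (Gc Uy e j i).1 addr0 subrr mulr0.
- by rewrite add0r (Gc Uy i e j).2 subrr mulr0.
- by rewrite add0r (Gc Uy e j i).1 subrr mulr0.
- by rewrite addr0 (Gc Uy i e j).2 subrr mulr0.
Qed.

Variable l : V -> R.
Hypothesis ls : smooth_on U l.
Let lc y : C := (l y)%:C.

Lemma nabla2_mixed (i j : 'I_n) y : U y ->
  nabla2 G (lshift n i) (rshift n j) lc y = levi l y i j /\
  nabla2 G (rshift n j) (lshift n i) lc y = levi l y i j.
Proof.
move=> Uy.
have nablaE a a' : (forall c, christoffel G c a a' y = 0) ->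
    nabla2 G a a' lc y = d_c a (d_c a' lc) y.
  move=> c0; rewrite /nabla2 [X in _ - X]big1 ?subr0 // => c _.
  by rewrite c0 mul0r.
rewrite nablaE; last by move=> c; exact: (christoffel_mixed c i j Uy).1.
rewrite nablaE; last by move=> c; exact: (christoffel_mixed c i j Uy).2.
rewrite !d_c_rshift !d_c_lshift mxE; split => //.
rewrite !d_z_fun !d_zb_fun.
exact: dop_comm Uo (smoothC_real ls) Uy.
Qed.

Lemma chess_levi y : U y -> chess G lc y = levi l y.
Proof.
by move=> Uy; apply/matrixP => i j; rewrite mxE (nabla2_mixed i j Uy).1.
Qed.

Lemma laplacian_grad_tr y : U y -> laplacian G lc y + grad_sqr G lc y =
  \tr (invmx (G y) *m (levi l y + dcol l y *m (dcol l y)^H)).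
Proof.
move=> Uy.
have trE (X : 'M[C]_n) : \tr (invmx (G y) *m X) = \sum_k \sum_k' ginv G y k k' * X k k'.
  rewrite exchange_big; apply: eq_bigr => i _; rewrite mxE; apply: eq_bigr => j _.
  by [].
rewrite mulmxDr mxtraceD !trE; congr (_ + _).
  rewrite /laplacian mulr_sumr; apply: eq_bigr => k _.
  rewrite mulr_sumr; apply: eq_bigr => k' _.
  have [-> ->] := nabla2_mixed k k' Uy.
  by field.
apply: eq_bigr => k _; apply: eq_bigr => k' _.
rewrite -mulrA; congr (_ * _); rewrite mxE big_ord1 adjmE !mxE; congr (_ * _).
rewrite -d_zb_conj; last exact: smoothC_derivable (smoothC_real ls) Uy.
by congr (d_zb _ _ _); apply/funext => x; rewrite conjcR.
Qed.

Lemma bisectionalE v w y : U y -> (forall y, U y -> G y \in unitmx) ->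
  bisectional G y w v =
  hform (mxd (vdir v) G y *m invmx (G y) *m mxd (vbdir v) G y
         - mxd (vdir v) (mxd (vbdir v) G) y) w.
Proof.
move=> Uy Gu; pose P x := invmx (G x).
have dG x : U x -> derivable_mx G x by exact: smooth_mx_derivable.
have dP : derivable_mx P y by exact: derivable_mx_inv Uo Uy Gu (dG y Uy).
have dA k : derivable_mx (mxd (zdir k) G) y.
  by apply: smooth_mx_derivable Uy; exact: smooth_mxd.
pose K k l' : 'M[C]_n := mxd (zdir k) G y *m P y *m mxd (zbdir l') G y -
   mxd (zbdir l') (mxd (zdir k) G) y.
have KE i j k l' : curvature G i j k l' y = K k l' i j.
  have gE i' p : gammaK G p i' k = fun x => (mxd (zdir k) G x *m P x) i' p.
    apply/funext => x; rewrite /gammaK mxE; apply: eq_bigr => q _.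
    by rewrite mxE d_zE /ginv mulrC.
  rewrite /curvature.
  have -> : \sum_p G y p j * d_zb l' (gammaK G p i k) y =
      (mxd (zbdir l') (fun x => mxd (zdir k) G x *m P x) y *m G y) i j.
    by rewrite [RHS]mxE; apply: eq_bigr => p _; rewrite gE d_zbE mulrC mxE.
  rewrite (mxdM _ (dA k) dP) (mxd_inv _ Uo Uy Gu (dG y Uy)) mulmxDl mulmxN mulNmx.
  rewrite -!mulmxA mulVmx ?Gu // !mulmx1 /K -mulmxA.
  by rewrite -[in RHS]opprB [RHS]mxE.
have sumK : mxd (vdir v) G y *m P y *m mxd (vbdir v) G y
    - mxd (vdir v) (mxd (vbdir v) G) y =
    \sum_k \sum_l' (v 0 k * conjc (v 0 l')) *: K k l'.
  have vE (X : V -> 'M[C]_n) x : mxd (vdir v) X x = \sum_k v 0 k *: mxd (zdir k) X x.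
    apply/matrixP => i j; rewrite summxE !mxE dop_vdir; apply: eq_bigr => k _.
    by rewrite !mxE d_zE.
  have vbE (X : V -> 'M[C]_n) x :
      mxd (vbdir v) X x = \sum_k conjc (v 0 k) *: mxd (zbdir k) X x.
    apply/matrixP => i j; rewrite summxE !mxE dop_vbdir; apply: eq_bigr => k _.
    by rewrite !mxE d_zbE.
  rewrite {1}vE {1}vbE (mxd_comm _ _ Uo Uy Gs) vbE.
  have -> : \sum_k conjc (v 0 k) *: mxd (zbdir k) (mxd (vdir v) G) y =
     \sum_k \sum_l' (v 0 k * conjc (v 0 l')) *: mxd (zbdir l') (mxd (zdir k) G) y.
    rewrite exchange_big; apply: eq_bigr => l' _.
    rewrite (mxd_comm _ _ Uo Uy Gs) vE scaler_sumr; apply: eq_bigr => k _.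
    by rewrite scalerA mulrC (mxd_comm _ _ Uo Uy Gs).
  rewrite !mulmx_suml -sumrB; apply: eq_bigr => k _.
  rewrite mulmx_sumr -sumrB; apply: eq_bigr => l' _.
  by rewrite -!scalemxAl -scalemxAr scalerA /K scalerBr.
rewrite sumK /bisectional /hform.
transitivity (\sum_i \sum_j \sum_k \sum_l'
    v 0 k * conjc (v 0 l') * K k l' i j * w 0 i * conjc (w 0 j)).
  do 4 (apply: eq_bigr => ? _); rewrite KE.
  move: (K _ _ _ _) (w 0 _) (v 0 _) => a b c.
  rewrite -[Num.conj _]/(conjc _) -[Num.conj _]/(conjc _).
  by ring.
apply: eq_bigr => i _; apply: eq_bigr => j _.
rewrite summxE !mulr_suml; apply: eq_bigr => k _.
rewrite -[Num.conj (w 0 j)]/(conjc (w 0 j)) summxE !mulr_suml.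
by apply: eq_bigr => l' _; rewrite [in RHS]mxE.
Qed.

End KahlerCoordinates.

(** * Holomorphic changes of coordinates *)

Section ChangeOfCoordinates.
Context {R : realType} {n : nat}.
Local Notation C := R[i].
Local Notation V := (Cn R n).

Lemma real_dir_coord (u : V) : real_dir (\row_k coordC k u) = u.
Proof.
by apply: injective_projections; apply/rowP => k; rewrite !mxE.
Qed.

Variables (O W : set V) (phi : V -> V).
Hypotheses (Oo : open O) (Wo : open W) (phiW : forall y, O y -> W (phi y)).
Hypothesis phi_hol : forall k, holomorphic_on O (fun y => coordC k (phi y)).

Let phic k y := coordC k (phi y).

Let phis k : smoothC_on O (phic k). Proof. by have [] := phi_hol k. Qed.

(** The increment of [phi] is expanded in the real coordinate directions. Its components have the
    derivatives of [phi] as difference quotients, so [cvg_sum_incr] yields the chain rule. *)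
Lemma is_derive_change (h : V -> R) z v : smooth_on W h -> O z ->
  is_derive z v (fun y => h (phi y))
    ('D_(real_dir (\row_k deriveC v (phic k) z)) h (phi z)).
Proof.
move=> hs Oz; have Wz := phiW Oz.
set w := \row_k _.
pose e (b : 'I_n * bool) : V := if b.2 then dirx b.1 else diry b.1.
pose comp (u : 'rV[C]_n) (b : 'I_n * bool) : R :=
  if b.2 then complex.Re (u 0 b.1) else complex.Im (u 0 b.1).
pose r := [seq (k, c) | k <- enum 'I_n, c <- [:: true; false]].
pose d (s : R) : 'rV[C]_n := \row_k coordC k (phi (s *: v + z) - phi z).
have dE s : phi (s *: v + z) = \sum_(b <- r) comp (d s) b *: e b + phi z.
  have := real_dirE (d s); rewrite real_dir_coord -/r => H.
  by rewrite -[LHS](subrK (phi z)) H.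
have compE b s : comp (d s) b = (if b.2 then complex.Re (phic b.1 (s *: v + z)) -
    complex.Re (phic b.1 z) else complex.Im (phic b.1 (s *: v + z)) - complex.Im (phic b.1 z)).
  by rewrite /comp /d /phic /coordC !mxE; case: b.2.
have q b : s^-1 * comp (d s) b @[s --> 0^'] --> comp w b.
  under eq_fun do rewrite compE.
  have dk := smoothC_derivable (phis b.1) Oz.
  have [/derivableP[d1 _] /derivableP[d2 _]] := dk v.
  by rewrite /comp mxE; case: b.2; [exact: d1 | exact: d2].
have q0 b : comp (d s) b @[s --> 0^'] --> 0.
  have s0 : s @[s --> 0^'] --> (0 : R) by exact: cvg_within.
  have L : s * (s^-1 * comp (d s) b) @[s --> 0^'] --> 0 * comp w b by exact: cvgM.
  rewrite mul0r in L; refine (cvg_trans _ L); apply: near_eq_cvg; near=> s.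
  by rewrite mulVKf //; near: s; exact: nbhs_dnbhs_neq.
have De i y : W y -> derivable h y (e i).
  by move=> Wy; exact: smooth_derivable hs Wy.
have Ce i : {for phi z, continuous ('D_(e i) h)}.
  by apply: smooth_continuous Wz; exact: smooth_derive.
have L := @cvg_sum_incr _ _ _ r W h (phi z) e (fun=> phi z)
  (fun b s => comp (d s) b) (comp w) Wo Wz De Ce q0 q (cvg_cst (phi z)).
have E : 'D_(real_dir w) h (phi z) = \sum_(b <- r) comp w b * 'D_(e b) h (phi z).
  rewrite real_dirE -/r.
  by rewrite (@derive_val _ _ _ _ _ _ _ (is_derive_comb _ (comp w) Wo Wz De Ce)).
rewrite E.
have L' : s^-1 *: (((fun y => h (phi y)) \o shift z) (s *: v) - h (phi z))
    @[s --> 0^'] --> \sum_(b <- r) comp w b * 'D_(e b) h (phi z).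
  by under eq_fun do rewrite /= dE; exact: L.
by split; [apply/cvg_ex; eexists; exact: L' | exact/cvg_lim].
Unshelve. all: by end_near. Qed.

Lemma is_deriveC_change (h : V -> C) z v : smoothC_on W h -> O z ->
  is_deriveC z v (fun y => h (phi y))
   (\sum_k (deriveC v (phic k) z * d_z k h (phi z) +
            conjc (deriveC v (phic k) z) * d_zb k h (phi z))).
Proof.
move=> hs Oz; have [h1 h2] := hs.
have := deriveC_real_dir (\row_k deriveC v (phic k) z) Wo hs (phiW Oz).
rewrite dop_vdir dop_vbdir -big_split /=.
under eq_bigr do rewrite !mxE.
move=> <-; split; [exact: is_derive_change h1 Oz | exact: is_derive_change h2 Oz].
Qed.

Lemma dop_change r (h : V -> C) z : smoothC_on W h -> O z ->
  dop r (fun y => h (phi y)) z =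
  \sum_k (dop r (phic k) z * d_z k h (phi z) +
          dop r (fun y => conjc (phic k y)) z * d_zb k h (phi z)).
Proof.
move=> hs Oz; rewrite /dop.
under eq_bigr do rewrite (is_deriveC_val (is_deriveC_change _ hs Oz)) mulr_sumr.
rewrite exchange_big; apply: eq_bigr => k _.
rewrite !mulr_suml -big_split; apply: eq_bigr => p _.
rewrite (is_deriveC_val (is_deriveC_conj (derivableCP p.2 (smoothC_derivable (phis k) Oz)))).
by rewrite mulrDr !mulrA.
Qed.

Let d_zb_phi i k y : O y -> d_zb i (phic k) y = 0.
Proof. by move=> Oy; have [_ ->] := phi_hol k. Qed.

Lemma d_z_change i (h : V -> C) z : smoothC_on W h -> O z ->
  d_z i (fun y => h (phi y)) z = \sum_k d_z i (phic k) z * d_z k h (phi z).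
Proof.
move=> hs Oz; rewrite d_zE (dop_change _ hs Oz); apply: eq_bigr => k _.
rewrite -!d_zE d_z_conj; last exact: smoothC_derivable (phis k) Oz.
by rewrite d_zb_phi // conjc0 mul0r addr0.
Qed.

Lemma d_zb_change j (h : V -> C) z : smoothC_on W h -> O z ->
  d_zb j (fun y => h (phi y)) z = \sum_k conjc (d_z j (phic k) z) * d_zb k h (phi z).
Proof.
move=> hs Oz; rewrite d_zbE (dop_change _ hs Oz); apply: eq_bigr => k _.
rewrite -!d_zbE d_zb_conj; last exact: smoothC_derivable (phis k) Oz.
by rewrite d_zb_phi // mul0r add0r.
Qed.

(** No second derivative of [phi] appears: d_i falls on conjugates of holomorphic functions, which
    it annihilates. Hence the complex Hessian transforms as a tensor. *)
Lemma levi_change (h : V -> R) z : smooth_on W h -> O z ->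
  let J := \matrix_(i, k) d_z i (phic k) z in
  levi (fun y => h (phi y)) z = J *m levi h (phi z) *m J^H.
Proof.
move=> hs Oz J; apply/matrixP => i j; rewrite [LHS]mxE.
have hcs : smoothC_on W (fun x => (h x)%:C) by exact: smoothC_real.
have hks k : smoothC_on W (d_zb k (fun x => (h x)%:C)).
  by rewrite d_zb_fun; exact: smoothC_dop.
have cs k : smoothC_on O (fun y => conjc (d_z j (phic k) y)).
  by apply: smoothC_conj => //; rewrite d_z_fun; exact: smoothC_dop.
have dhk k : derivableC (fun y => d_zb k (fun x => (h x)%:C) (phi y)) z.
  by apply: is_deriveC_derivable => v; exact: is_deriveC_change.
have E : \forall y \near z, d_zb j (fun x => (h (phi x))%:C) y =
    \sum_k conjc (d_z j (phic k) y) * d_zb k (fun x => (h x)%:C) (phi y).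
  apply: filterS (open_near Oo Oz) => y Oy.
  exact: (@d_zb_change j (fun x => (h x)%:C)).
rewrite d_zE (dop_near _ E) dop_sum; last first.
  by move=> k _; exact: derivableCM (smoothC_derivable (cs k) Oz) (dhk k).
rewrite [RHS]mxE; apply: eq_bigr => k _.
rewrite (dopM _ (smoothC_derivable (cs k) Oz) (dhk k)) -!d_zE.
have -> : d_z i (fun y => conjc (d_z j (phic k) y)) z = 0.
  rewrite d_z_conj; last first.
    by apply: smoothC_derivable Oz; rewrite d_z_fun; exact: smoothC_dop.
  rewrite d_z_fun d_zbE (dop_comm _ _ Oo (phis k) Oz).
  have -> : dop (zdir j) (dop (zbdir i) (phic k)) z = dop (zdir j) (fun=> 0) z.
    apply: dop_near.
    by apply: filterS (open_near Oo Oz) => y Oy; rewrite -d_zbE d_zb_phi.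
  by rewrite dop_cst conjc0.
rewrite mul0r add0r (d_z_change _ (hks k) Oz) mulrC adjmE [J j k]mxE; congr (_ * _).
by rewrite mxE; apply: eq_bigr => p _; rewrite !mxE.
Qed.

End ChangeOfCoordinates.

(** * Continuity and perturbation of Hermitian forms *)

Section MatrixContinuity.
Context {R : realType} {T : topologicalType} {n : nat}.
Local Notation C := R[i].

Definition continuous_mx (X : T -> 'M[C]_n) (x : T) := forall i j,
  {for x, continuous (fun y => complex.Re (X y i j))} /\
  {for x, continuous (fun y => complex.Im (X y i j))}.

Lemma near_mnorm (X : T -> 'M[C]_n) x (eta : R) : continuous_mx X x -> 0 < eta ->
  \forall y \near x, mnorm (X y - X x) < eta.
Proof.
move=> Xc eta0; pose N : R := n%:R * n%:R + 1.
have N0 : 0 < N by rewrite ltr_wpDl // mulr_ge0.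
pose d := eta / N / 2.
have d0 : 0 < d by rewrite !divr_gt0.
have : \forall y \near x, forall i, forall j,
    `|complex.Re (X y i j) - complex.Re (X x i j)| < d /\
    `|complex.Im (X y i j) - complex.Im (X x i j)| < d.
  apply: filter_forall => i; apply: filter_forall => j; have [c1 c2] := Xc i j.
  move/cvgrPdist_lt: c1 => /(_ _ d0) c1; move/cvgrPdist_lt: c2 => /(_ _ d0) c2.
  by apply: filterS2 c1 c2 => y; rewrite distrC [X in _ -> X < _ -> _]distrC.
apply: filterS => y Hy; apply: (@le_lt_trans _ _ (\sum_(i < n) \sum_(j < n) (d + d))).
  apply: ler_sum => i _; apply: ler_sum => j _; rewrite !mxE.
  have [h1 h2] := Hy i j.
  have -> : complex.Re (X y i j - X x i j) = complex.Re (X y i j) - complex.Re (X x i j).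
    by case: (X y i j); case: (X x i j).
  have -> : complex.Im (X y i j - X x i j) = complex.Im (X y i j) - complex.Im (X x i j).
    by case: (X y i j); case: (X x i j).
  by rewrite lerD // ltW.
rewrite !sumr_const !card_ord -mulrnA -mulr_natr natrM /d -splitr.
rewrite mulrAC ltr_pdivrMr // ltr_pM2l // /N; lra.
Qed.

End MatrixContinuity.

Section Perturbation.
Context {R : realType} {n : nat}.
Local Notation C := R[i].
Implicit Types (S X : 'M[C]_n) (v : 'rV[C]_n).

Lemma Re_hformD S X v :
  complex.Re (hform (S + X) v) = complex.Re (hform S v) + complex.Re (hform X v).
Proof. by rewrite hformD cReD. Qed.

Lemma Re_hformZ (c : R) S v :
  complex.Re (hform (c%:C *: S) v) = c * complex.Re (hform S v).
Proof. by rewrite hformZ cReM /=; rewrite mul0r subr0. Qed.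

Lemma Re_hform_shift S X (c : R) v : complex.Re (hform (S + c%:C *: X) v) =
  complex.Re (hform S v) + c * complex.Re (hform X v).
Proof. by rewrite Re_hformD Re_hformZ. Qed.

Lemma hform_lower S v : - (mnorm S * nsq v) <= complex.Re (hform S v).
Proof. by have := hform_bound S v; rewrite ler_norml => /andP[]. Qed.

Lemma hform_upper S v : complex.Re (hform S v) <= mnorm S * nsq v.
Proof. by have := hform_bound S v; rewrite ler_norml => /andP[]. Qed.

Lemma hform_perturb S X v :
  complex.Re (hform X v) - mnorm (S - X) * nsq v <= complex.Re (hform S v).
Proof.
have E : complex.Re (hform S v) = complex.Re (hform (S - X) v) + complex.Re (hform X v).
  by rewrite -Re_hformD subrK.
have := hform_lower (S - X) v; rewrite E.
by move: (complex.Re _) (complex.Re _) (mnorm _ * _) => x y z; lra.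
Qed.

Lemma posdefP S : S^H = S ->
  posdef S <-> forall v, v != 0 -> 0 < complex.Re (hform S v).
Proof.
by move=> SH; split => H v v0; have := H v v0; rewrite hform_gt0.
Qed.

Lemma psdP S : S^H = S -> psd S <-> forall v, 0 <= complex.Re (hform S v).
Proof. by move=> SH; split => H v; have := H v; rewrite hform_ge0. Qed.

Lemma posdef_open S : S^H = S -> posdef S -> exists2 eta : R, 0 < eta &
  forall X, X^H = X -> mnorm (X - S) < eta -> posdef X.
Proof.
move=> SH S0; have [c c0 Hc] := posdef_lower SH S0.
exists c => // X XH Xc; apply/(posdefP XH) => v v0.
have := hform_perturb X S v; apply: lt_le_trans.
rewrite subr_gt0; apply: lt_le_trans (Hc v).
by rewrite ltr_pM2r // nsq_gt0.
Qed.

Lemma herm_shift S X (c : R) : S^H = S -> X^H = X -> (S + c%:C *: X)^H = S + c%:C *: X.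
Proof. by move=> SH XH; rewrite adjmD adjmZ conjcR SH XH. Qed.

Lemma posdef_shift_le S X (a b : R) : S^H = S -> X^H = X -> posdef X -> a <= b ->
  posdef (S + a%:C *: X) -> posdef (S + b%:C *: X).
Proof.
move=> SH XH X0 ab /(posdefP (herm_shift a SH XH)) H.
apply/(posdefP (herm_shift b SH XH)) => v v0.
have := H v v0; rewrite !Re_hform_shift => h.
have := (posdefP XH).1 X0 v v0 => h'.
apply: lt_le_trans h _; rewrite lerD2l; by rewrite ler_wpM2r // ltW.
Qed.

(* Either f is so large that f G dominates H outright, or f is bounded and the
   forms at nearby points can be compared. *)
Lemma initial_perturbation (H0 G0 : 'M[C]_n) (m eps : R) : 0 < eps -> 0 <= m ->
  H0^H = H0 -> G0^H = G0 -> posdef G0 -> exists2 eta : R, 0 < eta &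
  forall H1 H2 G1 (f : R), H1^H = H1 -> H2^H = H2 -> G1^H = G1 ->
    mnorm (H1 - H0) < eta -> mnorm (H2 - H0) < eta -> mnorm (G1 - G0) < eta ->
    - m <= f -> psd (H2 + (f + eps / 2)%:C *: G0) -> posdef (H1 + (f + eps)%:C *: G1).
Proof.
move=> eps0 m0 H0H G0H G00; have [c c0 Hc] := posdef_lower G0H G00.
pose B := mnorm H0 + 1; have B0 : 0 < B by rewrite ltr_wpDl // mnorm_ge0.
(* [F0] bounds |f + eps/2| when f < 2 B / c. Beyond this threshold, f times c/2 already outweighs
   the bound [B] on H1. *)
pose F0 := m + 2 * B / c + eps.
have BC0 : 0 <= 2 * B / c by rewrite divr_ge0 // ltW // mulr_gt0.
have F00 : 0 < F0 by rewrite ltr_wpDl // addr_ge0.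
(* The first two bounds keep H1 above -B and G1 above c/2. The third makes the total error (2 + F0)
   eta at most half of the gain eps c / 4 obtained from (eps/2) G1. *)
pose eta := Num.min (Num.min 1 (c / 2)) (eps * c / 8 / (2 + F0)).
have c20 : 0 < c / 2 by rewrite divr_gt0.
have ec0 : 0 < eps * c / 8 by rewrite divr_gt0 // mulr_gt0.
have F20 : 0 < 2 + F0 by rewrite addr_gt0.
have eta0 : 0 < eta by rewrite !lt_min ltr01 c20 divr_gt0.
have eta1 : eta <= 1 by rewrite !ge_min lexx.
have eta2 : eta <= c / 2 by rewrite !ge_min lexx orbT.
have eta3 : eta * (2 + F0) <= eps * c / 8.
  have e3 : eta <= eps * c / 8 / (2 + F0) by rewrite /eta ge_min lexx orbT.
  by rewrite -ler_pdivlMr.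
exists eta => // H1 H2 G1 f H1H H2H G1H h1 h2 g1 fm.
move=> /(psdP (herm_shift (f + eps / 2) H2H G0H)) ps.
apply/(posdefP (herm_shift (f + eps) H1H G1H)) => v v0.
have V := nsq_gt0 v0; have := ps v.
have := hform_perturb H1 H0 v; have := hform_perturb G1 G0 v.
have := hform_upper (H2 - H0) v; have := hform_lower H0 v; have := Hc v.
have := hform_lower (G1 - G0) v; have := hform_upper (G1 - G0) v.
have E2 : complex.Re (hform H2 v) = complex.Re (hform (H2 - H0) v) + complex.Re (hform H0 v).
  by rewrite -Re_hformD subrK.
have E3 : complex.Re (hform G1 v) = complex.Re (hform (G1 - G0) v) + complex.Re (hform G0 v).
  by rewrite -Re_hformD subrK.
have E1 : complex.Re (hform H1 v) = complex.Re (hform (H1 - H0) v) + complex.Re (hform H0 v).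
  by rewrite -Re_hformD subrK.
have := hform_lower (H1 - H0) v.
rewrite !Re_hform_shift E1 E2 E3.
have k1 : mnorm (H1 - H0) * nsq v <= eta * nsq v by rewrite ler_wpM2r // ltW.
have k2 : mnorm (H2 - H0) * nsq v <= eta * nsq v by rewrite ler_wpM2r // ltW.
have k3 : mnorm (G1 - G0) * nsq v <= eta * nsq v by rewrite ler_wpM2r // ltW.
have k4 : eta * nsq v <= 1 * nsq v by rewrite ler_wpM2r // ltW.
have k5 : eta * nsq v <= c / 2 * nsq v by rewrite ler_wpM2r // ltW.
have k6 : eta * (2 + F0) * nsq v <= eps * c / 8 * nsq v by rewrite ler_wpM2r // ltW.
have BE : mnorm H0 = B - 1 by rewrite /B addrK.
rewrite BE; move: k1 k2 k3 k4 k5 k6.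
move: (complex.Re (hform H0 v)) (complex.Re (hform G0 v)) => a0 b0.
move: (complex.Re (hform (H1 - H0) v)) (complex.Re (hform (G1 - G0) v)) => a1 b1.
move: (complex.Re (hform (H2 - H0) v)) (mnorm (H1 - H0) * _) (mnorm (H2 - H0) * _)
   (mnorm (G1 - G0) * _) => a2 p q r.
move=> k1 k2 k3 k4 k5 k6 l1 l2 l3 l4 l5 l6 _ _ l7.
have [fl|fs] := leP (2 * B / c) f.
  have fg : (2 * B / c + eps) * (c / 2 * nsq v) <= (f + eps) * (b1 + b0).
    apply: ler_pM; [by rewrite addr_ge0 // ltW | by rewrite mulr_ge0 // ltW // divr_gt0 |
      by rewrite lerD2r | lra].
  have E : 2 * B / c * (c / 2 * nsq v) = B * nsq v.
    by field; rewrite gt_eqF.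
  have : 0 < eps * (c / 2 * nsq v) by rewrite !mulr_gt0 // divr_gt0.
  rewrite mulrDl E in fg; lra.
have fb : - F0 <= f + eps / 2 /\ f + eps / 2 <= F0.
  by rewrite /F0; split; lra.
have gb : - (F0 * (eta * nsq v)) <= (f + eps / 2) * b1.
  have b1b : `|b1| <= eta * nsq v by rewrite ler_norml; apply/andP; split; lra.
  have fb' : `|f + eps / 2| <= F0 by rewrite ler_norml; case: fb => -> ->.
  have : `|(f + eps / 2) * b1| <= F0 * (eta * nsq v) by rewrite normrM ler_pM.
  by rewrite ler_norml => /andP[].
have e1 : 0 < eps * c / 4 * nsq v by rewrite mulr_gt0 // !divr_gt0 // mulr_gt0.
have e2 : eps / 2 * (c / 2 * nsq v) <= eps / 2 * (b1 + b0).
  by apply: ler_wpM2l; [rewrite divr_ge0 // ltW | lra].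
have E4 : eps / 2 * (c / 2 * nsq v) = eps * c / 4 * nsq v by field.
lra.
Qed.

End Perturbation.

(** * The complex Hessian as a function of space and time *)

Lemma is_derive_sumf (R : realType) (I : Type) (r : seq I) (h : I -> R -> R)
    (d : I -> R) (t : R) : (forall i, is_derive t (1 : R) (h i) (d i)) ->
  is_derive t (1 : R) (fun s => \sum_(i <- r) h i s) (\sum_(i <- r) d i).
Proof.
move=> hd; elim: r => [|i r IH].
  by rewrite big_nil; under eq_fun do rewrite big_nil; exact: is_derive_cst.
rewrite big_cons; under eq_fun do rewrite big_cons.
exact: is_deriveD (hd i) IH.
Qed.

Section SpaceTime.
Context {R : realType} {n : nat}.
Local Notation C := R[i].
Local Notation V := (Cn R n).
Local Notation ST := (V * R^o)%type.
Implicit Types (k : ST -> R) (W : set ST) (U : set V).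

Lemma hform_Re_sum (S : 'M[C]_n) (v : 'rV[C]_n) : complex.Re (hform S v) =
  \sum_i \sum_j (complex.Re (S i j) * complex.Re (v 0 i * conjc (v 0 j)) -
                 complex.Im (S i j) * complex.Im (v 0 i * conjc (v 0 j))).
Proof.
have ReS (I : Type) (r : seq I) (g : I -> C) :
    complex.Re (\sum_(i <- r) g i) = \sum_(i <- r) complex.Re (g i).
  by apply: (big_morph (@complex.Re R)) => // x y; exact: cReD.
rewrite /hform ReS; apply: eq_bigr => i _; rewrite ReS; apply: eq_bigr => j _.
rewrite -mulrA; exact: cReM.
Qed.

Lemma levi_explicit U (l : V -> R) z i j : open U -> smooth_on U l -> U z ->
  levi l z i j =
  (4^-1 * ('D_(dirx i) ('D_(dirx j) l) z + 'D_(diry i) ('D_(diry j) l) z)) +i*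
  (4^-1 * ('D_(dirx i) ('D_(diry j) l) z - 'D_(diry i) ('D_(dirx j) l) z)).
Proof.
move=> Uo ls Uz; have lcs : smoothC_on U (fun y => (l y)%:C) by exact: smoothC_real.
have dd u v : deriveC u (deriveC v (fun y => (l y)%:C)) z = ('D_u ('D_v l) z)%:C.
  have E : (fun y => complex.Im (deriveC v (fun y => (l y)%:C) y)) = fun=> 0.
    by apply/funext => y; exact: (derive_cst 0 y v).
  by rewrite {1}/deriveC E derive_cst.
have E u : deriveC u (dop (zbdir j) (fun y => (l y)%:C)) z =
    2^-1 * ('D_u ('D_(dirx j) l) z)%:C + 2^-1 * 'i%C * ('D_u ('D_(diry j) l) z)%:C.
  rewrite (deriveC_dop u (zbdir j) Uo lcs Uz) /zbdir big_cons big_seq1; cbn [fst snd].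
  by rewrite !dd.
rewrite mxE d_zb_fun /d_z !E.
have alg (a d b c : R) :
    2^-1 * ((2^-1 * a%:C + 2^-1 * 'i%C * b%:C) - 'i%C * (2^-1 * c%:C + 2^-1 * 'i%C * d%:C)) =
    (4^-1 * (a + d)) +i* (4^-1 * (b - c)) :> C.
  have h2 : 2^-1 = (2^-1 : R)%:C :> C by rewrite fmorphV /= rmorph_nat.
  by rewrite h2; apply/eqP; rewrite eq_complex /=; apply/andP; split; apply/eqP; field.
exact: alg.
Qed.

Lemma levi_eq U (l1 l2 : V -> R) z : open U -> (forall y, U y -> l1 y = l2 y) ->
  U z -> levi l1 z = levi l2 z.
Proof.
move=> Uo E Uz; apply/matrixP => i j; rewrite [LHS]mxE [RHS]mxE !d_zE.
apply: dop_near; apply: filterS (open_near Uo Uz) => y Uy; rewrite !d_zbE.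
by apply: dop_near; apply: filterS (open_near Uo Uy) => x Ux; rewrite E.
Qed.

(** Real and imaginary part of d_i d_{\bar j}, written with real derivatives in the space directions
    of space-time. Joint continuity in (z, t) and differentiation in t are then those of iterated
    derivatives of [k]. *)
Definition leviRe k (i j : 'I_n) x : R :=
  4^-1 * ('D_(dirx i, 0) ('D_(dirx j, 0) k) x + 'D_(diry i, 0) ('D_(diry j, 0) k) x).

Definition leviIm k (i j : 'I_n) x : R :=
  4^-1 * ('D_(dirx i, 0) ('D_(diry j, 0) k) x - 'D_(diry i, 0) ('D_(dirx j, 0) k) x).

Definition stlevi k x : 'M[C]_n := \matrix_(i, j) (leviRe k i j x +i* leviIm k i j x).

Lemma stlevi_Re k x i j : complex.Re (stlevi k x i j) = leviRe k i j x.
Proof. by rewrite mxE. Qed.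

Lemma stlevi_Im k x i j : complex.Im (stlevi k x i j) = leviIm k i j x.
Proof. by rewrite mxE. Qed.

Let cplx (q a a' b b' c c' d d' : R) : a = a' -> b = b' -> c = c' -> d = d' ->
  (q * (a + d)) +i* (q * (b - c)) = (q * (a' + d')) +i* (q * (b' - c')) :> C.
Proof. by move=> -> -> -> ->. Qed.

Lemma levi_slice W k U z t : smooth_on W k -> open U ->
  (forall y, U y -> W (y, t)) -> U z ->
  levi (fun y => k (y, t)) z = stlevi k (z, t).
Proof.
move=> ks Uo UW Uz.
have ls : smooth_on U (fun y => k (y, t)).
  exact: smooth_sub UW (@smooth_slice R V W k t ks).
have E u v : 'D_u ('D_v (fun y : V => k (y, t))) z = 'D_(u, 0) ('D_(v, 0) k) (z, t).
  exact: (congr1 (fun h => h z) (iter_derive_slice k t [:: u; v])).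
apply/matrixP => i j; rewrite (levi_explicit i j Uo ls Uz) [RHS]mxE.
exact: cplx (E _ _) (E _ _) (E _ _) (E _ _).
Qed.

Lemma stlevi_continuous W k x : smooth_on W k -> W x -> continuous_mx (stlevi k) x.
Proof.
move=> ks Wx i j.
have c u v : {for x, continuous ('D_u ('D_v k))} by have [] := ks [:: u; v] x Wx.
split.
  rewrite (funext (fun y => stlevi_Re k y i j)).
  by apply: cvgMl_tmp; apply: cvgD; exact: c.
rewrite (funext (fun y => stlevi_Im k y i j)).
by apply: cvgMl_tmp; apply: cvgB; exact: c.
Qed.

Lemma stlevi_eq W k1 k2 x : open W -> (forall y, W y -> k1 y = k2 y) -> W x ->
  stlevi k1 x = stlevi k2 x.
Proof.
move=> Wo kE Wx.
have E u v : 'D_u ('D_v k1) x = 'D_u ('D_v k2) x := iter_derive_eq [:: u; v] Wo kE Wx.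
apply/matrixP => i j; rewrite [LHS]mxE [RHS]mxE.
exact: cplx (E _ _) (E _ _) (E _ _) (E _ _).
Qed.

Lemma stlevi_herm W k x : open W -> smooth_on W k -> W x ->
  (stlevi k x)^H = stlevi k x.
Proof.
case: x => z t Wo ks Wx; pose U := [set y : V | W (y, t)].
have Uo : open U.
  rewrite openE => y Wy; have := open_near Wo Wy.
  have : (fun y' : V => (y', t : R^o)) @ y --> (y, t : R^o).
    have L1 : y' @[y' --> y] --> y by exact: cvg_id.
    have L2 : (t : R^o) @[_ --> y] --> (t : R^o) by exact: cvg_cst.
    exact: (cvg_pair L1 L2).
  exact.
rewrite -(levi_slice (U := U) ks Uo) //.
exact: levi_herm Uo (smooth_slice ks) _ Wx.
Qed.

Lemma time_line (z : V) (s : R) : s *: ((0, 1) : ST) + (z, 0) = (z, s).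
Proof.
by rewrite /GRing.add /= /add_pair /= scaler0 add0r [s *: 1]mulr1 addr0.
Qed.

Lemma is_derive_time W k z t : smooth_on W k -> W (z, t) ->
  is_derive t (1 : R) (fun s => k (z, s)) ('D_(0, 1) k (z, t)).
Proof.
move=> ks Wz.
have dk : derivable k (t *: ((0, 1) : ST) + (z, 0)) (0, 1).
  by rewrite time_line; exact: smooth_derivable ks Wz.
have := is_derive_line dk; rewrite time_line.
by under eq_fun do rewrite time_line.
Qed.

(** Two applications of the symmetry of second derivatives move the time derivative inside both
    space derivatives. *)
Lemma stlevi_time W k z t v : open W -> smooth_on W k -> W (z, t) ->
  is_derive t (1 : R) (fun s => complex.Re (hform (stlevi k (z, s)) v))
    (complex.Re (hform (stlevi ('D_(0, 1) k) (z, t)) v)).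
Proof.
move=> Wo ks Wz.
have dE a b : is_derive t (1 : R) (fun s => 'D_a ('D_b k) (z, s))
    ('D_a ('D_b ('D_(0, 1) k)) (z, t)).
  have -> : 'D_a ('D_b ('D_(0, 1) k)) (z, t) = 'D_(0, 1) ('D_a ('D_b k)) (z, t).
    have e := smooth_Schwarz ((0, 1) : ST) a Wo (smooth_derive b ks) Wz.
    apply: etrans (esym e); apply: near_eq_derive; apply: filterS (open_near Wo Wz) => y Wy.
    exact: (smooth_Schwarz b ((0, 1) : ST) Wo ks Wy).
  exact: is_derive_time (smooth_derive a (smooth_derive b ks)) Wz.
under eq_fun do rewrite hform_Re_sum.
rewrite hform_Re_sum.
apply: is_derive_sumf => i; apply: is_derive_sumf => j.
have eqd (h1 h2 : R -> R) d1 d2 : h1 = h2 -> d1 = d2 ->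
    is_derive t (1 : R) h1 d1 -> is_derive t (1 : R) h2 d2 by move=> -> ->.
have S1 : is_derive t (1 : R) (fun s => complex.Re (stlevi k (z, s) i j))
    (complex.Re (stlevi ('D_(0, 1) k) (z, t) i j)).
  have D := is_deriveZ (4^-1 : R)
    (is_deriveD (dE (dirx i, 0) (dirx j, 0)) (dE (diry i, 0) (diry j, 0))).
  exact: eqd (funext (fun s => esym (stlevi_Re k (z, s) i j))) (esym (stlevi_Re _ _ i j)) D.
have S2 : is_derive t (1 : R) (fun s => complex.Im (stlevi k (z, s) i j))
    (complex.Im (stlevi ('D_(0, 1) k) (z, t) i j)).
  have D := is_deriveZ (4^-1 : R)
    (is_deriveB (dE (dirx i, 0) (diry j, 0)) (dE (diry i, 0) (dirx j, 0))).
  exact: eqd (funext (fun s => esym (stlevi_Im k (z, s) i j))) (esym (stlevi_Im _ _ i j)) D.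
move: (complex.Re (v 0 i * _)) (complex.Im (v 0 i * _)) => p q.
under eq_fun do rewrite [_ * p]mulrC [_ * q]mulrC.
rewrite [_ * p]mulrC [_ * q]mulrC.
exact: is_deriveB (is_deriveZ _ S1) (is_deriveZ _ S2).
Qed.

End SpaceTime.

(** * One-sided limits and derivatives at a first time *)

Section RealLemmas.
Context {R : realType}.
Implicit Types (phi : R -> R) (d s t : R).

Lemma left_limit_ge0 phi t : {for t, continuous phi} -> 0 < t ->
  (forall s, 0 < s -> s < t -> 0 <= phi s) -> 0 <= phi t.
Proof.
move=> phic t0 H; rewrite leNgt; apply/negP => neg.
have : \forall s \near t, phi s < 0 by exact: (cvgr_lt _ phic _ neg).
move=> /nbhs_ballP[e /= e0 He].
pose s := Num.max (t / 2) (t - e / 2).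
have e2 : 0 < e / 2 by rewrite divr_gt0.
have st : s < t by rewrite gt_max; apply/andP; split; lra.
have s0 : 0 < s by rewrite lt_max divr_gt0.
have : phi s < 0.
  apply: He; rewrite /ball /= ger0_norm; last by rewrite subr_ge0 ltW.
  have : t - e / 2 <= s by rewrite /s le_max lexx orbT.
  by lra.
by rewrite ltNge H.
Qed.

Lemma left_min_derive_le0 phi t d : is_derive t (1 : R) phi d -> 0 < t -> phi t = 0 ->
  (forall s, 0 < s -> s < t -> 0 <= phi s) -> d <= 0.
Proof.
move=> phid t0 phit H; rewrite leNgt; apply/negP => dpos.
have dphi : derivable phi t 1 := @ex_derive _ _ _ _ _ _ _ phid.
have lim : (fun h => h^-1 *: ((phi \o shift t) (h *: 1) - phi t)) @ 0^' --> d.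
  by rewrite -(@derive_val _ _ _ _ _ _ _ phid); exact: dphi.
have near0 : nbhs (0 : R) (fun h => h != 0 -> 0 < h^-1 *: ((phi \o shift t) (h *: 1) - phi t)).
  exact: cvgr_gt _ lim _ dpos.
have /nbhs_ballP[e /= e0 He] := near0.
pose h := - Num.min (e / 2) (t / 2).
have h0 : h < 0 by rewrite oppr_lt0 lt_min !divr_gt0.
have he : - h <= e / 2 by rewrite opprK ge_min lexx.
have ht : - h <= t / 2 by rewrite opprK ge_min lexx orbT.
have := He h; rewrite /ball /= sub0r normrN ltr0_norm // phit subr0 /GRing.scale /= mulr1.
have hle : - h < e by lra.
move=> /(_ hle (ltr0_neq0 h0)).
have ps : 0 <= phi (h + t) by apply: H; lra.
rewrite ltNge => /negP; apply; rewrite nmulr_rle0 //.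
by rewrite invr_lt0.
Qed.

End RealLemmas.

(** * The Hessian form in the charts *)

Section Charts.
Context {R : realType} {n : nat} {M : topologicalType} {A : complex_atlas R n M}.
Local Notation C := R[i].
Local Notation V := (Cn R n).
Local Notation ST := (V * R^o)%type.
Variables (g : kahler_metric A) (T : \bar R) (L : M -> R -> R).
Hypothesis Ls : @smooth_spacetime R n M A T L.
Implicit Types (a b : Defs.index A).

Lemma gmx_adj a z : cod a z -> (gmx g a z)^H = gmx g a z.
Proof.
move=> cz; apply/matrixP => i j; rewrite adjmE.
by rewrite (gmx_hermitian g i j cz) conjcK.
Qed.

Lemma gmx_closed_form a : closed_form (cod a) (gmx g a).
Proof. by move=> y cy i j k; exact: gmx_closed. Qed.

Definition in_chart a (x : ST) : R := L (param a x.1) x.2.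

Definition slab a : set ST := [set x | [/\ cod a x.1, 0 < x.2 & (x.2%:E < T)%E]].

Lemma open_before : open [set t : R | (t%:E < T)%E].
Proof.
case: T => [r| |].
- under eq_set do rewrite lte_fin; exact: open_lt.
- have -> : [set t : R | (t%:E < +oo)%E] = setT by apply/seteqP; split => t //= _; exact: ltry.
  exact: openT.
- have -> : [set t : R | (t%:E < -oo)%E] = set0 by apply/seteqP; split.
  exact: open0.
Qed.

Lemma open_lifetime : open [set t : R | 0 < t /\ (t%:E < T)%E].
Proof. exact: openI (@open_gt _ _) open_before. Qed.

Lemma slab_open a : open (slab a).
Proof.
rewrite openE => x [cx x0 xT].
exists (cod a, [set t : R^o | 0 < t /\ (t%:E < T)%E]) => /=.
  split; first exact: open_near (@cod_open _ _ _ _ a) cx.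
  exact: open_near open_lifetime (conj x0 xT).
by move=> y [? []].
Qed.

Lemma smooth_slab a : smooth_on (slab a) (in_chart a).
Proof.
move=> s x Wx; have [c0 t0 tT] := Wx.
have [N [k [No Nx ks kE]]] := Ls (And3 c0 (ltW t0) tT).
have WNo : open (N `&` slab a) by apply: openI => //; exact: slab_open.
have kE' y : (N `&` slab a) y -> k y = in_chart a y.
  by move=> [Ny [cy y0 yT]]; apply: kE => //; split => //; exact: ltW.
exact: (smooth_eq WNo kE' (smooth_sub (@subIsetl _ _ _) ks) s (conj Nx Wx)).
Qed.

Lemma smooth_chart a t : 0 < t -> (t%:E < T)%E ->
  smooth_on (cod a) (fun z => in_chart a (z, t)).
Proof.
move=> t0 tT; have sub : cod a `<=` [set z | slab a (z, t)] by move=> z cz; split.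
exact: smooth_sub sub (smooth_slice (t := t) (smooth_slab (a := a))).
Qed.

Lemma stlevi_slab a z t : cod a z -> 0 < t -> (t%:E < T)%E ->
  levi (fun y => in_chart a (y, t)) z = stlevi (in_chart a) (z, t).
Proof.
move=> cz t0 tT; exact: (levi_slice (smooth_slab (a := a)) (@cod_open _ _ _ _ a)).
Qed.

(** A connection-free form of [hess_plus], defined on space-time so that the time may vary. *)
Definition hessform a (c : R) (x : ST) : 'M[C]_n := stlevi (in_chart a) x + c%:C *: gmx g a x.1.

Lemma hess_plus_hessform a t c z : cod a z -> 0 < t -> (t%:E < T)%E ->
  hess_plus g L a t c z = hessform a c (z, t).
Proof.
move=> cz t0 tT; rewrite /hess_plus /hessform -stlevi_slab //; congr (_ + _).
have ls := smooth_chart (a := a) t0 tT.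
exact: (chess_levi (@cod_open _ _ _ _ a) (@gmx_closed_form a) ls cz).
Qed.

Lemma hessform_herm a c x : slab a x -> (hessform a c x)^H = hessform a c x.
Proof.
move=> Wx; have [cx _ _] := Wx.
rewrite /hessform; apply: herm_shift (gmx_adj cx).
have := stlevi_herm (@slab_open a) (@smooth_slab a) Wx.
exact.
Qed.

(* Under a holomorphic change of coordinates with Jacobian J, both the Levi form
   and the metric transform by S |-> J S J^H. *)
Lemma hessform_psd_change a b c z t : cod a z -> dom b (param a z) -> 0 < t -> (t%:E < T)%E ->
  psd (hessform b c (chart b (param a z), t)) -> psd (hessform a c (z, t)).
Proof.
move=> cz dz t0 tT.
pose O := cod a `&` param a @^-1` dom b; pose phi y := chart b (param a y).
have Oo : open O.
  rewrite openE => y [cy dy]; apply: filterI; first exact: open_near (@cod_open _ _ _ _ a) cy.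
  have pc : {for y, continuous (param a)} := param_continuous cy.
  apply: pc; apply: open_nbhs_nbhs; split => //; exact: dom_open.
have Oz : O z by [].
have phiW y : O y -> cod b (phi y) by move=> [_ dy]; exact: chart_cod.
have phi_hol k : holomorphic_on O (fun y => coordC k (phi y)).
  exact: transition_holomorphic.
have hs := smooth_chart (a := b) t0 tT.
have := levi_change Oo (@cod_open _ _ _ _ b) phiW phi_hol hs Oz.
set J := \matrix_(i, k) _ => /= JE.
have GE : gmx g a z = J *m gmx g b (phi z) *m J^H.
  apply/matrixP => i j; rewrite (gmx_transition g cz dz) [RHS]mxE exchange_big.
  apply: eq_bigr => q _; rewrite mxE mulr_suml; apply: eq_bigr => p _.
  by rewrite adjmE !mxE mulrAC.
have lE : levi (fun y => in_chart a (y, t)) z = J *m levi (fun y => in_chart b (y, t)) (phi z) *m J^H.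
  rewrite -JE; apply: (levi_eq Oo _ Oz) => y [cy dy].
  by rewrite /in_chart /= chartK.
have -> : hessform a c (z, t) = J *m hessform b c (phi z, t) *m J^H.
  rewrite /hessform -!stlevi_slab //; last exact: phiW.
  by rewrite lE [gmx g a _]GE mulmxDr mulmxDl -scalemxAr -scalemxAl.
exact: psd_congr.
Qed.

End Charts.

(** * The maximum principle *)

Section StrictStep.
Context {R : realType} {n : nat} {M : topologicalType} {A : complex_atlas R n M}.
Local Notation C := R[i].
Variables (g : kahler_metric A) (T : \bar R) (L : M -> R -> R) (F psi : R -> R).
Hypothesis g_bisectional : nonneg_bisectional g.
Hypothesis L_solution : heat_solution g T L F.
Hypotheses (dF : forall u : R, derivable F u 1) (ddF : forall u : R, derivable (derive1 F) u 1).
Hypothesis F_convex : forall u : R, 0 <= derive1 (derive1 F) u.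
Implicit Types (a b : Defs.index A).

Let Ls : @smooth_spacetime R n M A T L. Proof. by case: L_solution. Qed.

Lemma in_chart_heat a t z : 0 < t -> (t%:E < T)%E -> cod a z ->
  ('D_(0, 1) (in_chart L a) (z, t : R^o))%:C =
  \tr (invmx (gmx g a z) *m (levi (fun y => in_chart L a (y, t)) z +
     dcol (fun y => in_chart L a (y, t)) z *m (dcol (fun y => in_chart L a (y, t)) z)^H)) +
  (F (in_chart L a (z, t)))%:C.
Proof.
move=> t0 tT cz; have [_ /(_ a z t cz t0 tT) heat] := L_solution.
have ls := smooth_chart Ls (a := a) t0 tT.
have dt : is_derive t (1 : R) (fun s => in_chart L a (z, s)) ('D_(0, 1) (in_chart L a) (z, t)).
  by apply: is_derive_time (smooth_slab Ls (a := a)) _; split.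
rewrite derive1E (@derive_val _ _ _ _ _ _ _ dt) in heat.
rewrite heat; congr (_ + _).
exact: (laplacian_grad_tr (@cod_open _ _ _ _ a) (@gmx_closed_form _ _ _ _ g a) ls cz).
Qed.

(** Tested in a single chart, which keeps openness a local matter. [positive_psd] passes to any
    other chart in the weaker form of semidefiniteness, for which invertibility of the Jacobian does
    not enter. *)
Definition positive (t : R) (p : M) :=
  exists2 a, dom a p & posdef (hessform g L a (psi t) (chart a p, t : R^o)).

Lemma positive_psd a z t : cod a z -> 0 < t -> (t%:E < T)%E -> positive t (param a z) ->
  psd (hessform g L a (psi t) (z, t : R^o)).
Proof.
move=> cz t0 tT [b db pos].
exact: (hessform_psd_change Ls cz db t0 tT (posdef_psd pos)).
Qed.

Lemma hessform_time_derive a z t dpsi v : cod a z -> 0 < t -> (t%:E < T)%E ->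
  is_derive t (1 : R) psi dpsi ->
  is_derive t (1 : R) (fun s => complex.Re (hform (hessform g L a (psi s) (z, s : R^o)) v))
    (complex.Re (hform (levi (fun y => 'D_(0, 1) (in_chart L a) (y, t : R^o)) z) v) +
     dpsi * complex.Re (hform (gmx g a z) v)).
Proof.
move=> cz t0 tT dp.
have ls := smooth_slab Ls (a := a); have Wx : slab T a (z, t) by split.
have -> : levi (fun y => 'D_(0, 1) (in_chart L a) (y, t : R^o)) z =
    stlevi ('D_(0, 1) (in_chart L a)) (z, t).
  have qs : smooth_on (slab T a) ('D_(0, 1) (in_chart L a)) by exact: smooth_derive ls.
  refine (@levi_slice _ _ (slab T a) _ (cod a) z t qs (@cod_open _ _ _ _ a) _ cz).
  by move=> y cy; split.
under eq_fun do rewrite Re_hform_shift.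
have d1 := stlevi_time v (slab_open (a := a)) ls Wx.
have d2 (c : R) : is_derive t (1 : R) (fun s => psi s * c) (dpsi * c).
  have -> : (fun s => psi s * c) = c \*: psi by apply/funext => s; exact: mulrC.
  by rewrite mulrC; exact: is_deriveZ.
have := is_deriveD d1 (d2 (complex.Re (hform (gmx g a z) v))).
exact.
Qed.

Lemma positive_step t : 0 < t -> (t%:E < T)%E -> derivable psi t 1 ->
  (forall p, 0 < psi t ^+ 2 - derive1 F (L p t) * psi t + derive1 psi t) ->
  (forall s, 0 < s -> s < t -> forall p, positive s p) ->
  forall p, positive t p.
Proof.
move=> t0 tT dpsi strict before p.
have [a dp] := atlas_cover A p; exists a => //.
have cz : cod a (chart a p) by exact: chart_cod.
set z := chart a p in cz *.
have ls := smooth_slab Ls (a := a).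
have fH y : cod a y -> (hessform g L a (psi t) (y, t))^H = hessform g L a (psi t) (y, t).
  by move=> cy; exact: (@hessform_herm _ _ _ _ g T L Ls a (psi t) (y, t) (And3 cy t0 tT)).
have dpsi' : is_derive t (1 : R) psi (derive1 psi t) by rewrite derive1E; exact: derivableP.
have early y v s : cod a y -> 0 < s -> s < t ->
    0 <= complex.Re (hform (hessform g L a (psi s) (y, s : R^o)) v).
  move=> cy s0 st; have sT : (s%:E < T)%E by apply: lt_trans tT; rewrite lte_fin.
  have := positive_psd cy s0 sT (before s s0 st _).
  rewrite psdP; first by apply.
  exact: (@hessform_herm _ _ _ _ g T L Ls a (psi s) (y, s) (And3 cy s0 sT)).
(* For each fixed vector, the value at time t is the left limit of the nonnegative earlier
   values. *)
have N0 y : cod a y -> psd (hessform g L a (psi t) (y, t)).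
  move=> cy; apply/(psdP (fH y cy)) => v.
  have d := hessform_time_derive v cy t0 tT dpsi'.
  have dd := @ex_derive _ _ _ _ _ _ _ d.
  apply: (left_limit_ge0 (phi := fun s => complex.Re (hform (hessform g L a (psi s) (y, s : R^o)) v))) => //.
    exact/differentiable_continuous/derivable1_diffP.
  by move=> s s0 st; exact: early.
apply/(posdefP (fH z cz)) => v v0; rewrite lt_neqAle eq_sym.
rewrite (psdP (fH z cz)).1 ?andbT; last exact: N0.
apply/eqP => v_null.
have Nv : hform (hessform g L a (psi t) (z, t)) v = 0.
  by apply/eqP; rewrite eq_complex v_null hform_herm_Im ?fH //= !eqxx.
have Gu y : cod a y -> gmx g a y \in unitmx by move=> cy; apply: posdef_unit; exact: gmx_posdef.
have K0 : psd (mxd (vdir v) (gmx g a) z *m invmx (gmx g a z) *m mxd (vbdir v) (gmx g a) z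
    - mxd (vdir v) (mxd (vbdir v) (gmx g a)) z).
  move=> w; rewrite -(bisectionalE (@cod_open _ _ _ _ a) (gmx_smooth g a) v w cz Gu).
  exact: g_bisectional.
have sE y : cod a y -> hessform g L a (psi t) (y, t) =
    levi (fun x => in_chart L a (x, t)) y + (psi t)%:C *: gmx g a y.
  by move=> cy; rewrite (stlevi_slab Ls).
have qs : smooth_on (cod a) (fun y => 'D_(0, 1) (in_chart L a) (y, t : R^o)).
  have sub : cod a `<=` [set y | slab T a (y, t)] by move=> y cy; split.
  exact: smooth_sub sub (smooth_slice (t := t) (smooth_derive _ ls)).
have mp := local_maximum_principle (@cod_open _ _ _ _ a) cz (smooth_chart Ls t0 tT) qs
  (gmx_smooth g a) (@gmx_adj _ _ _ _ g a) (@gmx_posdef _ _ _ _ g a)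
  (@gmx_closed_form _ _ _ _ g a) dF ddF (F_convex _)
  (fun y cy => in_chart_heat t0 tT cy) (fun y cy => eq_ind _ _ (N0 y cy) _ (sE y cy))
  (eq_trans (congr1 (fun S => hform S v) (esym (sE z cz))) Nv) K0.
have := left_min_derive_le0 (hessform_time_derive v cz t0 tT dpsi') t0 v_null
  (fun s s0 st => early z v s cz s0 st).
move: mp; rewrite lecE => /andP[_].
rewrite cReM /= mul0r subr0.
have Gv : 0 < complex.Re (hform (gmx g a z) v) 
  by apply: (posdefP (gmx_adj g cz)).1 => //; exact: gmx_posdef.
have pE : param a z = p by exact: chartK.
have := strict p; rewrite /in_chart /= pE => st.
have := mulr_gt0 st Gv.
move: (complex.Re _) (complex.Re _) => x y; lra.
Qed.

End StrictStep.

Section ContinuousMatrices.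
Context {R : realType} {S T : topologicalType} {n : nat}.
Local Notation C := R[i].

Lemma continuous_mx_comp (f : S -> T) (X : T -> 'M[C]_n) x :
  {for x, continuous f} -> continuous_mx X (f x) -> continuous_mx (fun y => X (f y)) x.
Proof.
move=> fc Xc i j; have [c1 c2] := Xc i j.
by split; [exact: (continuous_comp fc c1) | exact: (continuous_comp fc c2)].
Qed.

Lemma continuous_mx_shift (c : T -> R) (X Y : T -> 'M[C]_n) x : {for x, continuous c} ->
  continuous_mx X x -> continuous_mx Y x -> continuous_mx (fun y => X y + (c y)%:C *: Y y) x.
Proof.
move=> cc Xc Yc i j; have [c1 c2] := Xc i j; have [d1 d2] := Yc i j.
have ReE y : complex.Re ((X y + (c y)%:C *: Y y) i j) =
    complex.Re (X y i j) + c y * complex.Re (Y y i j).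
  by rewrite !mxE cReD cReM /= mul0r subr0.
have ImE y : complex.Im ((X y + (c y)%:C *: Y y) i j) =
    complex.Im (X y i j) + c y * complex.Im (Y y i j).
  by rewrite !mxE cImD cImM /= mul0r addr0.
split; [rewrite (funext ReE) | rewrite (funext ImE)].
  exact: continuousD c1 (continuousM cc d1).
exact: continuousD c2 (continuousM cc d2).
Qed.

End ContinuousMatrices.

(** * Induction over a time interval *)

Section RealInduction.
Context {R : realType}.

(** The infimum of the failing times is positive by the initial hypothesis and satisfies P by the
    second one; the third then contradicts its being the infimum. The second hypothesis will be
    [positive_step], the third [positive_open]. *)
Lemma real_induction (P : R -> Prop) (t1 : R) : (\forall t \near 0^'+, P t) ->
  (forall t, 0 < t -> t <= t1 -> (forall s, 0 < s -> s < t -> P s) -> P t) ->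
  (forall t, 0 < t -> t <= t1 -> P t -> \forall s \near t, P s) ->
  forall t, 0 < t -> t <= t1 -> P t.
Proof.
move=> Pinit Pclosed Popen t t0 tt1; apply: contrapT => nP.
pose B := [set s | [/\ 0 < s, s <= t1 & ~ P s]].
have Bt : B t by [].
have near0 : nbhs (0 : R) (fun s => 0 < s -> P s) by exact: Pinit.
have /nbhs_ballP[d /= d0 Hd] := near0.
have Bd s : B s -> d <= s.
  move=> [s0 _ nPs]; rewrite leNgt; apply/negP => sd; apply: nPs; apply: Hd => //.
  by rewrite /ball /= sub0r normrN gtr0_norm.
have Blb : has_lbound B by exists d => s; exact: Bd.
have Binf : has_inf B by split=> //; exists t.
pose i := inf B.
have di : d <= i by apply: lb_le_inf => [|s]; [exists t | exact: Bd].
have i0 : 0 < i by exact: lt_le_trans di.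
have it : i <= t1 by apply: le_trans tt1; exact: ge_inf.
have Pi : P i.
  apply: Pclosed => // s s0 si; apply: contrapT => nPs.
  have : i <= s by apply: ge_inf => //; split=> //; exact: ltW (lt_le_trans si it).
  by rewrite leNgt si.
have /nbhs_ballP[e /= e0 He] := Popen i i0 it Pi.
have [b Bb bi] := inf_adherent e0 Binf.
have ib : i <= b by exact: ge_inf.
have [_ _] := Bb; apply; apply: He; rewrite /ball /= distrC ger0_norm ?subr_ge0 //.
by rewrite ltrBlDl.
Qed.

Lemma ge0_small_perturb (x c : R) : 0 <= c -> (forall e, 0 < e -> 0 <= x + e * c) -> 0 <= x.
Proof.
move=> c0 H; rewrite leNgt; apply/negP => x0.
have c1 : 0 < c + 1 by rewrite ltr_wpDl.
have e0 : 0 < - x / (c + 1) by rewrite divr_gt0 // oppr_gt0.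
have := H _ e0; have : - x / (c + 1) * (c + 1) = - x by rewrite divfK // gt_eqF.
rewrite mulrDr mulr1; lra.
Qed.

End RealInduction.

(** * Openness of positivity and its start at t = 0 *)

Section Persistence.
Context {R : realType} {n : nat} {M : topologicalType} {A : complex_atlas R n M}.
Local Notation C := R[i].
Local Notation V := (Cn R n).
Local Notation ST := (V * R^o)%type.
Variables (g : kahler_metric A) (T : \bar R) (L : M -> R -> R) (f : R -> R).
Hypothesis Ls : @smooth_spacetime R n M A T L.
Hypothesis T_gt0 : (0%:E < T)%E.
Implicit Types (a b : Defs.index A) (psi : R -> R).

Lemma near_lifetime (t : R) : 0 < t -> (t%:E < T)%E -> \forall s \near t, 0 < s /\ (s%:E < T)%E.
Proof. by move=> t0 tT; apply: open_nbhs_nbhs; split=> //; exact: open_lifetime. Qed.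

Lemma near0_lifetime : \forall t \near (0 : R)^'+, 0 < t /\ (t%:E < T)%E.
Proof.
have H : nbhs (0 : R) [set t : R | (t%:E < T)%E].
  by apply: open_nbhs_nbhs; split=> //; exact: open_before.
near=> t; split; near: t; first exact: nbhs_right_gt.
exact: cvg_within H.
Unshelve. all: by end_near. Qed.

Lemma metric_continuous a z : cod a z -> continuous_mx (gmx g a) z.
Proof.
by move=> cz i j; have [s1 s2] := gmx_smooth g a i j; split; apply: smooth_continuous cz.
Qed.

Lemma positive_open psi t p : 0 < t -> (t%:E < T)%E -> {for t, continuous psi} ->
  positive g L psi t p -> \forall q \near p & s \near t, positive g L psi s q.
Proof.
move=> t0 tT pc [a dp pos]; pose x0 := (p, t).
have cz : cod a (chart a p) by exact: chart_cod.
pose gam (x : M * R) : ST := (chart a x.1, x.2).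
have gamc : {for x0, continuous gam}.
  have c1 : {for x0, continuous (fun x : M * R => chart a x.1)}.
    by apply: continuous_comp; [exact: cvg_fst | exact: chart_continuous].
  have c2 : {for x0, continuous (fun x : M * R => x.2)} by exact: cvg_snd.
  exact: (cvg_pair c1 c2).
pose Phi (x : M * R) := hessform g L a (psi x.2) (gam x).
have Wx : slab T a (gam x0) by split.
have Phic : continuous_mx Phi x0.
  apply: continuous_mx_shift.
  - by apply: continuous_comp; [exact: cvg_snd | exact: pc].
  - exact: continuous_mx_comp gamc (stlevi_continuous (smooth_slab Ls (a := a)) Wx).
  - apply: (continuous_mx_comp (f := fun x : M * R => chart a x.1)).
      by apply: continuous_comp; [exact: cvg_fst | exact: chart_continuous].
    exact: metric_continuous.
have [eta eta0 H] := posdef_open (hessform_herm g Ls (psi t) Wx) pos.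
have near_dom : \forall x \near x0, dom a x.1 /\ (0 < x.2 /\ (x.2%:E < T)%E).
  exists (dom a, [set s : R | 0 < s /\ (s%:E < T)%E]) => /=.
    split; last exact: near_lifetime.
    by apply: open_nbhs_nbhs; split=> //; exact: dom_open.
  by move=> x [].
have : \forall x \near x0, positive g L psi x.2 x.1.
  apply: filterS2 near_dom (near_mnorm Phic eta0) => -[q s] /= [dq [s0 sT]] close.
  have cq : cod a (chart a q) by exact: chart_cod.
  have sH := @hessform_herm _ _ _ _ g T L Ls a (psi s) (chart a q, s) (And3 cq s0 sT).
  have posq : posdef (hessform g L a (psi s) (chart a q, s)) := H _ sH close.
  by exists a; [exact: dq | exact: posq].
exact.
Qed.

Lemma time_extension a z : cod a z -> exists (N : set ST) (k : ST -> R),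
  [/\ open N, N (z, 0), smooth_on N k &
    forall x, N x -> slab T a x -> stlevi (in_chart L a) x = stlevi k x].
Proof.
move=> cz; have [N [k [No Nz ks kE]]] := Ls (a := a) (z := (z, 0)) (And3 cz (lexx _) T_gt0).
exists N, k; refine (And4 No Nz ks _) => x Nx Wx.
have WNo : open (N `&` slab T a) by apply: openI => //; exact: slab_open.
apply: (stlevi_eq WNo _ (conj Nx Wx)) => y [Ny [cy y0 yT]].
exact: esym (kE y Ny (And3 cy (ltW y0) yT)).
Qed.

Lemma nbhs_line (z : V) (P : set ST) : nbhs (z, 0 : R^o) P -> \forall t \near (0 : R)^'+, P (z, t).
Proof.
move=> [[X Y] /= [Xz Y0] XY].
have Y0' : \forall t \near (0 : R)^'+, Y t by apply: cvg_within; exact: Y0.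
apply: filterS Y0' => t Yt; apply: XY; split=> //=; exact: nbhs_singleton.
Qed.

Hypothesis L_initial : hess_ineq_initial g L f.

(** Test the initial condition at one point, with e = 1, on one nonzero vector v: (f + 1) g(v, v) is
    at least - H(v, v), where the Hessian value H(v, v) stays bounded as t -> 0+. Such a vector
    exists because n > 0. *)
Lemma initial_lower_bound a z : (0 < n)%N -> cod a z ->
  exists2 m, 0 <= m & \forall t \near (0 : R)^'+, - m <= f t.
Proof.
have alg (mu q x y w : R) : mu <= q -> y <= `|y| -> x <= mu -> 0 <= x + y + w ->
  - w <= `|y| + q by move: `|y| => u; lra.
have alg' (u w : R) : - (w + 1) <= u -> - (u + 1) <= w by lra.
move=> n0 cz; have [N [k [No Nz ks slE]]] := time_extension cz.
pose H0 := stlevi k (z, 0); have kc : continuous_mx (stlevi k) (z, 0) := stlevi_continuous ks Nz.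
pose v : 'rV[C]_n := const_mx 1.
have v0 : v != 0.
  by apply/eqP => /rowP/(_ (Ordinal n0))/eqP; rewrite !mxE oner_eq0.
pose c := complex.Re (hform (gmx g a z) v).
have c0 : 0 < c.
  by apply: (posdefP (gmx_adj g cz)).1 => //; exact: gmx_posdef.
pose h0 := `|complex.Re (hform H0 v)| + nsq v.
have h00 : 0 <= h0 by rewrite /h0 addr_ge0 ?nsq_ge0.
exists (h0 / c + 1); first by rewrite addr_ge0 // divr_ge0 // ltW.
have nc : nbhs (z, 0 : R^o) (fun x => mnorm (stlevi k x - H0) < 1) := near_mnorm kc ltr01.
near=> t.
have [t0 tT] : 0 < t /\ (t%:E < T)%E by near: t; exact: near0_lifetime.
have Nt : N (z, t) by near: t; apply: nbhs_line; exact: open_near No Nz.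
have cl : mnorm (stlevi k (z, t) - H0) < 1.
  by near: t; exact: nbhs_line nc.
have ps : psd (hess_plus g L a t (f t + 1) z) by near: t; exact: L_initial cz 1 ltr01.
have Wx : slab T a (z, t) by split.
move: ps; rewrite (hess_plus_hessform g Ls _ cz t0 tT) /hessform (slE _ Nt Wx) => ps.
have := ps v; rewrite lecE => /andP[_]; rewrite Re_hform_shift /= -/c.
have := hform_upper (stlevi k (z, t) - H0) v.
have E : complex.Re (hform (stlevi k (z, t)) v) =
    complex.Re (hform (stlevi k (z, t) - H0) v) + complex.Re (hform H0 v).
  by rewrite -Re_hformD subrK.
rewrite E; have := ler_norm (complex.Re (hform H0 v)).
have : mnorm (stlevi k (z, t) - H0) * nsq v <= 1 * nsq v by rewrite ler_wpM2r ?ltW // nsq_gt0.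
rewrite mul1r => h1 h2 h3 h4.
have : - (f t + 1) * c <= h0.
  by rewrite mulNr; exact: alg h1 h2 h3 h4.
rewrite -ler_pdivlMr // => h5; exact: alg' h5.
Unshelve. all: by end_near. Qed.

(** The initial condition concerns a single point z, with no uniformity in z. Used there with eps/2,
    it is carried to all nearby points by [initial_perturbation], which spends the other eps/2 on
    the variation of Hessian and metric. *)
Lemma positive_initial psi (eps t1 m : R) (p : M) : 0 < eps -> 0 < t1 -> 0 <= m ->
  (\forall t \near (0 : R)^'+, - m <= f t) ->
  (forall t, 0 < t -> t <= t1 -> f t + eps <= psi t) ->
  \forall q \near p & t \near (0 : R)^'+, positive g L psi t q.
Proof.
move=> eps0 t10 m0 fm fpsi; have [a dp] := atlas_cover A p.
have cz : cod a (chart a p) by exact: chart_cod.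
set z := chart a p in cz.
have [N [k [No Nz ks slE]]] := time_extension cz.
pose H0 := stlevi k (z, 0); have kc : continuous_mx (stlevi k) (z, 0) := stlevi_continuous ks Nz.
have [eta eta0 H] := initial_perturbation eps0 m0 (stlevi_herm No ks Nz) (gmx_adj g cz)
  (@gmx_posdef _ _ _ _ g a z cz).
pose Q (x : ST) := N x /\ mnorm (stlevi k x - H0) < eta.
have Q0 : nbhs (z, 0 : R^o) Q.
  by apply: filterI; [exact: open_near No Nz | exact: near_mnorm kc eta0].
have [[X Y] /= [Xz Y0] XY] := Q0.
pose P1 q := dom a q /\ X (chart a q) /\ mnorm (gmx g a (chart a q) - gmx g a z) < eta.
have near1 : nbhs p P1.
  apply: filterI; first by apply: open_nbhs_nbhs; split=> //; exact: dom_open.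
  have cc : {for p, continuous (chart a)} := chart_continuous dp.
  apply: filterI; first exact: cc.
  have gc : nbhs z (fun y => mnorm (gmx g a y - gmx g a z) < eta).
    exact: near_mnorm (metric_continuous cz) eta0.
  exact: cc gc.
pose P2 t := [/\ 0 < t /\ (t%:E < T)%E, Y t, Q (z, t), - m <= f t &
  t <= t1 /\ psd (hess_plus g L a t (f t + eps / 2) z)].
have near2 : \forall t \near (0 : R)^'+, P2 t.
  near=> t; split; near: t.
  - exact: near0_lifetime.
  - by apply: cvg_within; exact: Y0.
  - exact: nbhs_line.
  - exact: fm.
  - near=> t; split; near: t; first exact: nbhs_right_le.
    by apply: L_initial; rewrite ?divr_gt0.
exists (P1, P2) => // -[q t] /= [[dq [Xq gq]] [[t0 tT] Yt [Nz' cl0] ft [tt1 ps]]].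
have cq : cod a (chart a q) by exact: chart_cod.
have [Nq clq] : Q (chart a q, t) by apply: XY; split.
have Wq : slab T a (chart a q, t) by split.
have Wz : slab T a (z, t) by split.
move: ps; rewrite (hess_plus_hessform g Ls _ cz t0 tT) /hessform (slE _ Nz' Wz) => ps.
have pos := H _ _ _ (f t) (stlevi_herm No ks Nq) (stlevi_herm No ks Nz') (gmx_adj g cq)
  clq cl0 gq ft ps.
exists a; first exact: dq.
rewrite /hessform (slE _ Nq Wq).
exact: (posdef_shift_le (stlevi_herm No ks Nq) (gmx_adj g cq)
  (@gmx_posdef _ _ _ _ g a _ cq) (fpsi t t0 tt1) pos).
Unshelve. all: by end_near. Qed.

End Persistence.

(** * An upper bound for F'(L) - 2 f *)

Section ReactionBound.
Context {R : realType} {n : nat} {M : topologicalType} {A : complex_atlas R n M}.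
Local Notation V := (Cn R n).
Local Notation ST := (V * R^o)%type.
Variables (T : \bar R) (L : M -> R -> R) (F f : R -> R).
Hypothesis Ls : @smooth_spacetime R n M A T L.
Hypothesis M_compact : compact [set: M].
Hypothesis ddF : forall u : R, derivable (derive1 F) u 1.
Hypothesis df : forall t : R, 0 < t -> (t%:E < T)%E -> derivable f t 1.

(** Compactness is applied to M x [0, t1], including t = 0. There L has a smooth extension, and f,
    entering with a negative sign, has only to be bounded below. *)
Lemma reaction_bound (t1 m : R) : (t1%:E < T)%E -> (\forall t \near (0 : R)^'+, - m <= f t) ->
  exists C, forall p t, 0 < t -> t <= t1 -> derive1 F (L p t) - 2 * f t <= C.
Proof.
move=> t1T fm; pose K : set (M * R) := [set: M] `*` `[0, t1].
have Kc : compact K by apply: compact_setX => //; exact: segment_compact.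
pose P (C : R) (x : M * R) := 0 < x.2 -> x.2 <= t1 -> derive1 F (L x.1 x.2) - 2 * f x.2 <= C.
have H : \forall C \near +oo, K `<=` P C.
  apply: ((compact_near_coveringP K).1 Kc R (pinfty_nbhs R) P) => -[p t] [_ /=].
  rewrite in_itv /= => /andP[t0 tt1].
  have [a dp] := atlas_cover A p.
  have cz : cod a (chart a p) by exact: chart_cod.
  have sT (s : R) : s <= t1 -> (s%:E < T)%E by move=> st; apply: le_lt_trans t1T; rewrite lee_fin.
  have [N [k [No Nz ks kE]]] := Ls (a := a) (z := (chart a p, t)) (And3 cz t0 (sT t tt1)).
  pose x0 := (p, t); pose gam (x : M * R) : ST := (chart a x.1, x.2).
  have gamc : {for x0, continuous gam}.
    have c1 : {for x0, continuous (fun x : M * R => chart a x.1)}.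
      by apply: continuous_comp; [exact: cvg_fst | exact: chart_continuous].
    have c2 : {for x0, continuous (fun x : M * R => x.2)} by exact: cvg_snd.
    exact: (cvg_pair c1 c2).
  have kc : {for x0, continuous (fun x => k (gam x))}.
    exact: continuous_comp gamc (smooth_continuous ks Nz).
  have Fc : {for k (gam x0), continuous (derive1 F)}.
    exact/differentiable_continuous/derivable1_diffP.
  have hc : {for x0, continuous (fun x => derive1 F (k (gam x)))} := continuous_comp kc Fc.
  pose c0 := derive1 F (k (gam x0)).
  have c01 : c0 < c0 + 1 by rewrite ltrDl.
  have near1 : nbhs x0 (fun x => derive1 F (k (gam x)) < c0 + 1).
    exact: cvgr_lt _ hc _ c01.
  have near2 : nbhs x0 (fun x => N (gam x)) := gamc _ (open_near No Nz).
  (* At t = 0 the lower bound is the given [m]; at a positive time, continuity of f gives f > f t -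
     1 nearby. *)
  have [B HB] : exists B, nbhs t (fun s => 0 < s -> - B <= f s).
    move: t0; rewrite le_eqVlt => /orP[/eqP <-|t0]; first by exists m; exact: fm.
    have fc : {for t, continuous f}.
      by apply/differentiable_continuous/derivable1_diffP; apply: df => //; exact: sT.
    have ft : f t - 1 < f t by rewrite gtrDl oppr_lt0.
    exists (1 - f t); have : \forall s \near t, f t - 1 < f s by exact: cvgr_gt _ fc _ ft.
    by apply: filterS => s fs _; rewrite opprB ltW.
  have near3 : nbhs x0 (fun x => dom a x.1 /\ (0 < x.2 -> - B <= f x.2)).
    exists (dom a, fun s => 0 < s -> - B <= f s) => /=; last by move=> x [].
    by split=> //; apply: open_nbhs_nbhs; split=> //; exact: dom_open.
  pose P2 : set R := fun C => c0 + 1 + 2 * B <= C.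
  have near4 : \forall C \near +oo, P2 C by exact: nbhs_pinfty_ge (num_real _).
  exists (fun x => derive1 F (k (gam x)) < c0 + 1 /\ (N (gam x) /\
    (dom a x.1 /\ (0 < x.2 -> - B <= f x.2))), P2).
    by split=> //=; apply: filterI => //; exact: filterI.
  move=> [[q s] C] /= [[h1 [h2 [dq h3]]] h4] s0 st.
  have cq : cod a (chart a q) by exact: chart_cod.
  have e := kE (gam (q, s)) h2 (And3 cq (ltW s0) (sT s st)).
  rewrite /= chartK // in e; rewrite e in h1.
  have := h3 s0; rewrite /P2 in h4.
  move: (derive1 F _) h1 => d h1; lra.
have [C HC] := filter_ex H; exists C => p t t0 tt1.
by apply: (HC (p, t)) => //; split=> //=; rewrite in_itv /= tt1 ltW.
Qed.

End ReactionBound.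

(** * Persistence of the inequality up to an arbitrary time *)

Lemma is_derive_expR_scale (R : realType) (K s : R) :
  is_derive s (1 : R) (fun r => expR (K * r)) (K * expR (K * s)).
Proof.
have d1 : is_derive s (1 : R) (fun r : R => K * r) (K * 1).
  exact: (is_deriveZ K (is_derive_id s (1 : R))).
have dl := @ex_derive _ _ _ _ _ _ _ d1; have dv := @derive_val _ _ _ _ _ _ _ d1.
have de : derivable expR (K * s) 1 by [].
have E : derive1 expR (K * s) * 'D_1 (fun r : R => K * r) s = K * expR (K * s).
  by rewrite derive1E derive_val dv mulr1 mulrC.
by rewrite -E; exact: is_derive_comp_real de dl.
Qed.

Theorem theorem1p6 (R : realType) (n : nat) (M : topologicalType)
    (A : complex_atlas R n M) (g : kahler_metric A)
    (T : \bar R) (L : M -> R -> R) (F f : R -> R)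
    (M_compact : compact [set: M])
    (g_bisectional : nonneg_bisectional g)
    (T_gt0 : (0%:E < T)%E)
    (L_solution : heat_solution g T L F)
    (F_derivable : forall u : R, derivable F u 1)
    (F'_derivable : forall u : R, derivable (derive1 F) u 1)
    (F_convex : forall u : R, 0 <= derive1 (derive1 F) u)
    (f_derivable : forall t : R, 0 < t -> (t%:E < T)%E -> derivable f t 1)
    (f_ineq : forall (p : M) (t : R), 0 < t -> (t%:E < T)%E ->
       0 <= f t ^+ 2 - derive1 F (L p t) * f t + derive1 f t)
    (L_initial : hess_ineq_initial g L f) :
  forall t : R, 0 < t -> (t%:E < T)%E -> hess_ineq g L f t.
Proof.
move=> t1 t10 t1T a z cz; have [Ls _] := L_solution.
(* In dimension 0 the form is an empty sum, and there is no nonzero vector from which to bound f. *)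
case: (posnP n) => [n0|n0].
  move=> v; rewrite /hform big1 // => i _; exfalso.
  by have : (nat_of_ord i < 0)%N by rewrite -n0; exact: ltn_ord.
have [m m0 fm] := initial_lower_bound Ls T_gt0 L_initial n0 cz.
have [C HC] := reaction_bound Ls M_compact F'_derivable f_derivable t1T fm.
(* With K >= 0 the factor [expR (K * s)] is at least 1, so psi >= f + eps, as [positive_initial]
   requires. *)
pose K := Num.max C 0.
have K0 : 0 <= K by rewrite le_max lexx orbT.
have CK : C <= K by rewrite le_max lexx.
have sT (s : R) : s <= t1 -> (s%:E < T)%E by move=> st; apply: le_lt_trans t1T; rewrite lee_fin.
have cover := (compact_near_coveringP [set: M]).1 M_compact.
have pos (eps : R) : 0 < eps ->
    forall p, positive g L (fun s => f s + eps * expR (K * s)) t1 p.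
  move=> eps0; set psi := fun s : R => _.
  have dpsi s : 0 < s -> (s%:E < T)%E ->
      is_derive s (1 : R) psi (derive1 f s + eps * (K * expR (K * s))).
    move=> s0 sT'; have d1 := derivableP (f_derivable s s0 sT'); rewrite derive1E.
    exact: is_deriveD d1 (is_deriveZ eps (is_derive_expR_scale K s)).
  apply: (real_induction (P := fun s => forall p, positive g L psi s p) (t1 := t1)) => //.
  - have fpsi s : 0 < s -> s <= t1 -> f s + eps <= psi s.
      move=> s0 _; rewrite /psi lerD2l -[leLHS]mulr1 ler_pM2l //.
      by apply: le_trans (expR_ge1Dx _); rewrite lerDl mulr_ge0 // ltW.
    have : \forall s \near (0 : R)^'+, [set: M] `<=` positive g L psi s.
      (* Compactness turns positivity near each point for small times into a common time interval
         for all of M. *)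
      apply: (cover R _ (positive g L psi)) => p _.
      exact: (positive_initial Ls T_gt0 L_initial p eps0 t10 m0 fm fpsi).
    by apply: filterS => s Hs p; exact: Hs.
  - move=> s s0 st before.
    have d := dpsi s s0 (sT s st).
    apply: (positive_step g_bisectional L_solution F_derivable F'_derivable F_convex s0
      (sT s st) (@ex_derive _ _ _ _ _ _ _ d) _ before) => p.
    rewrite [derive1 psi s]derive1E (@derive_val _ _ _ _ _ _ _ d) /psi.
    have := f_ineq p s s0 (sT s st); have := HC p s s0 st.
    have e0 : 0 < eps * expR (K * s) by rewrite mulr_gt0 // expR_gt0.
    rewrite [eps * (K * _)]mulrCA.
    move: (derive1 F _) (derive1 f s) (f s) (eps * _) e0 => D f' fs e e0 h1 h2.
    (* Here [e] is eps exp(K s) and D - 2 f <= C <= K, so the second factor is at least [e], hence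
       positive; this excess makes the inequality assumed for f strict for psi. *)
    have h3 : 0 < e * (2 * fs + e - D + K) by apply: mulr_gt0 => //; lra.
    have -> : (fs + e) ^+ 2 - D * (fs + e) + (f' + K * e) =
      (fs ^+ 2 - D * fs + f') + e * (2 * fs + e - D + K) by ring.
    lra.
  - move=> s s0 st Ps; have d := dpsi s s0 (sT s st).
    have pc : {for s, continuous psi}.
      exact/differentiable_continuous/derivable1_diffP/(@ex_derive _ _ _ _ _ _ _ d).
    have : \forall r \near s, [set: M] `<=` positive g L psi r.
      apply: (cover R (nbhs s) (positive g L psi)) => p _.
      exact: (positive_open Ls s0 (sT s st) pc (Ps p)).
    by apply: filterS => r Hr p; exact: Hr.
have Wx : slab T a (z, t1) by split.
rewrite (hess_plus_hessform g Ls _ cz t10 t1T).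
apply/(psdP (hessform_herm g Ls _ Wx)) => v.
have G0 : 0 <= complex.Re (hform (gmx g a z) v).
  by apply: (psdP (gmx_adj g cz)).1; apply: posdef_psd; exact: gmx_posdef.
(* At the fixed time t1 the perturbation is eps times a constant independent of eps, so it
   disappears as eps tends to 0. *)
apply: (ge0_small_perturb (c := expR (K * t1) * complex.Re (hform (gmx g a z) v))).
  by rewrite mulr_ge0 // expR_ge0.
move=> eps eps0; have := positive_psd L_solution cz t10 t1T (pos eps eps0 _).
move=> /(psdP (hessform_herm g Ls _ Wx))/(_ v); rewrite !Re_hform_shift.
by rewrite mulrDl addrA mulrA.
Qed.
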